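(* Let $d\ge 1$ be an integer, $\alpha\ge 1$, $0<\delta<1$, $\rho,\mu>0$. There exists $\varepsilon_0=\varepsilon_0(d,\rho,\mu,\alpha,\delta)>0$ such that for every $\varepsilon\in(0,\varepsilon_0)$, every $\omega\in\Omega_{\rho,\mu}$ and every $\alpha$-Hölder monotone function $f\colon\mathbb R\to[-\infty,+\infty)$ there exist a $1$-periodic function $E\colon\mathbb R\to[-\infty,+\infty)$, strictly increasing on $[0,1)$, and a $1$-periodic measurable function $\psi\colon\mathbb R\to\ell^2(\mathbb Z^d)$ such that $$H(x)\psi(x)=E(x)\psi(x)\quad\text{for all }x\in\mathbb R,$$ and, for all $x\in\mathbb R$, $$\|\psi(x)\|_{\ell^2(\mathbb Z^d)}=1,\qquad |\psi(x;\mathbf 0)-1|<\varepsilon^{1-\delta},\qquad |\psi(x;\mathbf n)|\le\varepsilon^{(1-\delta)|\mathbf n|}\ \text{ for }|\mathbf n|\ne 0 .$$ If $f$ is Lipschitz monotone, then $E$ is also Lipschitz monotone.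
   Context: Notation. $|\mathbf n|=|n_1|+\dots+|n_d|$ for $\mathbf n\in\mathbb Z^d$; $\{e_{\mathbf n}\}$ is the standard basis of $\ell^2(\mathbb Z^d)$; $\psi(x;\mathbf n)=\langle\psi(x),e_{\mathbf n}\rangle$; $\|t\|=\mathrm{dist}(t,\mathbb Z)$ for $t\in\mathbb R$. Monotone functions. A function $f\colon\mathbb R\to[-\infty,+\infty)$ is $\alpha$-Hölder monotone if it is $1$-periodic and $f(y)-f(x)\ge (y-x)^\alpha$ for $0\le x\le y<1$. For $\alpha=1$ it is called Lipschitz monotone. The value $-\infty$ is allowed only at integer points. Frequencies. $\Omega_{\rho,\mu}=\{\omega\in[0,1)^d:\ \|\mathbf n\cdot\omega\|\ge e^{-\rho|\mathbf n|^{1/(1+\mu)}}\ \text{for all }\mathbf n\in\mathbb Z^d\setminus\{\mathbf 0\}\}$. Operators. On $\ell^2(\mathbb Z^d)$, $(H(x)\psi)(\mathbf n)=\varepsilon(\Delta\psi)(\mathbf n)+f(x+\omega\cdot\mathbf n)\psi(\mathbf n)$, where $(\Delta\psi)(\mathbf n)=\sum_{|\mathbf m-\mathbf n|=1}\psi(\mathbf m)$ (self-adjoint on its natural domain). Infinite values. If $f(0)=-\infty$ and $x+\omega\cdot\mathbf n\in\mathbb Z$ for some (necessarily unique) $\mathbf n$, then $H(x)$ is understood in the sense of infinite coupling: $e_{\mathbf n}$ is an eigenvector with generalized eigenvalue $-\infty$, and on the orthogonal complement of $e_{\mathbf n}$ the operator acts as the compression of $\varepsilon\Delta+f(x+\omega\cdot)$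 to that complement. *)

(* Defs.v *)
From HB Require Import structures.
From mathcomp Require Import all_boot all_order all_algebra.
From mathcomp Require Import all_classical all_reals all_analysis.
From mathcomp Require Import complex.

Set Implicit Arguments.
Unset Strict Implicit.
Unset Printing Implicit Defensive.

Import Order.TTheory GRing.Theory Num.Theory.

Local Open Scope classical_set_scope.
Local Open Scope complex_scope.
Local Open Scope ring_scope.

(* A site n of Z^d is a row vector n : 'rV[int]_d. *)

Definition l1norm d (n : 'rV[int]_d) : nat := (\sum_(i < d) `|n ord0 i|)%N.

Definition zdot (R : realType) d (n : 'rV[int]_d) (omega : 'rV[R]_d) : R :=
  \sum_(i < d) (n 0 i)%:~R * omega 0 i.

(* dist(t, Z) *)
Definition dist_int (R : realType) (t : R) : R :=
  inf [set `|t - k%:~R| | k in [set: int]].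

Definition diophantine (R : realType) d (rho mu : R) : set 'rV[R]_d :=
  [set omega : 'rV[R]_d | (forall i, 0 <= omega 0 i < 1) /\
    forall n : 'rV[int]_d, n != 0 ->
      expR (- (rho * ((l1norm n)%:R `^ (1 + mu)^-1)))
        <= dist_int (zdot n omega)].

Definition periodic1 (R : realType) (T : Type) (g : R -> T) :=
  forall x, g (x + 1) = g x.

(* The increment condition is in additive form, because -oo - -oo = -oo in
   \bar R: where f x = -oo the condition is void, as it should be. *)
Definition holder_monotone (R : realType) (alpha : R) (f : R -> \bar R) :=
  [/\ forall x, (f x < +oo)%E,
      periodic1 f,
      forall x, f x = -oo%E -> exists k : int, x = k%:~R
    & forall x y, 0 <= x -> x <= y -> y < 1 ->
        (f x + ((y - x) `^ alpha)%:E <= f y)%E].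

Definition lipschitz_monotone (R : realType) (f : R -> \bar R) :=
  holder_monotone 1 f.

Section l2.
Context (R : realType) (d : nat).

Definition modulus (z : R[i]) : R := ComplexField.Normc.normc z.

Definition l2normsq (u : 'rV[int]_d -> R[i]) : \bar R :=
  \esum_(n in [set: 'rV[int]_d]) (modulus (u n) ^+ 2)%:E.

Record l2 := L2 {
  l2_val :> 'rV[int]_d -> R[i] ;
  l2_fin : (l2normsq l2_val < +oo)%E }.

Definition l2norm (u : 'rV[int]_d -> R[i]) : R :=
  Num.sqrt (fine (l2normsq u)).

Lemma l2normsq0 : (l2normsq (fun=> 0%R) < +oo)%E.
Proof.
rewrite /l2normsq esum1 ?ltry// => n _.
by rewrite /modulus ComplexField.Normc.normc0 expr0n.
Qed.

HB.instance Definition _ := gen_eqMixin l2.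
HB.instance Definition _ := gen_choiceMixin l2.
HB.instance Definition _ := isPointed.Build l2 (L2 l2normsq0).

Definition l2_open : set (set l2) :=
  [set U | forall u : l2, U u -> exists2 r : R, 0 < r &
     forall v : l2, l2norm (fun n => v n - u n) < r -> U v].

(* l2(Z^d) with the Borel sigma-algebra of its norm topology *)
Definition l2_borel := g_sigma_algebraType l2_open.

End l2.

Section operator.
Context (R : realType) (d : nat).
Implicit Types (u : 'rV[int]_d -> R[i]) (V : 'rV[int]_d -> \bar R).

(* The index set is finite, so this \sum over a classical set is not degenerate. *)
Definition laplacian u (n : 'rV[int]_d) : R[i] :=
  \sum_(m \in [set m | l1norm (m - n) = 1%N]) u m.

(* The operator eps * Delta + V, where the sites with V n = -oo have infinite
   coupling: it is the compression to the orthogonal complement of these e_n,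
   that is, to the functions that vanish at these sites. *)
Definition in_domain V u : Prop :=
  [/\ (l2normsq u < +oo)%E,
      forall n, V n = -oo%E -> u n = 0
    & (l2normsq (fun n => (fine (V n))%:C * u n)%R < +oo)%E].

Definition schrodinger (eps : R) V u (n : 'rV[int]_d) : R[i] :=
  if V n == -oo%E then 0 else eps%:C * laplacian u n + (fine (V n))%:C * u n.

(* H u = E u. The generalized eigenvalue -oo has as its eigenvectors the
   multiples of e_n, for n a site with V n = -oo. *)
Definition eigen_equation (eps : R) V (E : \bar R) u : Prop :=
  match E with
  | e%:E => in_domain V u /\ forall n, schrodinger eps V u n = e%:C * u n
  | -oo%E => exists2 n, V n = -oo%E &
      exists c : R[i], forall m, u m = if m == n then c else 0
  | +oo%E => False
  end.

Definition potential (f : R -> \bar R) (omega : 'rV[R]_d) (x : R)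
    (n : 'rV[int]_d) : \bar R := f (x + zdot n omega).

End operator.

(* Main.v *)
(** The frequency is first replaced by a rational one, [a / N].  On the [N]
sites of Z/N the potential becomes an increasing sequence with
[V i + gam (j - i) <= V j], and since translation by [k] sites wraps around
only at the [k] top sites, min-max gives the ordered eigenvalues of
[t Delta + V] the very same gaps.  With the Diophantine condition, the gap
between the eigenvalues attached to two sites is bounded below by a
subexponential function of their distance.  Localization of the [j]-th
eigenvector at [j] follows by continuity in the coupling [t], from 0 to [eps]:
Green's identity for the [j]-th and [k]-th eigenvectors on the ball around [k]
of half the distance from [k] to [j] improves a bound
[2 * b (|k - j|)] to [b (|k - j|)], where
[b s = eps ^ ((1 - delta) s + delta/2 s^beta)], [beta = 1/(1 + mu)]: the
concavity of [s^beta] absorbs the small denominator.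

A limit [N -> oo] along an ultrafilter gives a family of localized
eigenfunctions indexed by the orbit of [x].  Diagonal dominance makes them
unique, so that [E] and [psi] are functions of the potential alone; the gaps
pass to the limit and make [E] as monotone as [f]; and [psi] is continuous at
all but countably many points, hence measurable. *)

(* An orbit is dense modulo 1, so its eigenvalues cannot be numbered in increasing order; hence the
   detour through finite models. The function [f] enters only through lower bounds on gaps: Green's
   identity eliminates the potential, so [eps0] does not depend on [f].

   An exponent linear in the distance would gain nothing when a path is cut in two. The term in
   [s^beta] creates a gain of order [s^beta], the same order as the logarithm of the small
   denominators, and this gain is multiplied by [|ln eps|]; a small [eps] therefore wins at all
   distances at once.

   Finite models carry real potentials, so a value -oo is replaced by values that tend to -oo with
   the size of the model. To compare [E] at two points that share no orbit, both must live in the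
   same model; models therefore hold finitely many base points. The Lipschitz claim concerns the
   same [E], so the profile is fixed by [alpha] while gaps are proved for every exponent [alpha']
   between 1 and [alpha]. *)
Require Import Defs.
From HB Require Import structures.
From mathcomp Require Import all_boot all_order all_algebra.
From mathcomp Require Import all_classical all_reals all_analysis.
From mathcomp Require Import complex.
From mathcomp Require Import spectral ring lra zify.
Import Order.TTheory GRing.Theory Num.Theory.

Set Implicit Arguments.
Unset Strict Implicit.
Unset Printing Implicit Defensive.

Local Open Scope complex_scope.
Local Open Scope ring_scope.

(** * Comparison of ordered eigenvalues *)

Section MinMax.
Local Open Scope sesquilinear_scope.
Variables (C : numClosedFieldType) (N : nat).
Implicit Types (M U : 'M[C]_N) (lam : 'I_N -> C) (x y : 'rV[C]_N).

Definition qform M x : C := (x *m M *m x^t*) 0 0.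

Definition eigenbasis M lam U :=
  U *m U^t* = 1%:M /\ U *m M = diag_mx (\row_i lam i) *m U.

Lemma norm2E x : (x *m x^t*) 0 0 = \sum_i `|x 0 i| ^+ 2.
Proof. by rewrite mxE; apply: eq_bigr => i _; rewrite !mxE normCK. Qed.

Lemma qform_eigenbasis M lam U x : eigenbasis M lam U ->
  qform M (x *m U) = \sum_i lam i * `|x 0 i| ^+ 2.
Proof.
move=> [UU UM]; rewrite /qform -(mulmxA x) UM trmx_mul map_mxM !mulmxA.
rewrite -(mulmxA _ U) UU mulmx1 mxE; apply: eq_bigr => i _.
by rewrite mul_mx_diag !mxE normCK mulrCA mulrA [x 0 i * lam i]mulrC.
Qed.

Lemma exists_row_orth k l (B : 'M[C]_(k, N)) (Q : 'M[C]_(N, l)) :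
  (l < k)%N -> exists2 y : 'rV[C]_k, y != 0 & y *m B *m Q = 0.
Proof.
move=> lk; have : kermx (B *m Q) != 0.
  rewrite -mxrank_eq0 mxrank_ker subn_eq0 -ltnNge.
  by rewrite (leq_ltn_trans (rank_leq_col _)).
move=> /rowV0Pn[y /sub_kermxP yk y0]; exists y => //.
by rewrite -mulmxA.
Qed.

(** Courant-Fischer with one explicit trial vector. Some nonzero [x] has [x *m S] in the span of the
    first [j + 1] eigenvectors of [M'], is orthogonal to the first [i] eigenvectors of [M] and
    vanishes on [W]; its two Rayleigh quotients give the two sides of the claim. *)
Lemma eigenvalue_interlacing M M' lam lam' U U' (S : 'M[C]_N) (W : {set 'I_N})
    (c : C) (i j : 'I_N) :
  eigenbasis M lam U -> eigenbasis M' lam' U' ->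
  (forall a, lam a \is Num.real) -> (forall a, lam' a \is Num.real) ->
  c \is Num.real ->
  {homo lam : a b / (a <= b)%N >-> a <= b} ->
  {homo lam' : a b / (a <= b)%N >-> a <= b} ->
  S *m S^t* = 1%:M ->
  (forall x, (forall w, w \in W -> x 0 w = 0) ->
     qform M x + c * (x *m x^t*) 0 0 <= qform M' (x *m S)) ->
  (i + #|W| <= j)%N -> lam i + c <= lam' j.
Proof.
move=> b b' rl rl' rc hl hl' SS hq ij.
have jN : (j.+1 <= N)%N by [].
have iN : (i <= N)%N by apply: ltnW.
pose emb (k : 'I_j.+1) : 'I_N := widen_ord jN k.
pose B := rowsub emb U' *m S^t*.
(* The [i + #|W|] linear conditions on [x], fewer than the [j + 1] rows of [B]. *)
pose Q := row_mx (colsub (widen_ord iN) (U^t*))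
  (colsub (fun w : 'I_#|W| => enum_val w) (1%:M : 'M[C]_N)).
have [y y0 yBQ] := exists_row_orth B Q (ij : (i + #|W| < j.+1)%N).
have [x xE] : exists x, x = y *m B by exists (y *m B).
(* [y] padded with zeros: the coordinates of [x *m S] in the eigenbasis [U']. *)
pose z : 'rV[C]_N := \row_k (if insub (val k) is Some k' then y 0 k' else 0).
have zemb k : z 0 (emb k) = y 0 k.
  by rewrite mxE; case: insubP => [k' _ e|]; [congr (y _ _); apply/val_inj|rewrite /= ltn_ord].
have z0 (k : 'I_N) : (j < k)%N -> z 0 k = 0.
  by move=> jk; rewrite mxE; case: insubP => // k' /=; rewrite ltnS leqNgt jk.
have xS : x *m S = z *m U'.
  have SS' : S^t* *m S = 1%:M by apply: mulmx1C.
  rewrite xE /B mulmxA -(mulmxA _ (S^t*)) SS' mulmx1.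
  apply/rowP => k; rewrite !mxE.
  rewrite (bigID (fun a : 'I_N => (a < j.+1)%N)) /=.
  rewrite [X in _ = _ + X]big1 ?addr0; last first.
    by move=> a; rewrite -leqNgt => /z0 ->; rewrite mul0r.
  rewrite (big_ord_narrow jN); apply: eq_bigr => a _; rewrite mxE -[widen_ord _ _]/(emb a) zemb.
  by [].
have xx : (x *m x^t*) 0 0 = \sum_k `|z 0 k| ^+ 2.
  rewrite -norm2E; congr (_ 0 0).
  have -> : x *m x^t* = x *m S *m (x *m S)^t*.
    by rewrite (trmx_mul x S) map_mxM mulmxA -(mulmxA x) SS mulmx1.
  by rewrite xS (trmx_mul z U') map_mxM mulmxA -(mulmxA z) b'.1 mulmx1.
have zpos : 0 < \sum_k `|z 0 k| ^+ 2.
  rewrite lt_neqAle sumr_ge0 ?andbT => [|k _]; last exact: exprn_ge0.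
  apply: contra y0; rewrite eq_sym psumr_eq0 => [/allP h|k _]; last exact: exprn_ge0.
  apply/eqP/rowP => k; rewrite mxE -zemb; apply/eqP.
  have := h (emb k) (mem_index_enum _).
  by rewrite expf_eq0 /= normr_eq0.
have [w wE] : exists w, w = x *m U^t* by exists (x *m U^t*).
have xw : x = w *m U.
  by rewrite wE -mulmxA (mulmx1C b.1) mulmx1.
have w0 (k : 'I_N) : (k < i)%N -> w 0 k = 0.
  move=> ki; have := yBQ; rewrite -xE /Q mul_mx_row -[RHS]row_mx0 => /eq_row_mx[+ _].
  move=> /rowP/(_ (Ordinal ki)); rewrite wE mxE [RHS]mxE => e; rewrite mxE -[RHS]e.
  by apply: eq_bigr => a _; rewrite !mxE; congr (_ * (U _ a)^*); apply: val_inj.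
have xW (k : 'I_N) : k \in W -> x 0 k = 0.
  move=> kW; have := yBQ; rewrite -xE /Q mul_mx_row -[RHS]row_mx0 => /eq_row_mx[_].
  move=> /rowP/(_ (enum_rank_in kW k)); rewrite mxE [RHS]mxE => e; rewrite -[RHS]e.
  rewrite (bigD1 k) //= !mxE enum_rankK_in // eqxx mulr1 big1 ?addr0 // => a ak.
  by rewrite !mxE enum_rankK_in // (negPf ak) mulr0.
have ww : \sum_k `|w 0 k| ^+ 2 = \sum_k `|z 0 k| ^+ 2.
  rewrite -xx -norm2E; congr (_ 0 0).
  by rewrite [in RHS]xw (trmx_mul w U) map_mxM mulmxA -(mulmxA w) b.1 mulmx1.
have := hq x xW; rewrite xx xS {1}xw (qform_eigenbasis _ b) (qform_eigenbasis _ b').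
move=> h.
rewrite -(ler_pM2r zpos) mulrDl.
apply: le_trans (le_trans h _).
  rewrite lerD2r -ww mulr_sumr; apply: ler_sum => k _.
  have [ki|ik] := ltnP k i; first by rewrite w0 // normr0 expr0n !mulr0.
  by rewrite ler_wpM2r ?exprn_ge0 // hl.
rewrite mulr_sumr; apply: ler_sum => k _.
have [jk|kj] := ltnP j k; first by rewrite z0 // normr0 expr0n !mulr0.
by rewrite ler_wpM2r ?exprn_ge0 // hl'.
Qed.

Lemma hermitian_sorted_eigenbasis M : M^t* = M ->
  exists lam U, [/\ eigenbasis M lam U, forall a, lam a \is Num.real &
    {homo lam : a b / (a <= b)%N >-> a <= b}].
Proof.
move=> MM; have Mh : M \is hermsymmx.
  by apply/is_hermitianmxP; rewrite expr0 scale1r MM.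
have Dr := hermitian_spectral_diag_real Mh.
have /orthomx_spectralP ME := hermitian_normalmx Mh.
set P := spectralmx M in ME; set D := spectral_diag M in ME Dr.
have Pu : P *m P^t* = 1%:M by apply/unitarymxP/spectral_unitarymx.
have PM : P *m M = diag_mx D *m P.
  by rewrite {1}ME !mulmxA mulmxV ?mul1mx // spectral_unit.
pose le (a b : 'I_N) := D 0 a <= D 0 b.
have Dr' a : D 0 a \is Num.real by move/mxOverP : Dr; apply.
have le_tot : total le by move=> a b; rewrite /le real_leVge.
have le_tr : transitive le by move=> a b c; apply: le_trans.
pose s := sort le (enum 'I_N).
have ss : size s = N by rewrite size_sort size_enum_ord.
case: (posnP N) => [N0|Npos].
  exists (fun a => D 0 a), P; split=> // [|a b _]; last by have := ltn_ord a; rewrite {2}N0 ltn0.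
  split=> //; rewrite PM; congr (diag_mx _ *m _).
  by apply/rowP => i; rewrite mxE.
pose x0 := Ordinal Npos.
pose sg (a : 'I_N) := nth x0 s a.
have sg_inj : injective sg.
  move=> a b /eqP; rewrite /sg nth_uniq ?ss ?ltn_ord //; first by move=> /eqP/val_inj.
  by rewrite sort_uniq enum_uniq.
exists (fun a => D 0 (sg a)), (rowsub sg P); split; first split.
- apply/matrixP => a b; have /matrixP/(_ (sg a) (sg b)) := Pu.
  rewrite !mxE (inj_eq sg_inj) => <-.
  by apply: eq_bigr => k _; rewrite !mxE.
- apply/matrixP => a b; have /matrixP/(_ (sg a) b) := PM.
  rewrite !mul_diag_mx !mxE => <-.
  by apply: eq_bigr => k _; rewrite !mxE.
- by move=> a; apply: Dr'.
- move=> a b ab; rewrite -/(le (sg a) (sg b)) /sg.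
  have st : sorted le s by apply: sort_sorted.
  have [->|nab] := eqVneq a b; first by rewrite /le.
  by apply: (sorted_leq_nth le_tr _ x0 st) => //; rewrite ?inE ?ss //; move=> ?; rewrite /le.
Qed.

End MinMax.

(** * Green's identity and the bootstrap estimate *)

Lemma double_le_half (s r : nat) : (s <= r./2)%N -> (s.*2 <= r)%N.
Proof. lia. Qed.

Lemma half_subS (r : nat) : (r - r./2.+1 <= r - r./2)%N.
Proof. lia. Qed.

Section Green.
Variables (R : realType) (T : zmodType) (d : nat) (a : 'I_d -> T).
Implicit Types (u v : T -> R) (B : seq T).

(** Stated for any abelian group with steps [a], because Green's identity is used both on residues
    modulo N and on Z^d. Steps that coincide in the group count with multiplicity. *)
Definition lap u x : R := \sum_i (u (x + a i) + u (x - a i)).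

Definition eigenfun (eps : R) (V : T -> R) (e : R) u :=
  forall x, eps * lap u x + V x * u x = e * u x.

Lemma sum_shift_pair B (c : T) (F : T -> T -> R) : uniq B ->
  \sum_(x <- B | x - c \in B) F x (x - c) = \sum_(x <- B | x + c \in B) F (x + c) x.
Proof.
move=> uB; rewrite -big_filter -[RHS]big_filter.
have p : perm_eq [seq x <- B | x - c \in B]
    [seq y + c | y <- [seq x <- B | x + c \in B]].
  apply: uniq_perm; first exact: filter_uniq.
    by rewrite map_inj_uniq ?filter_uniq //; exact: addIr.
  move=> x; rewrite mem_filter; apply/andP/mapP => [[xc xB]|[y]].
    by exists (x - c); rewrite ?mem_filter subrK // xB.
  by rewrite mem_filter => /andP[yc yB] ->; rewrite addrK.
by rewrite (perm_big _ p) big_map; apply: eq_bigr => x _; rewrite addrK.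
Qed.

(** The summand is antisymmetric in the two ends of an edge, so edges inside [B] cancel and only
    those leaving [B] remain, at most [2 d] at each site. If [B] is the whole group there are none,
    and [K = 0] gives self-adjointness. *)
Lemma green_bound B u v (K : T -> R) : uniq B ->
  (forall x i y, x \in B -> y \notin B -> (y = x + a i \/ y = x - a i) ->
     `|u x * v y - u y * v x| <= K x) ->
  (forall x, x \in B -> 0 <= K x) ->
  `|\sum_(x <- B) (u x * lap v x - v x * lap u x)|
     <= (d.*2)%:R * \sum_(x <- B) K x.
Proof.
move=> uB hK K0.
have cancel (c : T) : \sum_(x <- B | x + c \in B) (u x * v (x + c) - u (x + c) * v x) +
    \sum_(x <- B | x - c \in B) (u x * v (x - c) - u (x - c) * v x) = 0.
  rewrite (sum_shift_pair c (fun x y => u x * v y - u y * v x) uB) -big_split /=.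
  by rewrite big1 // => x _; rewrite addrC subrKA subrr.
pose G (c : T) := \sum_(x <- B | x + c \notin B) (u x * v (x + c) - u (x + c) * v x).
have -> : \sum_(x <- B) (u x * lap v x - v x * lap u x) = \sum_i (G (a i) + G (- a i)).
  transitivity (\sum_i \sum_(x <- B) ((u x * v (x + a i) - u (x + a i) * v x) +
      (u x * v (x - a i) - u (x - a i) * v x))).
    rewrite exchange_big /=; apply: eq_bigr => x _.
    by rewrite /lap !mulr_sumr -sumrB; apply: eq_bigr => i _; ring.
  apply: eq_bigr => i _; rewrite big_split /=.
  rewrite (bigID (fun x => x + a i \in B)) [X in _ + X](bigID (fun x => x - a i \in B)) /=.
  by rewrite addrACA cancel add0r.
have Gle c : (forall x, x \in B -> x + c \notin B ->
    `|u x * v (x + c) - u (x + c) * v x| <= K x) -> `|G c| <= \sum_(x <- B) K x.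
  move=> h; rewrite /G big_mkcond /= big_seq [leRHS]big_seq.
  apply: le_trans (ler_norm_sum _ _ _) _; apply: ler_sum => x xB.
  by case: ifPn => [|_]; [exact: h|rewrite normr0 K0].
apply: le_trans (ler_norm_sum _ _ _) _.
have -> : (d.*2)%:R * \sum_(x <- B) K x = \sum_(i < d) ((\sum_(x <- B) K x) *+ 2).
  by rewrite sumr_const card_ord -mulrnA mulrC mulr_natr mulnC muln2.
apply: ler_sum => i _; apply: le_trans (ler_normD _ _) _; rewrite mulr2n.
by apply: lerD; apply: Gle => x xB yB; apply: (hK _ i _ xB yB); [left|right].
Qed.

Lemma green_eigenfun B eps V e e' u v : eigenfun eps V e u -> eigenfun eps V e' v ->
  (e' - e) * \sum_(x <- B) u x * v x =
  eps * \sum_(x <- B) (u x * lap v x - v x * lap u x).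
Proof.
move=> hu hv; rewrite !mulr_sumr; apply: eq_bigr => x _.
have -> : (e' - e) * (u x * v x) = u x * (e' * v x) - v x * (e * u x) by ring.
by rewrite -hu -hv; ring.
Qed.

End Green.

(* [b] is the decay of eigenfunctions, [q] the lower bound on small denominators
   and [w] a summable weight, all as functions of the distance.  [dp_split] and
   [dp_half] express that cutting a path of length [r] in two gains a factor;
   in [dp_half], at the middle, this gain also pays for the denominator [q r]. *)
Record decay_profile (R : realType) (d : nat) (eps tau Cw : R) (q w b : nat -> R) : Prop := {
  dp_eps : 0 < eps;
  dp_tau : 0 < tau;
  dp_tauC : 40 * (d.+1)%:R * tau * Cw <= 1;
  dp_q : forall s, 0 < q s;
  dp_w : forall s, 0 < w s;
  dp_b : forall s, 0 < b s;
  dp_b0 : b 0%N = 1;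
  dp_mono : forall s r, (s <= r)%N -> b r <= b s;
  dp_split : forall s r, (1 <= s)%N -> (s.*2 <= r)%N -> b s * b (r - s)%N <= tau * w s * b r;
  dp_half : forall r, (1 <= r)%N ->
    eps * (b (r./2) * b (r - (r./2).+1)%N) <= tau * q r * w (r./2) * b r;
  dp_small : forall s, (1 <= s)%N -> b s <= tau * w s
}.

Section Bootstrap.
Variables (R : realType) (T : finZmodType) (d : nat) (a : 'I_d -> T).
Variables (nrm : T -> nat) (eps tau Cw : R) (q w b : nat -> R).
Hypothesis (nrmD : forall x y : T, (nrm (x + y)%R <= nrm x + nrm y)%N).
Hypothesis (nrmN : forall x : T, nrm (- x)%R = nrm x).
Hypothesis (nrm0 : forall x : T, (nrm x == 0%N) = (x == 0)).
Hypothesis (nrm_step : forall i, (nrm (a i) <= 1)%N).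
Hypothesis (sumw : \sum_x w (nrm x) <= Cw).
Hypothesis (dp : decay_profile d eps tau Cw q w b).

Lemma sumw_shift y : \sum_x w (nrm (x - y)%R) <= Cw.
Proof.
apply: le_trans sumw; rewrite [leRHS](reindex_inj (addIr (- y))) /=.
by apply: ler_sum.
Qed.

(** The first bound keeps the diagonal values away from 0. In the second, [16 d] comes from the
    boundary of the ball in [bootstrap] and 4 from its interior; both double on division by
    [phi k k], which is at least 1/2 in modulus. *)
Lemma tauCw : tau * Cw <= 40^-1 /\ (32 * d%:R + 8) * (tau * Cw) <= 1.
Proof.
have C0 : 0 <= Cw.
  by apply: le_trans sumw; apply: sumr_ge0 => x _; apply/ltW/(dp_w dp).
have := dp_tauC dp; have t0 := dp_tau dp.
have tC : 0 <= tau * Cw by rewrite mulr_ge0 // ltW.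
rewrite -!mulrA => h; rewrite -natr1 in h.
have d0 : 0 <= d%:R :> R by rewrite ler0n.
have dtC : 0 <= d%:R * (tau * Cw) by rewrite mulr_ge0.
by split; nra.
Qed.

Variables (V : T -> R) (lam : T -> R) (phi : T -> T -> R).
Hypothesis (ev : forall j, eigenfun a eps V (lam j) (phi j)).
Hypothesis (unit_phi : forall j, \sum_x phi j x ^+ 2 = 1).
Hypothesis (gap : forall j k : T, j != k -> q (nrm (k - j)%R) <= `|lam j - lam k|).

Lemma phi_le1 j k : `|phi j k| <= 1.
Proof.
have : phi j k ^+ 2 <= 1.
  by rewrite -(unit_phi j) (bigD1 k) //= lerDl sumr_ge0 // => ? _; exact: sqr_ge0.
by rewrite -real_normK ?num_real // expr_le1 ?normr_ge0.
Qed.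

(** Of the two factors [b] in each square, one is spent on summability, being at most [tau * w]; the
    other stays as [b 1], which later yields the closeness [eps ^ (1 - delta)] of the central value
    to 1. *)
Lemma sum_tail_sqr (c : R) j : 0 <= c ->
  (forall k, k != j -> `|phi j k| <= c * b (nrm (k - j)%R)) ->
  1 - phi j j ^+ 2 <= c ^+ 2 * tau * Cw * b 1%N.
Proof.
move=> c0 h; rewrite -(unit_phi j) (bigD1 j) //= addrAC subrr add0r.
apply: (@le_trans _ _ (\sum_(k | k != j) c ^+ 2 * tau * b 1%N * w (nrm (k - j)%R))); last first.
  rewrite -mulr_sumr.
  have -> : c ^+ 2 * tau * Cw * b 1 = c ^+ 2 * tau * b 1 * Cw by ring.
  apply: ler_wpM2l; first by rewrite !mulr_ge0 ?exprn_ge0 // ltW ?(dp_tau dp) ?(dp_b dp).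
  apply: le_trans (sumw_shift j); rewrite [leRHS](bigD1 j) //= lerDr.
  exact/ltW/(dp_w dp).
apply: ler_sum => k kj; rewrite -real_normK ?num_real //.
have n0 : (1 <= nrm (k - j)%R)%N by rewrite lt0n nrm0 subr_eq0.
have b0 := dp_b dp (nrm (k - j)%R).
apply: (@le_trans _ _ ((c * b (nrm (k - j)%R)) ^+ 2)).
  by rewrite ler_pXn2r ?nnegrE ?mulr_ge0 // ?h // ltW.
have -> : c ^+ 2 * tau * b 1%N * w (nrm (k - j)%R) =
  c ^+ 2 * (b 1%N * (tau * w (nrm (k - j)%R))) by ring.
rewrite exprMn; apply: ler_wpM2l; first exact: exprn_ge0.
rewrite expr2; apply: ler_pM; [exact: ltW|exact: ltW|exact: (dp_mono dp)|exact: (dp_small dp)].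
Qed.

Lemma phi_diag (c : R) j : 0 <= c -> c <= 2 ->
  (forall k, k != j -> `|phi j k| <= c * b (nrm (k - j)%R)) -> 2^-1 <= `|phi j j|.
Proof.
move=> c0 c2 h; have := sum_tail_sqr c0 h; have [tC _] := tauCw.
have b1 : b 1%N <= 1 by rewrite -(dp_b0 dp) (dp_mono dp).
have b1' := dp_b dp 1%N.
have c4 : c ^+ 2 <= 4 by nra.
have C0 : 0 <= Cw.
  by apply: le_trans sumw; apply: sumr_ge0 => x _; apply/ltW/(dp_w dp).
have tC0 : 0 <= tau * Cw by rewrite mulr_ge0 // ltW // (dp_tau dp).
have -> : c ^+ 2 * tau * Cw * b 1 = c ^+ 2 * (tau * Cw) * b 1 by ring.
have : c ^+ 2 * (tau * Cw) * b 1 <= 4 * 40^-1 * 1.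
  apply: ler_pM => //; [by rewrite mulr_ge0 ?exprn_ge0 |exact: ltW|].
  by apply: ler_pM => //; rewrite exprn_ge0.
move=> h1 h2; have : 4^-1 <= `|phi j j| ^+ 2 by rewrite real_normK ?num_real //; lra.
by have := normr_ge0 (phi j j); nra.
Qed.

(** In the sum of [phi k x * phi j x] over the ball, the term [x = k] is [phi j k] times a factor of
    modulus at least 1/2. Bounding the full sum by Green's identity and the gap ([I3]), and the
    other terms by [dp_split] ([I1]), isolates it; the small [tau] in both bounds removes the factor
    2. *)
Lemma bootstrap :
  (forall j k, k != j -> `|phi j k| <= 2 * b (nrm (k - j)%R)) ->
  forall j k, k != j -> `|phi j k| <= b (nrm (k - j)%R).
Proof.
move=> h j k kj.
have h' j' k' : `|phi j' k'| <= 2 * b (nrm (k' - j')%R).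
  have [->|/h//] := eqVneq k' j'.
  have /eqP -> : nrm (j' - j')%R == 0%N by rewrite nrm0 subrr.
  by rewrite (dp_b0 dp); have := phi_le1 j' j'; lra.
set r := nrm (k - j)%R; have r1 : (1 <= r)%N by rewrite lt0n nrm0 subr_eq0.
(* Green's identity for [phi k] and [phi j] on the ball [B] around [k]. *)
pose B := [seq x <- enum T | (nrm (x - k)%R <= r./2)%N].
have uB : uniq B by rewrite filter_uniq // enum_uniq.
have inB x : (x \in B) = (nrm (x - k)%R <= r./2)%N by rewrite mem_filter mem_enum andbT.
have kB : k \in B by rewrite inB subrr; have /eqP -> : nrm 0 == 0%N by rewrite nrm0.
have tri x : (r - nrm (x - k)%R <= nrm (x - j)%R)%N.
  rewrite leq_subLR /r; have -> : k - j = - (x - k) + (x - j).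
    by rewrite opprB addrA subrK.
  by rewrite -(nrmN (x - k)); exact: nrmD.
have C0 : 0 <= Cw.
  by apply: le_trans sumw; apply: sumr_ge0 => x _; apply/ltW/(dp_w dp).
have [tC dtC] := tauCw.
have e0 := dp_eps dp; have t0 := dp_tau dp; have br0 := dp_b dp r.
have qr0 := dp_q dp r.
have I1 : `|\sum_(x <- B | x != k) phi k x * phi j x| <= 4 * (tau * Cw) * b r.
  apply: le_trans (ler_norm_sum _ _ _) _.
  apply: (@le_trans _ _ (\sum_(x <- B | x != k) 4 * tau * b r * w (nrm (x - k)%R))).
    rewrite big_seq_cond [leRHS]big_seq_cond; apply: ler_sum => x /andP[].
    rewrite inB => xr xk; set s := nrm (x - k)%R in xr *.
    have s1 : (1 <= s)%N by rewrite lt0n nrm0 subr_eq0.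
    have s2 := double_le_half xr.
    have := dp_split dp s1 s2 => hs.
    have hb : `|phi j x| <= 2 * b (r - s)%N.
      apply: le_trans (h' _ _) _; rewrite ler_pM2l //; apply: (dp_mono dp); exact: tri.
    rewrite normrM.
    apply: (@le_trans _ _ ((2 * b s) * (2 * b (r - s)%N))).
      by apply: ler_pM => //; rewrite /s; exact: h'.
    by lra.
  rewrite -mulr_sumr.
  have -> : 4 * (tau * Cw) * b r = 4 * tau * b r * Cw by ring.
  apply: ler_wpM2l; first by rewrite !mulr_ge0 // ltW.
  apply: le_trans (sumw_shift k).
  rewrite big_filter_cond big_enum_cond /= [leRHS](bigID (fun x => (nrm (x - k)%R <= r./2)%N &&
    (x != k))) /=.
  by rewrite lerDl sumr_ge0 // => x _; exact/ltW/(dp_w dp).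
have I2 : `|lam j - lam k| * `|\sum_(x <- B) phi k x * phi j x| <=
   q r * (8 * d%:R * (tau * Cw) * 2 * b r).
  rewrite -normrM (green_eigenfun B (@ev k) (@ev j)) normrM (gtr0_norm e0).
  (* [eps^-1] cancels the coupling in front of Green's identity; 8 counts two products of two
     values, each value carrying the factor 2 of the hypothesis. *)
  pose K x := eps^-1 * (8 * (tau * q r * b r)) * w (nrm (x - k)%R).
  have wB : \sum_(x <- B) w (nrm (x - k)%R) <= Cw.
    apply: le_trans (sumw_shift k).
    rewrite big_filter big_enum_cond /= [leRHS](bigID (fun x => (nrm (x - k)%R <= r./2)%N)) /=.
    by rewrite lerDl sumr_ge0 // => x _; exact/ltW/(dp_w dp).
  have K0 : 0 <= eps^-1 * (8 * (tau * q r * b r)) by rewrite !mulr_ge0 ?invr_ge0 // ltW.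
  have hg : `|\sum_(x <- B) (phi k x * lap a (phi j) x - phi j x * lap a (phi k) x)|
     <= (d.*2)%:R * \sum_(x <- B) K x.
    apply: green_bound => // [x i y xB yB xy|x _]; last first.
      by rewrite mulr_ge0 ?K0 // ltW // (dp_w dp).
    have yx : (nrm (y - k)%R <= (nrm (x - k)%R).+1)%N.
      case: xy => ->; rewrite addrAC -addn1; apply: leq_trans (nrmD _ _) _.
        by rewrite leq_add2l.
      by rewrite leq_add2l nrmN.
    move: yB; rewrite inB -ltnNge => yB.
    (* An edge leaving the ball joins distance exactly [r./2] to [(r./2).+1]; both ends are at
       distance at least [r - (r./2).+1] from [j]. *)
    have ws : nrm (x - k)%R = r./2.
      apply/eqP; rewrite eqn_leq -inB xB -ltnS; exact: leq_trans yx.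
    have ys : nrm (y - k)%R = (r./2).+1.
      by apply/eqP; rewrite eqn_leq yB andbT -ws.
    rewrite /K ws.
    have hk1 : `|phi k x| <= 2 * b (r./2) by rewrite -ws.
    have hk2 : `|phi k y| <= 2 * b (r./2).
      apply: le_trans (h' _ _) _; rewrite ler_pM2l // ys; exact: (dp_mono dp).
    have hj1 : `|phi j x| <= 2 * b (r - (r./2).+1)%N.
      apply: le_trans (h' _ _) _; rewrite ler_pM2l //; apply: (dp_mono dp).
      by apply: leq_trans (tri x); rewrite ws; exact: half_subS.
    have hj2 : `|phi j y| <= 2 * b (r - (r./2).+1)%N.
      apply: le_trans (h' _ _) _; rewrite ler_pM2l //; apply: (dp_mono dp).
      by apply: leq_trans (tri y); rewrite ys.
    apply: le_trans (ler_normB _ _) _; rewrite !normrM.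
    have p1 := ler_pM (normr_ge0 _) (normr_ge0 _) hk1 hj2.
    have p2 := ler_pM (normr_ge0 _) (normr_ge0 _) hk2 hj1.
    have := dp_half dp r1 => hh.
    rewrite -mulrA ler_pdivlMl //.
    apply: (@le_trans _ _ (eps * (8 * (b r./2 * b (r - (r./2).+1)%N)))).
      by rewrite ler_pM2l //; lra.
    by lra.
  apply: (@le_trans _ _ (eps * ((d.*2)%:R * (eps^-1 * (8 * (tau * q r * b r)) * Cw)))).
    rewrite ler_pM2l //; apply: le_trans hg _.
    rewrite ler_wpM2l ?ler0n // /K -mulr_sumr ler_wpM2l //.
  rewrite le_eqVlt; apply/orP; left; apply/eqP.
  by rewrite -muln2 natrM; field; rewrite gt_eqF.
have I3 : `|\sum_(x <- B) phi k x * phi j x| <= 8 * d%:R * (tau * Cw) * 2 * b r.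
  rewrite -(ler_pM2l qr0); apply: le_trans I2; apply: ler_wpM2r => //.
  by apply: gap; rewrite eq_sym.
have kk : 2^-1 <= `|phi k k| by apply: (@phi_diag 2) => //; exact: h.
move: I3; rewrite (bigD1_seq k) //=; set S := \sum_(_ <- _ | _) _ in I1 *.
move=> I3.
have I4 : `|phi k k * phi j k| <= (8 * d%:R * (tau * Cw) * 2 + 4 * (tau * Cw)) * b r.
  rewrite mulrDl; apply: le_trans (lerD I3 I1).
  by rewrite -{1}(addrK S (phi k k * phi j k)); exact: ler_normB.
have I5 : 2^-1 * `|phi j k| <= (8 * d%:R * (tau * Cw) * 2 + 4 * (tau * Cw)) * b r.
  by apply: le_trans I4; rewrite normrM ler_wpM2r.
have : (32 * d%:R + 8) * (tau * Cw) * b r <= 1 * b r by rewrite ler_pM2r.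
lra.
Qed.
End Bootstrap.

(** * The finite model *)

Section FiniteSpectrum.
Local Open Scope sesquilinear_scope.
Variables (R : realType) (m d : nat).
Notation T := 'I_m.+1.
Variables (a : 'I_d -> T) (V : T -> R) (gam : nat -> R).
Hypothesis V_gap : forall i j : T, (i < j)%N -> V i + gam (j - i)%N <= V j.
Local Notation C := R[i].

(** Complex scalars are there for the spectral theorem; the entries are real, which
    [spectrum_eigenfun] exploits to return to real functions. *)
Definition hamiltonian (t : R) : 'M[C]_m.+1 :=
  \matrix_(i, j) ((t * \sum_l ((j == i + a l :> T)%:R + (j == i - a l)%:R))%:C
                  + (V i)%:C * (i == j)%:R).

Lemma conjc_real (x : R) : (x%:C)^* = x%:C :> C.
Proof. by rewrite -[LHS]/(conjc _) /= oppr0. Qed.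

Lemma hamiltonian_herm t : (hamiltonian t)^t* = hamiltonian t.
Proof.
apply/matrixP => i j; rewrite !mxE rmorphD /= conjc_real.
congr (_ + _).
  congr ((_ * _)%:C); apply: eq_bigr => l _; rewrite addrC.
  by congr ((_ : bool)%:R + (_ : bool)%:R); apply/eqP/eqP => ->; rewrite ?addrK ?subrK.
by rewrite rmorphM /= conjc_real conjC_nat eq_sym; case: eqP => [->|]; rewrite ?mulr0.
Qed.

(** Each edge appears once, with both of its conjugate terms, so that translation invariance is a
    reindexing and bounds can be checked edge by edge. *)
Definition hop (x : 'rV[C]_m.+1) : C :=
  \sum_l \sum_i (x 0 i * (x 0 (i + a l))^* + x 0 (i + a l) * (x 0 i)^*).

Lemma sum_delta_mul (f : T -> C) (i : T) : \sum_j (j == i)%:R * f j = f i.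
Proof.
rewrite (bigD1 i) //= eqxx mul1r big1 ?addr0 // => j ji.
by rewrite (negPf ji) mul0r.
Qed.

Lemma qform_hamiltonian t (x : 'rV[C]_m.+1) :
  qform (hamiltonian t) x = t%:C * hop x + \sum_i (V i)%:C * `|x 0 i| ^+ 2.
Proof.
rewrite /qform mxE.
under eq_bigr => j _ do rewrite mxE mulr_suml.
rewrite exchange_big /=.
transitivity (\sum_i (t%:C * (\sum_l (x 0 i * (x 0 (i + a l))^* + x 0 i * (x 0 (i - a l))^*))
   + (V i)%:C * `|x 0 i| ^+ 2)).
  apply: eq_bigr => i _.
  under eq_bigr => j _ do rewrite !mxE mulrDr mulrDl.
  rewrite big_split /=; congr (_ + _).
    under eq_bigr => j _.
      rewrite rmorphM rmorph_sum /= mulrA [x 0 i * _]mulrC -!mulrA mulr_suml.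
      rewrite mulr_sumr mulr_sumr.
      under eq_bigr => l _ do rewrite rmorphD /= !rmorph_nat mulrDl mulrDr mulrDr.
      over.
    rewrite /= exchange_big mulr_sumr /=; apply: eq_bigr => l _.
    have h (z : T) : t%:C * (x 0 i * (x 0 z)^*) =
        \sum_j t%:C * (x 0 i * ((j == z)%:R * (x 0 j)^*)).
      by rewrite -!mulr_sumr sum_delta_mul.
    by rewrite big_split /= mulrDr !h.
  have -> : (V i)%:C * `|x 0 i| ^+ 2 = x 0 i * ((V i)%:C * \sum_j ((j == i)%:R * (x 0 j)^*)).
    by rewrite sum_delta_mul normCK; ring.
  rewrite !mulr_sumr; apply: eq_bigr => j _; rewrite mulrA mulrA eq_sym; ring.
rewrite big_split /= -mulr_sumr; congr (_ * _ + _).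
rewrite exchange_big /=; apply: eq_bigr => l _; rewrite !big_split /=; congr (_ + _).
rewrite (reindex_inj (addIr (a l))) /=; apply: eq_bigr => i _.
by rewrite addrK.
Qed.

Definition spectrum t (lam : T -> R) := exists2 U,
  eigenbasis (hamiltonian t) (fun i => (lam i)%:C : C) U &
  {homo lam : i j / (i <= j)%N >-> i <= j}.

Lemma spectrum_exists t : exists lam, spectrum t lam.
Proof.
have [lam [U [b rl hl]]] := hermitian_sorted_eigenbasis (hamiltonian_herm t).
have lamE i : lam i = (complex.Re (lam i))%:C.
  by have /Creal_ImP := rl i; case: (lam i) => x y; rewrite -complexIm => -[/= ->].
exists (fun i => complex.Re (lam i)), U.
  suff -> : (fun i => (complex.Re (lam i))%:C) = lam by [].
  by apply/funext => i; rewrite -lamE.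
by move=> i j ij; have := hl _ _ ij; rewrite (lamE i) (lamE j) lecR.
Qed.

Lemma realC_real (x : R) : (x%:C : C) \is Num.real.
Proof. by apply/CrealP; rewrite conjc_real. Qed.

Lemma spectrum_compare s t lam mu (S : 'M[C]_m.+1) (W : {set T}) (c : R) (i j : T) :
  spectrum s lam -> spectrum t mu -> S *m S^t* = 1%:M ->
  (forall x : 'rV[C]_m.+1, (forall w, w \in W -> x 0 w = 0) ->
     qform (hamiltonian s) x + c%:C * (x *m x^t*) 0 0 <= qform (hamiltonian t) (x *m S)) ->
  (i + #|W| <= j)%N -> lam i + c <= mu j.
Proof.
move=> [U b hl] [U' b' hl'] SS hq ij.
rewrite -lecR rmorphD /=.
apply: (eigenvalue_interlacing b b' _ _ (realC_real c) _ _ SS hq ij).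
- by move=> k; exact: realC_real.
- by move=> k; exact: realC_real.
- by move=> k l kl; rewrite lecR hl.
- by move=> k l kl; rewrite lecR hl'.
Qed.

(* Translation by [k = j - i] sites raises the potential by [gam k], except at
   the [k] top sites, where it wraps around. *)
Lemma spectrum_gap t lam (i j : T) : spectrum t lam -> (i < j)%N ->
  lam i + gam (j - i)%N <= lam j.
Proof.
move=> sp ij; pose k : T := inord (j - i).
have kE : k = (j - i)%N :> nat by rewrite inordK // ltnS (leq_trans (leq_subr _ _)) // -ltnS.
pose S : 'M[C]_m.+1 := \matrix_(x, y) (y == x + k)%:R.
have xS (x : 'rV[C]_m.+1) z : (x *m S) 0 z = x 0 (z - k).
  rewrite mxE -[RHS](sum_delta_mul (x 0)); apply: eq_bigr => w _.
  by rewrite mxE mulrC; congr ((_ : bool)%:R * _); apply/eqP/eqP => ->; rewrite ?addrK ?subrK.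
pose W := [set x : T | (m.+1 - (j - i) <= x)%N].
apply: (@spectrum_compare t t lam lam S W) => //.
- apply/matrixP => x y; rewrite !mxE.
  under eq_bigr => z _ do rewrite !mxE conjC_nat.
  by rewrite sum_delta_mul (inj_eq (addIr k)).
- move=> x xW; rewrite !qform_hamiltonian norm2E.
  have -> : hop (x *m S) = hop x.
    apply: eq_bigr => l _; rewrite (reindex_inj (addIr k)) /=.
    by apply: eq_bigr => y _; rewrite !xS addrK addrAC addrK.
  rewrite -addrA lerD2l mulr_sumr -big_split /= [leRHS](reindex_inj (addIr k)) /=.
  apply: ler_sum => y _; rewrite xS addrK -mulrDl.
  have [yW|yW] := boolP (y \in W); first by rewrite xW // normr0 expr0n !mulr0.
  apply: ler_wpM2r; first exact: exprn_ge0.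
  move: yW; rewrite inE -ltnNge => yW.
  have yk : (y + k)%R = (y + (j - i))%N :> nat.
    by rewrite /= kE modn_small //; have := ltn_ord j; lia.
  rewrite -rmorphD /= lecR; have := @V_gap y (y + k); rewrite yk.
  have -> : (y + (j - i) - y)%N = (j - i)%N by lia.
  by apply; lia.
- suff -> : #|W| = (j - i)%N by lia.
  have jm := ltn_ord j.
  rewrite -(card_ord (j - i)).
  have h (z : 'I_(j - i)) : (m.+1 - (j - i) + z < m.+1)%N by have := ltn_ord z; lia.
  pose f (z : 'I_(j - i)) : T := Ordinal (h z).
  rewrite -(card_imset _ (f := f)); last by move=> y z [] /eqP; rewrite eqn_add2l => /eqP/val_inj.
  apply: eq_card => z; rewrite inE; apply/idP/imsetP => [zW|[y _ ->]]; last by rewrite /= leq_addr.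
  have h' : (z - (m.+1 - (j - i)) < j - i)%N by have := ltn_ord z; lia.
  by exists (Ordinal h') => //; apply: val_inj; rewrite /=; lia.
Qed.

(** On each edge [|u + s v|^2 >= 0], where [s] is the sign of [c]; every site lies on [2 d]
    edges. *)
Lemma hop_lower_bound (x : 'rV[C]_m.+1) (c : R) :
  - (`|c| * (d.*2)%:R)%:C * (x *m x^t*) 0 0 <= c%:C * hop x.
Proof.
have h (s : C) : s = 1 \/ s = -1 -> - (d.*2)%:R * (x *m x^t*) 0 0 <= s * hop x.
  move=> s1; rewrite /hop mulr_sumr norm2E.
  have -> : - (d.*2)%:R * \sum_i `|x 0 i| ^+ 2 = \sum_(l < d) \sum_i
      (- `|x 0 i| ^+ 2 - `|x 0 (i + a l)| ^+ 2).
    transitivity (\sum_(l < d) (- (\sum_i `|x 0 i| ^+ 2) *+ 2)).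
      by rewrite sumr_const card_ord -mulrnA mul2n mulNrn mulNr mulr_natl.
    apply: eq_bigr => l _; rewrite big_split /= !sumrN mulr2n; congr (_ - _).
    by rewrite (reindex_inj (addIr (a l))).
  apply: ler_sum => l _; rewrite mulr_sumr; apply: ler_sum => i _.
  rewrite -subr_ge0; set u := x 0 i; set v := x 0 (i + a l).
  suff -> : s * (u * v^* + v * u^*) - (- `|u| ^+ 2 - `|v| ^+ 2) = `|u + s * v| ^+ 2.
    exact: exprn_ge0.
  rewrite !normCK !rmorphD !rmorphM /=.
  by case: s1 => ->; rewrite ?rmorphN ?rmorph1; ring.
have [c0|c0] := leP 0 c.
  rewrite ger0_norm // rmorphM -mulNr -!mulrA.
  have -> : - (c%:C : C) * (((d.*2)%:R%:C : C) * (x *m x^t*) 0 0) =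
     c%:C * (- (d.*2)%:R * (x *m x^t*) 0 0) by rewrite rmorph_nat; ring.
  apply: ler_wpM2l; first by rewrite lecR.
  by rewrite -[leRHS]mul1r; apply: h; left.
rewrite ltr0_norm // rmorphM rmorphN /=.
have -> : - (- (c%:C : C) * ((d.*2)%:R%:C : C)) * (x *m x^t*) 0 0 =
     - c%:C * (- (d.*2)%:R * (x *m x^t*) 0 0) by rewrite rmorph_nat; ring.
have -> : c%:C * hop x = - c%:C * (-1 * hop x) by ring.
apply: ler_wpM2l; first by rewrite -rmorphN lecR oppr_ge0 ltW.
by apply: h; right.
Qed.

(** Weyl's perturbation bound: the same comparison with no translation and no excluded site. *)
Lemma spectrum_lipschitz s t lam mu i : spectrum s lam -> spectrum t mu ->
  lam i - `|t - s| * (d.*2)%:R <= mu i.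
Proof.
move=> sp sp'; apply: (@spectrum_compare s t lam mu 1%:M finset.set0) => //.
- by rewrite trmx1 map_mx1 mulmx1.
- move=> x _; rewrite mulmx1 !qform_hamiltonian.
  rewrite addrAC lerD2r rmorphN.
  have h := hop_lower_bound x (t - s).
  rewrite -lerBDl -mulrBl -rmorphB; exact: le_trans h.
- by rewrite cards0 addn0.
Qed.

(** The real and imaginary parts of a complex eigenvector both solve the real equation; one of them
    is nonzero and is normalized. *)
Lemma spectrum_eigenfun t lam j : spectrum t lam ->
  exists2 u : T -> R, eigenfun a t V (lam j) u & \sum_x u x ^+ 2 = 1.
Proof.
move=> [U [UU UM] _].
pose z := row j U.
have zx x : t%:C * (\sum_l (z 0 (x + a l) + z 0 (x - a l))) + (V x)%:C * z 0 x = (lam j)%:C * z 0 x.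
  have /matrixP/(_ j x) := UM; rewrite mul_diag_mx !mxE => <-.
  have e1 (y w : T) : (x == y + w) = (y == x - w) by apply/eqP/eqP => ->; rewrite ?addrK ?subrK.
  have e2 (y w : T) : (x == y - w) = (y == x + w) by apply/eqP/eqP => ->; rewrite ?addrK ?subrK.
  under [in RHS]eq_bigr => y _ do rewrite mxE mulrDr.
  rewrite [RHS]big_split /=; congr (_ + _); last first.
    transitivity (\sum_y (y == x)%:R * ((V y)%:C * U j y)).
      by rewrite sum_delta_mul.
    by apply: eq_bigr => y _; ring.
  transitivity (\sum_y \sum_l (t%:C * ((y == x - a l)%:R * U j y) + t%:C * ((y == x + a l)%:R *
    U j y))).
    rewrite exchange_big mulr_sumr /=; apply: eq_bigr => l _.
    by rewrite big_split /= -!mulr_sumr !sum_delta_mul !mxE -mulrDr addrC.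
  apply: eq_bigr => y _; rewrite rmorphM rmorph_sum /= !mulr_sumr; apply: eq_bigr => l _.
  by rewrite e1 e2 rmorphD !rmorph_nat; ring.
have key (g : C -> R) : {morph g : x y / x + y} -> (forall (c : R) x, g (c%:C * x) = c * g x) ->
  eigenfun a t V (lam j) (fun x => g (z 0 x)).
  move=> gD gM x; rewrite -[RHS]gM -zx gD !gM; congr (_ * _ + _).
  rewrite /lap; have g0 : g 0 = 0 by have := gM 0 0; rewrite mulr0 mul0r.
  by rewrite (big_morph g gD g0); apply: eq_bigr => l _; rewrite gD.
have nz : exists x, z 0 x != 0.
  apply/existsP; rewrite -[X in is_true X]negbK; apply/negP; rewrite negb_exists => /forallP h.
  have /matrixP/(_ j j) := UU; rewrite !mxE eqxx big1 => [/eqP|x _].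
    by rewrite eq_sym oner_eq0.
  by have := h x; rewrite negbK mxE => /eqP ->; rewrite mul0r.
have norm1 (u : T -> R) : eigenfun a t V (lam j) u -> (exists x, u x != 0) ->
   exists2 u : T -> R, eigenfun a t V (lam j) u & \sum_x u x ^+ 2 = 1.
  move=> hu [x ux]; set n := \sum_x u x ^+ 2.
  have n0 : 0 < n.
    rewrite /n (bigD1 x) //= ltr_pwDl //; last by apply: sumr_ge0 => ? _; exact: sqr_ge0.
    by rewrite lt_neqAle sqr_ge0 andbT eq_sym sqrf_eq0.
  exists (fun x => (Num.sqrt n)^-1 * u x).
    move=> y; have -> : lap a (fun x => (Num.sqrt n)^-1 * u x) y = (Num.sqrt n)^-1 * lap a u y.
      by rewrite /lap mulr_sumr; apply: eq_bigr => l _; rewrite mulrDr.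
    rewrite [eps in eps + _]mulrCA [X in _ + X]mulrCA -mulrDr hu; ring.
  under eq_bigr => y _ do rewrite exprMn.
  by rewrite -mulr_sumr exprVn sqr_sqrtr ?ltW // mulVf // gt_eqF.
have [x zx0] := nz.
have [re0|re0] := eqVneq (complex.Re (z 0 x)) 0.
  apply: (norm1 (fun x => complex.Im (z 0 x))).
    apply: key => [[? ?] [? ?]//|c [p q']] /=; by rewrite mul0r addr0.
  exists x; apply: contra zx0; move: re0; case: (z 0 x) => p q' /= -> /eqP ->.
  by [].
apply: (norm1 (fun x => complex.Re (z 0 x))).
  apply: key => [[? ?] [? ?]//|c [p q']] /=; by rewrite mul0r subr0.
by exists x.
Qed.

End FiniteSpectrum.

(** * Following the eigenfunctions from zero coupling *)

Section Orthonormal.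
Variables (R : realType) (T : finZmodType) (d : nat) (a : 'I_d -> T) (V : T -> R).

Lemma eigenfun_orth eps e e' (u v : T -> R) : eigenfun a eps V e u -> eigenfun a eps V e' v ->
  e != e' -> \sum_x u x * v x = 0.
Proof.
move=> hu hv ee; apply/eqP; rewrite -(mulrI_eq0 _ (lregP _ : GRing.lreg (e' - e))); last first.
  by rewrite subr_eq0 eq_sym.
have := green_eigenfun (enum T) hu hv; rewrite !big_enum /= => ->.
have := @green_bound _ _ _ a (enum T) u v (fun=> 0) (enum_uniq _).
rewrite !big_enum /= sumr_const mul0rn mulr0 => h.
suff /eqP -> : \sum_x (u x * lap a v x - v x * lap a u x) == 0 by rewrite mulr0.
rewrite -normr_le0; apply: h => // x i y _.
by rewrite mem_enum.
Qed.

Lemma eigenfun_delta j : eigenfun a 0 V (V j) (fun x => (x == j)%:R).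
Proof.
move=> x; rewrite mul0r add0r; have [->//|_] := eqVneq x j.
by rewrite !mulr0.
Qed.

(** The potential cancels between the two equations, and what is left is proportional to the change
    of coupling: first-order perturbation theory without derivatives. *)
Lemma eigenfun_cross t s e e' u v : eigenfun a t V e u -> eigenfun a s V e' v ->
  (e' - e) * (\sum_x u x * v x) = (s - t) * \sum_x u x * lap a v x.
Proof.
move=> hu hv.
have gs := @green_bound _ _ _ a (enum T) u v (fun=> 0) (enum_uniq _).
have sym : \sum_x u x * lap a v x = \sum_x v x * lap a u x.
  apply/eqP; rewrite -subr_eq0 -sumrB -normr_le0.
  move: gs; rewrite !big_enum /= sumr_const mul0rn mulr0; apply => // x i y _.
  by rewrite mem_enum.
transitivity (\sum_x u x * (e' * v x) - \sum_x v x * (e * u x)).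
  by rewrite mulr_sumr -sumrB; apply: eq_bigr => x _; ring.
have -> : \sum_x u x * (e' * v x) = s * (\sum_x u x * lap a v x) + \sum_x V x * (u x * v x).
  by rewrite mulr_sumr -big_split /=; apply: eq_bigr => x _; rewrite -hv; ring.
have -> : \sum_x v x * (e * u x) = t * (\sum_x v x * lap a u x) + \sum_x V x * (u x * v x).
  by rewrite mulr_sumr -big_split /=; apply: eq_bigr => x _; rewrite -hu; ring.
rewrite -sym; ring.
Qed.

End Orthonormal.

Lemma orthonormal_expand (R : realType) (m : nat) (phi : 'I_m -> 'I_m -> R) :
  (forall j, \sum_x phi j x ^+ 2 = 1) ->
  (forall i j, i != j -> \sum_x phi i x * phi j x = 0) ->
  forall (f : 'I_m -> R) k, f k = \sum_j (\sum_x phi j x * f x) * phi j k.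
Proof.
move=> n1 o f k; pose P := \matrix_(i, j) phi i j.
have /mulmx1C PP : P *m P^T = 1%:M.
  apply/matrixP => i j; rewrite !mxE.
  under eq_bigr => x _ do rewrite !mxE.
  have [->|ij] := eqVneq i j; last exact: o.
  by rewrite -[RHS](n1 j); apply: eq_bigr => x _; rewrite expr2.
have h l : \sum_j phi j l * phi j k = (l == k)%:R.
  have /matrixP/(_ l k) := PP; rewrite !mxE => <-.
  by apply: eq_bigr => x _; rewrite !mxE.
under eq_bigr => j _ do rewrite mulr_suml.
rewrite exchange_big /= (bigD1 k) //= [X in _ + X]big1 ?addr0 => [|l lk].
  under eq_bigr => j _ do rewrite mulrAC mulrC.
  by rewrite -mulr_sumr h eqxx mulr1.
under eq_bigr => j _ do rewrite mulrAC mulrC.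
by rewrite -mulr_sumr h (negPf lk) mulr0.
Qed.

(** Apart from positivity, the coupling occurs only in [dp_half], which gets easier as it decreases;
    one profile serves the whole path up to [eps]. *)
Lemma decay_profile_le (R : realType) d (s eps tau Cw : R) q w b : 0 < s -> s <= eps ->
  decay_profile d eps tau Cw q w b -> decay_profile d s tau Cw q w b.
Proof.
move=> s0 se [e0 t0 tc q0 w0 b0 b01 bm bs bh bl]; split => // r r1.
apply: le_trans (bh _ r1); rewrite ler_wpM2r // mulr_ge0 //; exact: ltW.
Qed.

Section FiniteLocalization.
Variables (R : realType) (m d : nat).
Notation T := 'I_m.+1.
Variables (a : 'I_d -> T) (V : T -> R) (gam : nat -> R).
Variables (nrm : T -> nat) (eps tau Cw : R) (q w b : nat -> R).
Hypothesis (nrmD : forall x y : T, (nrm (x + y)%R <= nrm x + nrm y)%N).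
Hypothesis (nrmN : forall x : T, nrm (- x)%R = nrm x).
Hypothesis (nrm0 : forall x : T, (nrm x == 0%N) = (x == 0)).
Hypothesis (nrm_step : forall i, (nrm (a i) <= 1)%N).
Hypothesis (sumw : \sum_x w (nrm x) <= Cw).
Hypothesis (dp : decay_profile d eps tau Cw q w b).
Hypothesis V_gap : forall i j : T, (i < j)%N -> V i + gam (j - i)%N <= V j.
Hypothesis gam1 : 0 < gam 1%N.
Hypothesis gam_ge1 : forall k, (1 <= k)%N -> gam 1%N <= gam k.
Hypothesis q_gam : forall i j : T, (i < j)%N -> q (nrm (j - i)%R) <= gam (j - i)%N.

Definition localized_at (t : R) (lam : T -> R) (phi : T -> T -> R) :=
  [/\ spectrum a V t lam, forall j, eigenfun a t V (lam j) (phi j),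
      forall j, \sum_x phi j x ^+ 2 = 1 &
      forall j k, k != j -> `|phi j k| <= b (nrm (k - j)%R)].

(** A separation uniform in [t]. It serves to follow eigenfunctions continuously, where constants
    depending on [m] do no harm; the decay rests on [spectrum_q]. *)
Lemma spectrum_neq t lam i j : spectrum a V t lam -> i != j -> gam 1%N <= `|lam i - lam j|.
Proof.
move=> sp; wlog ij : i j / (i < j)%N => [H ne|_].
  have [ij|ji|/val_inj e] := ltngtP i j; first exact: H.
    by rewrite distrC H // eq_sym.
  by rewrite e eqxx in ne.
have := spectrum_gap V_gap sp ij.
have : gam 1%N <= gam (j - i)%N by apply: gam_ge1; rewrite subn_gt0.
by rewrite distrC => h1 h2; apply: le_trans (ler_norm _); lra.
Qed.

Lemma spectrum_q t lam j k : spectrum a V t lam -> j != k ->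
  q (nrm (k - j)%R) <= `|lam j - lam k|.
Proof.
move=> sp; wlog jk : j k / (j < k)%N => [H ne|_].
  have [ij|ji|/val_inj e] := ltngtP j k; first exact: H.
    by rewrite distrC -nrmN opprB H // eq_sym.
  by rewrite e eqxx in ne.
have := spectrum_gap V_gap sp jk; have := q_gam jk.
by rewrite distrC => h1 h2; apply: le_trans (ler_norm _); lra.
Qed.

Lemma abs_unit_le1 (u : T -> R) k : \sum_x u x ^+ 2 = 1 -> `|u k| <= 1.
Proof.
move=> u1; have : u k ^+ 2 <= 1.
  by rewrite -u1 (bigD1 k) //= lerDl sumr_ge0 // => ? _; exact: sqr_ge0.
by rewrite -real_normK ?num_real // expr_le1 ?normr_ge0.
Qed.

(** In the expansion of [psi j] in the basis [phi], the [j]-th coefficient is at most 1 in modulus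
    and the others are of order [|s - t|] by [eigenfun_cross]. A one-sided bound on moduli avoids
    any matching of signs. *)
Lemma eigenfun_drift t s lam mu phi psi :
  spectrum a V t lam -> spectrum a V s mu ->
  (forall j, eigenfun a t V (lam j) (phi j)) -> (forall j, \sum_x phi j x ^+ 2 = 1) ->
  (forall j, eigenfun a s V (mu j) (psi j)) -> (forall j, \sum_x psi j x ^+ 2 = 1) ->
  `|s - t| * (4 * d%:R) <= gam 1%N ->
  forall j k, `|psi j k| <= `|phi j k| + `|s - t| * (4 * d%:R * m.+1%:R * m.+1%:R / gam 1%N).
Proof.
move=> sp sp' hphi n1 hpsi n1' small j k.
have orth i i' : i != i' -> \sum_x phi i x * phi i' x = 0.
  move=> ne; apply: (eigenfun_orth (hphi i) (hphi i')).
  by rewrite -subr_eq0 -normr_gt0 (lt_le_trans gam1) // (spectrum_neq sp).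
have d0 : 0 <= d%:R :> R := ler0n _ _.
set A := \sum_(i | i != j) (\sum_x phi i x * psi j x) * phi i k.
have -> : psi j k = (\sum_x phi j x * psi j x) * phi j k + A.
  by rewrite (orthonormal_expand n1 orth (psi j) k) (bigD1 j).
have CS : `|\sum_x phi j x * psi j x| <= 1.
  apply: le_trans (ler_norm_sum _ _ _) _.
  apply: (@le_trans _ _ (\sum_x (phi j x ^+ 2 + psi j x ^+ 2) / 2)).
    apply: ler_sum => x _; rewrite normrM.
    rewrite -(real_normK (num_real (phi j x))) -(real_normK (num_real (psi j x))).
    have := sqr_ge0 (`|phi j x| - `|psi j x|); rewrite sqrrB; lra.
  by rewrite -mulr_suml big_split /= n1 n1'; lra.
apply: le_trans (ler_normD _ _) _; apply: lerD.
  by rewrite normrM -[leRHS]mul1r ler_wpM2r.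
apply: le_trans (ler_norm_sum _ _ _) _.
apply: (@le_trans _ _ (\sum_(i : T) `|s - t| * (4 * d%:R * m.+1%:R / gam 1%N))); last first.
  by rewrite sumr_const card_ord -mulr_natr; lra.
rewrite big_mkcond /=; apply: ler_sum => i _.
have nn : 0 <= `|s - t| * (4 * d%:R * m.+1%:R / gam 1).
  by rewrite !mulr_ge0 // ?invr_ge0 ltW.
case: ifPn => // ij.
rewrite normrM -[leRHS]mulr1; apply: ler_pM => //; last exact: abs_unit_le1.
have lapb x : `|lap a (psi j) x| <= 2 * d%:R.
  apply: le_trans (ler_norm_sum _ _ _) _.
  apply: (@le_trans _ _ (\sum_(l < d) 2)); last by rewrite sumr_const card_ord mulr_natr.
  apply: ler_sum => l _; apply: le_trans (ler_normD _ _) _.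
  have h1 := abs_unit_le1 (x + a l) (n1' j).
  have h2 := abs_unit_le1 (x - a l) (n1' j); lra.
have num : `|\sum_x phi i x * lap a (psi j) x| <= 2 * d%:R * m.+1%:R.
  apply: le_trans (ler_norm_sum _ _ _) _.
  apply: (@le_trans _ _ (\sum_(x : T) 2 * d%:R)).
    apply: ler_sum => x _; rewrite normrM -[leRHS]mul1r; apply: ler_pM => //.
    exact: abs_unit_le1.
  by rewrite sumr_const card_ord -[leLHS]mulr_natr.
have cr := eigenfun_cross (hphi i) (hpsi j).
(* The [j]-th eigenvalue moves by at most half of [gam 1], so the other half of the gap remains. *)
have den : gam 1%N / 2 <= `|mu j - lam i|.
  have g1 := spectrum_neq sp ij; rewrite distrC in g1.
  have l1 := spectrum_lipschitz j sp sp'; have l2 := spectrum_lipschitz j sp' sp.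
  rewrite distrC in l2; rewrite -muln2 natrM in l1 l2.
  have l3 : `|mu j - lam j| <= `|s - t| * (2 * d%:R) by rewrite ler_norml; apply/andP; split; lra.
  have : `|lam j - lam i| <= `|mu j - lam i| + `|mu j - lam j|.
    have -> : lam j - lam i = (mu j - lam i) - (mu j - lam j) by lra.
    exact: ler_normB.
  lra.
have den0 : 0 < gam 1%N / 2 by rewrite divr_gt0.
have /(congr1 Num.norm) := cr; rewrite !normrM => e.
have : gam 1%N / 2 * `|\sum_x phi i x * psi j x| <= `|s - t| * (2 * d%:R * m.+1%:R).
  apply: (@le_trans _ _ (`|mu j - lam i| * `|\sum_x phi i x * psi j x|)).
    exact: ler_wpM2r.
  rewrite e; exact: ler_wpM2l.
rewrite -ler_pdivlMl //; move=> hh; apply: le_trans hh _.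
by rewrite invf_div le_eqVlt; apply/orP; left; apply/eqP; field; rewrite gt_eqF.
Qed.

(** On a finite group [b] is bounded below by some [K^-1 > 0], so a short step costs at most the
    factor 2 that [bootstrap] removes. The length [h] does not depend on [t], so finitely many steps
    reach [eps]. *)
Lemma localized_step : exists2 h, 0 < h & forall t s lam phi, 0 < s -> s <= eps -> `|s - t| <= h ->
  localized_at t lam phi -> exists lam' phi', localized_at s lam' phi'.
Proof.

pose K := \sum_x (b (nrm x))^-1.
have b0 := dp_b dp.
have bK x : K^-1 <= b (nrm x).
  rewrite -[leRHS]invrK lef_pV2 ?posrE ?invr_gt0 //.
    by rewrite /K (bigD1 x) //= lerDl sumr_ge0 // => y _; rewrite invr_ge0 ltW.
  rewrite /K (bigD1 x) //= ltr_pwDl ?invr_gt0 // sumr_ge0 // => y _; rewrite invr_ge0 ltW //.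
have K0 : 0 < K^-1.
  rewrite invr_gt0 /K (bigD1 0) //= ltr_pwDl ?invr_gt0 // sumr_ge0 // => y _.
  by rewrite invr_ge0 ltW.
pose D := 4 * d%:R * m.+1%:R * m.+1%:R / gam 1%N.
have D0 : 0 <= D by rewrite !mulr_ge0 // ?invr_ge0 ltW.
pose E : R := 4 * d%:R; have E0 : 0 <= E by rewrite mulr_ge0.
exists (Num.min (gam 1%N / (E + 1)) (K^-1 / (D + 1))).
  by rewrite lt_min !divr_gt0 // ltr_wpDl.
move=> t s lam phi s0 se; rewrite le_min => /andP[h1 h2] [sp hphi n1 loc].
have [mu sp'] := spectrum_exists a V s.
have /boolp.choice[psi hpsi] : forall j, exists u, eigenfun a s V (mu j) u /\ \sum_x u x ^+ 2 = 1.
  by move=> j; have [u] := spectrum_eigenfun j sp'; exists u.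
exists mu, psi; split=> //; try by move=> j; have [] := hpsi j.
move=> j k kj.
apply: (bootstrap nrmD nrmN nrm0 nrm_step sumw (decay_profile_le s0 se dp)
  (fun j => (hpsi j).1) (fun j => (hpsi j).2)) => //.
  by move=> i i' ne; apply: (spectrum_q sp').
move=> {kj}i i' ne.
have := eigenfun_drift sp sp' hphi n1 (fun j => (hpsi j).1) (fun j => (hpsi j).2).
have -> : `|s - t| * (4 * d%:R) <= gam 1%N.
  apply: (@le_trans _ _ (gam 1%N / (E + 1) * E)); first exact: ler_wpM2r.
  by rewrite mulrAC ler_pdivrMr ?ltr_wpDl // ler_pM2l //; lra.
move=> /(_ isT i i') hd; apply: le_trans hd _.
have h3 := loc i i' ne.
have : `|s - t| * D <= K^-1.
  apply: (@le_trans _ _ (K^-1 / (D + 1) * D)); first exact: ler_wpM2r.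
  by rewrite mulrAC ler_pdivrMr ?ltr_wpDl // ler_pM2l //; lra.
by have := bK (i' - i); rewrite /D; lra.
Qed.

Lemma localized_zero : exists lam phi, localized_at 0 lam phi.
Proof.
exists V, (fun j x => (x == j)%:R); split.
- exists 1%:M.
    split; first by rewrite trmx1 map_mx1 mulmx1.
    rewrite mul1mx mulmx1; apply/matrixP => i j; rewrite !mxE mul0r add0r.
    by case: eqP => [->|]; rewrite ?mulr1 ?mulr0.
  move=> i j; rewrite leq_eqVlt => /orP[/eqP/val_inj->//|ij].
  have := V_gap ij; have : gam 1%N <= gam (j - i)%N by apply: gam_ge1; rewrite subn_gt0.
  by move=> h1 h2; apply: le_trans h2; rewrite lerDl; apply: le_trans h1; exact: ltW.
- by move=> j; exact: eigenfun_delta.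
- move=> j; rewrite (bigD1 j) //= eqxx expr1n big1 ?addr0 // => i /negPf ->.
  by rewrite expr0n.
- by move=> j k /negPf ->; rewrite normr0 ltW // (dp_b dp).
Qed.

Lemma finite_localization : exists lam phi,
  [/\ forall j, eigenfun a eps V (lam j) (phi j),
      forall j, \sum_x phi j x ^+ 2 = 1,
      forall j k, `|phi j k| <= b (nrm (k - j)%R),
      forall j, 2^-1 <= phi j j /\ 1 - phi j j ^+ 2 <= tau * Cw * b 1%N &
      forall i j : T, (i < j)%N -> lam i + gam (j - i)%N <= lam j].
Proof.
have e0 := dp_eps dp.
have [h h0 step] := localized_step.
pose n := (Num.truncn (eps / h)).+1.
have nh : eps / n%:R <= h.
  rewrite ler_pdivrMr ?ltr0n // mulrC -ler_pdivrMr //.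
  exact/ltW/truncnS_gt.
have all k : (k <= n)%N -> exists lam phi, localized_at (k%:R * (eps / n%:R)) lam phi.
  elim: k => [_|k IH kn]; first by rewrite mul0r; exact: localized_zero.
  have [lam [phi lp]] := IH (ltnW kn).
  apply: step lp.
  - by rewrite mulr_gt0 ?divr_gt0 // ltr0n.
  - by rewrite mulrCA ger_pMr // ler_pdivrMr ?ltr0n // mul1r ler_nat.
  - by rewrite -mulrBl -natrB // subSnn mul1r gtr0_norm // divr_gt0 ?ltr0n.
have [lam [phi]] := all n (leqnn _).
rewrite mulrCA divff ?mulr1 ?pnatr_eq0 // => -[sp hphi n1 loc].
have half j : 2^-1 <= `|phi j j|.
  apply: (phi_diag nrm0 sumw dp n1 (c := 1)) => //; first by lra.
  by move=> k kj; rewrite mul1r; exact: loc.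
have tail j : 1 - phi j j ^+ 2 <= tau * Cw * b 1%N.
  have loc1 k : k != j -> `|phi j k| <= 1 * b (nrm (k - j)%R) by rewrite mul1r; exact: loc.
  by have := sum_tail_sqr nrm0 sumw dp n1 ler01 loc1; rewrite expr1n mul1r.
(* The sign makes the central value positive, a normalization that survives the limit and is needed
   for uniqueness. *)
exists lam, (fun j x => Num.sg (phi j j) * phi j x).
have sg2 j : Num.sg (phi j j) ^+ 2 = 1.
  by rewrite sqr_sg -normr_gt0 (lt_le_trans _ (half j)) // invr_gt0.
split.
- move=> j x; rewrite [RHS]mulrCA -hphi /lap mulrDr [X in _ + X]mulrCA; congr (_ + _).
  rewrite mulrCA; congr (_ * _); rewrite mulr_sumr; apply: eq_bigr => l _.
  by rewrite mulrDr.
- by move=> j; under eq_bigr => x _ do rewrite exprMn sg2 mul1r; exact: n1.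
- move=> j k; rewrite normrM.
  have -> : `|Num.sg (phi j j)| = 1.
    by rewrite normr_sg -normr_gt0 (lt_le_trans _ (half j)) // invr_gt0.
  rewrite mul1r; have [->|kj] := eqVneq k j; last exact: loc.
  have /eqP -> : nrm (j - j)%R == 0%N by rewrite nrm0 subrr.
  by rewrite (dp_b0 dp); apply: abs_unit_le1.
- move=> j; rewrite exprMn sg2 mul1r; split; last exact: tail.
  by rewrite -normrEsg.
- by move=> i j ij; exact: spectrum_gap sp ij.
Qed.

End FiniteLocalization.

(** * The decay profile *)

Lemma powR_1l (R : realType) (x : R) : 1 `^ x = 1.
Proof. by rewrite powR1. Qed.

Lemma half_lt (r : nat) : (1 <= r)%N -> (r./2 < r)%N.
Proof. lia. Qed.

Lemma double_half_le (r : nat) : ((r./2).*2 <= r)%N.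
Proof. lia. Qed.

Lemma le_doubleS_half (r : nat) : (r <= (r./2).*2.+1)%N.
Proof. lia. Qed.

Section ConcavePower.
Variables (R : realType) (beta : R).
Hypothesis hb : 0 < beta < 1.

Let b0 : 0 < beta. Proof. by case/andP: hb. Qed.
Let b1 : beta < 1. Proof. by case/andP: hb. Qed.

Definition concave_gain : R := 1 - 2^-1 `^ (1 - beta).

Lemma concave_gain_gt0 : 0 < concave_gain.
Proof.
rewrite subr_gt0 -[ltRHS](powR_1l (1 - beta)).
by apply: gt0_ltr_powR; rewrite ?nnegrE ?subr_gt0 //; lra.
Qed.

Lemma powR_ge_id (x : R) : 0 <= x <= 1 -> x <= x `^ beta.
Proof.
move=> /andP[x0 x1]; move: x0; rewrite le_eqVlt => /predU1P[<-|x0]; first exact: powR_ge0.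
rewrite -{1}(powRr1 (ltW x0)) /powR gt_eqF // ler_expR ler_wnM2r //; first exact: ln_le0.
exact: ltW.
Qed.

(** By scaling, take [r = 1] and [u = s <= 1/2]. Then [(1 - u)^beta >= 1 - u], and
    [u <= u^beta * 2^(beta - 1)], which is the origin of [concave_gain]. *)
Lemma powR_concave_gain (s r : R) : 0 <= s -> 2 * s <= r ->
  r `^ beta + concave_gain * s `^ beta <= s `^ beta + (r - s) `^ beta.
Proof.
move=> s0 sr; have [r0|r0] := eqVneq r 0.
  have s00 : s = 0 by lra.
  by rewrite r0 s00 subr0 !powR0 ?gt_eqF // mulr0.
have rp : 0 < r by rewrite lt_neqAle eq_sym r0; lra.
pose u := s / r; have u0 : 0 <= u by rewrite divr_ge0 // ltW.
have u2 : u <= 2^-1 by rewrite ler_pdivrMr // ler_pdivlMl.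
have -> : s = r * u by rewrite /u mulrCA divff // mulr1.
have -> : r - r * u = r * (1 - u) by ring.
have rb := powR_ge0 r beta.
have u1 : 0 <= 1 - u by lra.
rewrite (powRM _ (ltW rp) u0) (powRM _ (ltW rp) u1).
have h1 : 1 - u <= (1 - u) `^ beta by apply: powR_ge_id; lra.
have h2 : u <= u `^ beta * 2^-1 `^ (1 - beta).
  move: u0; rewrite le_eqVlt => /predU1P[<-|u0]; first by rewrite powR0 ?gt_eqF // mul0r.
  have {1}-> : u = u `^ beta * u `^ (1 - beta).
    rewrite -powRD; last by rewrite (gt_eqF u0) implybT.
    by rewrite addrC subrK powRr1 // ltW.
  rewrite ler_wpM2l ?powR_ge0 //.
  apply: ge0_ler_powR; rewrite ?nnegrE //; [by rewrite subr_ge0 ltW|exact: ltW].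
rewrite /concave_gain; nra.
Qed.

Lemma powR_subadd (x y : R) : 0 <= x -> 0 <= y -> (x + y) `^ beta <= x `^ beta + y `^ beta.
Proof.
wlog xy : x y / x <= y => [H x0 y0|x0 y0].
  by have [xy|/ltW xy] := leP x y; [exact: H|rewrite addrC [leRHS]addrC; exact: H].
have := @powR_concave_gain x (x + y) x0.
have -> : x + y - x = y by ring.
have := concave_gain_gt0; have := powR_ge0 x beta => h1 h2 h3.
by have {}h3 := h3 ltac:(lra); nra.
Qed.

(** From [ln y <= y] at [y = (s + 1)^beta]. The logarithms of weights and denominators thus cost
    only multiples of [s^beta] and constants. *)
Lemma ln_natS_le (s : nat) : ln (s.+1%:R : R) <= beta^-1 * (s%:R `^ beta + 1).
Proof.
have h : ln (s.+1%:R : R) <= beta^-1 * s.+1%:R `^ beta.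
  rewrite ler_pdivlMl // -ln_powR.
  have := @le_ln1Dx R (s.+1%:R `^ beta - 1).
  have p : 0 < (s.+1%:R : R) `^ beta by rewrite powR_gt0 // ltr0n.
  have -> : 1 + (s.+1%:R `^ beta - 1) = (s.+1%:R : R) `^ beta by ring.
  by move=> h; apply: le_trans (h _) _; lra.
apply: le_trans h _; rewrite ler_pM2l ?invr_gt0 //.
by rewrite -natr1; apply: le_trans (powR_subadd _ _) _; rewrite ?ler0n // powR_1l.
Qed.

Lemma powR_nat_ge1 (s : nat) : (1 <= s)%N -> 1 <= (s%:R : R) `^ beta.
Proof.
move=> s1; rewrite -[leLHS](powR_1l beta).
apply: ge0_ler_powR; rewrite ?nnegrE ?ler1n //; exact: ltW.
Qed.

End ConcavePower.

Section Profile.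
Variables (R : realType) (d : nat) (alpha delta rho beta : R).
Hypothesis (halpha : 1 <= alpha) (hdelta : 0 < delta < 1) (hrho : 0 < rho) (hbeta : 0 < beta < 1).

(** One hop brings a full factor [eps], a surplus of [delta] over the rate [1 - delta]. With the
    coefficient [delta / 2], the site lost at the middle of a path uses up at most half of this
    surplus. *)
Definition profile (eps : R) (s : nat) : R :=
  expR (ln eps * ((1 - delta) * s%:R + delta / 2 * s%:R `^ beta)).

(* This is [(exp (- rho s^beta) / (4 (s + 1))) ^ alpha]; [s + 1] instead of [s]
   keeps it positive at 0. *)
Definition divisor (s : nat) : R :=
  expR (- (alpha * (rho * s%:R `^ beta + ln 4 + ln s.+1%:R))).

Definition weight (s : nat) : R := (s.+1%:R ^+ d.*2)^-1.

Let c := concave_gain beta.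

Lemma weightE s : weight s = expR (- ((d.*2)%:R * ln s.+1%:R)).
Proof.
by rewrite /weight expRN expRM_natl lnK // posrE ltr0n.
Qed.

Lemma exp_bound (t x y : R) : 0 < t -> y - x <= ln t -> expR y <= t * expR x.
Proof.
move=> t0 h; rewrite -{1}(lnK t0) -expRD ler_expR; lra.
Qed.

Lemma profile_exists (tau Cw : R) : 0 < tau -> 40 * (d.+1)%:R * tau * Cw <= 1 ->
  exists2 eps0, 0 < eps0 <= 1 &
  forall eps, 0 < eps < eps0 -> decay_profile d eps tau Cw divisor weight (profile eps).
Proof.
move=> t0 tC.
have [b0 b1] := andP hbeta; have [d0 d1] := andP hdelta; have ha := halpha; have hr0 := hrho.
have c0 := concave_gain_gt0 hbeta; rewrite -/c in c0.
pose D : R := (d.*2)%:R; have D0 : 0 <= D by rewrite ler0n.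
pose bi : R := beta^-1; have bi0 : 0 < bi by rewrite invr_gt0.
(* [A] collects the logarithmic costs of [tau], of the weight and of the small denominator. The
   threshold [L] for [|ln eps|] makes both [delta / 2 * |ln eps|] and its product with [c] at least
   [A]. *)
pose A : R := `|ln tau| + 2 * D * bi + alpha * (2 * rho + ln 4 + 2 * bi).
have ln4 : 0 <= ln 4 :> R by rewrite ln_ge0 //; lra.
have al0 : 0 < alpha by lra.
have A0 : 0 <= A.
  by rewrite !addr_ge0 ?mulr_ge0 ?addr_ge0 ?mulr_ge0 // ?ltW.
pose L := (2 * A / delta) + 2 * A / (delta * c).
have L0 : 0 <= L by rewrite addr_ge0 // divr_ge0 ?mulr_ge0 // ltW // mulr_gt0.
exists (expR (- L)); first by rewrite expR_gt0 /= -expR0 ler_expR; lra.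
move=> eps /andP[e0 eL].
set l := - ln eps.
have lL : L <= l by rewrite /l lerNr -(expRK (- L)) ler_ln ?posrE ?expR_gt0 // ltW.
have lA1 : A <= l * (delta / 2).
  apply: (@le_trans _ _ ((2 * A / delta) * (delta / 2))).
    by rewrite le_eqVlt; apply/orP; left; apply/eqP; field; rewrite gt_eqF.
  rewrite ler_pM2r ?divr_gt0 //; apply: le_trans lL; rewrite /L lerDl.
  by rewrite divr_ge0 ?mulr_ge0 // ltW // mulr_gt0.
have lA2 : A <= l * (delta / 2) * c.
  apply: (@le_trans _ _ ((2 * A / (delta * c)) * (delta / 2) * c)).
    by rewrite le_eqVlt; apply/orP; left; apply/eqP; field; rewrite !gt_eqF.
  rewrite -[leLHS]mulrA -[leRHS]mulrA ler_pM2r ?mulr_gt0 ?divr_gt0 //; apply: le_trans lL;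
    rewrite /L lerDr.
  by rewrite divr_ge0 ?mulr_ge0 // ltW.
have l0 : 0 <= l by lra.
have ld : 0 <= l * (delta / 2) by rewrite mulr_ge0 // divr_ge0 // ltW.
have lnt : - `|ln tau| <= ln tau by rewrite lerNl ler_normr lexx orbT.
have lne : ln eps = - l by rewrite opprK.
have bw s : 0 < weight s by rewrite invr_gt0 exprn_gt0 // ltr0n.
have prE s : profile eps s = expR (- (l * ((1 - delta) * s%:R + delta / 2 * s%:R `^ beta))).
  by rewrite /profile lne mulNr.
have lnS (s : nat) : (1 <= s)%N -> D * ln (s.+1%:R : R) <= 2 * D * bi * s%:R `^ beta.
  move=> s1; have := ln_natS_le hbeta s; rewrite -/bi => h.
  have y1 := powR_nat_ge1 hbeta s1.
  apply: (@le_trans _ _ (D * (bi * (s%:R `^ beta + 1)))); first exact: ler_wpM2l.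
  have := mulr_ge0 D0 (ltW bi0); nra.
have aq : 0 <= alpha * (2 * rho + ln 4 + 2 * bi).
  by rewrite !mulr_ge0 ?addr_ge0 ?mulr_ge0 // ltW.
split; [exact: e0|exact: t0|exact: tC|by move=> s; exact: expR_gt0|exact: bw
  |by move=> s; exact: expR_gt0|..].
- by rewrite prE powR0 ?gt_eqF // !mulr0 addr0 mulr0 oppr0 expR0.
- move=> s r sr; rewrite !prE ler_expR lerN2 ler_wpM2l // lerD //.
    by rewrite ler_wpM2l ?ler_nat //; lra.
  rewrite ler_pM2l ?divr_gt0 //; apply: ge0_ler_powR; rewrite ?nnegrE ?ler0n ?ler_nat //.
  exact: ltW.
(* The linear exponents of both sides agree, so only the concave gain pays; since [s >= 1],
   constants too are bounded by multiples of [s^beta]. *)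
- move=> s r s1 s2; rewrite !prE weightE -expRD -[leRHS]mulrA -expRD.
  apply: exp_bound => //.
  have sr : (s <= r)%N by apply: leq_trans s2; rewrite -addnn leq_addr.
  rewrite natrB //.
  have cg := @powR_concave_gain _ _ hbeta s%:R r%:R (ler0n _ _).
  have {}cg := cg ltac:(by rewrite -natrM ler_nat mul2n); rewrite -/c in cg.
  have h := lnS s s1; rewrite -/D; have y1 := powR_nat_ge1 hbeta s1.
  set y := s%:R `^ beta in y1 h cg *; set x := r%:R `^ beta in cg *.
  set z := (r%:R - s%:R) `^ beta in cg *.
  have k1 : l * (delta / 2) * (c * y) <= l * (delta / 2) * (y + z - x).
    by apply: ler_wpM2l => //; lra.
  have k2 : A * y <= l * (delta / 2) * (c * y).
    by rewrite mulrA ler_wpM2r //; lra.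
  have k3 : `|ln tau| + D * ln s.+1%:R <= A * y.
    have : `|ln tau| <= `|ln tau| * y by rewrite ler_peMr.
    rewrite /A; nra.
  lra.
(* The linear exponents leave a surplus [delta], and passing from [(r - h)^beta] to
   [(r - h - 1)^beta] costs at most [delta / 2]. The rest, [delta / 2 * (1 + c * h^beta)], pays for
   [A * (1 + h^beta)]; the constant part matters because [h] is 0 for [r = 1]. *)
- move=> r r1; set h := r./2.
  rewrite -[leRHS]mulrA -[leRHS]mulrA !prE weightE /divisor -{1}(lnK e0) -!expRD.
  apply: exp_bound => //; rewrite lne -/D.
  have hr : (h.+1 <= r)%N := half_lt r1.
  rewrite natrB //.
  have cg := @powR_concave_gain _ _ hbeta h%:R r%:R (ler0n _ _).
  have h2r : 2 * h%:R <= r%:R :> R by rewrite -natrM ler_nat mul2n /h double_half_le.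
  have {}cg := cg h2r; rewrite -/c in cg.
  have p1 := powR_subadd hbeta (x := r%:R - h.+1%:R) (y := 1).
  have {}p1 := p1 ltac:(by rewrite subr_ge0 ler_nat) ler01.
  have e1 : r%:R - h.+1%:R + 1 = r%:R - h%:R :> R by rewrite -natr1; ring.
  rewrite e1 powR_1l in p1.
  have rb : r%:R `^ beta <= 2 * h%:R `^ beta + 1.
    apply: (@le_trans _ _ ((h%:R + h%:R + 1) `^ beta)).
      apply: ge0_ler_powR; rewrite ?nnegrE ?addr_ge0 ?ler0n ?(ltW b0) //.
      by rewrite -natrD natr1 ler_nat addnn /h le_doubleS_half.
    apply: le_trans (powR_subadd hbeta _ _) _; rewrite ?addr_ge0 // powR_1l lerD2r.
    by apply: le_trans (powR_subadd hbeta _ _) _; rewrite //; lra.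
  have lr := ln_natS_le hbeta r; have lh := ln_natS_le hbeta h; rewrite -/bi in lr lh.
  have y0 : 0 <= (h%:R : R) `^ beta by exact: powR_ge0.
  have eR : h.+1%:R = h%:R + 1 :> R by rewrite natr1.
  set y := h%:R `^ beta in cg rb lh y0 *; set x := r%:R `^ beta in cg rb lr *.
  set z := (r%:R - h.+1%:R) `^ beta in p1 *; set z' := (r%:R - h%:R) `^ beta in cg p1 *.
  rewrite eR.
  have k1 : l * (delta / 2) * (c * y - 1) <= l * (delta / 2) * (y + z - x).
    by apply: ler_wpM2l => //; lra.
  have k2 : A * y <= l * (delta / 2) * c * y by rewrite ler_wpM2r.
  have k4 : D * ln (h%:R + 1) <= D * bi * y + D * bi.
    by rewrite -eR; apply: (@le_trans _ _ (D * (bi * (y + 1)))); [exact: ler_wpM2l|lra].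
  have k5 : alpha * (rho * x + ln 4 + ln r.+1%:R) <=
      alpha * (2 * rho + ln 4 + 2 * bi) * (y + 1).
    rewrite -mulrA ler_pM2l //.
    have q1 : rho * x <= rho * (2 * y + 1) by rewrite ler_pM2l.
    have q2 : bi * (x + 1) <= bi * (2 * y + 2) by rewrite ler_pM2l //; lra.
    have q3 : 0 <= ln 4 * y by rewrite mulr_ge0.
    lra.
  have k6 : `|ln tau| + D * ln (h%:R + 1) + alpha * (rho * x + ln 4 + ln r.+1%:R) <= A * y + A.
    have q1 : 0 <= `|ln tau| * y by rewrite mulr_ge0.
    have q2 : 0 <= D * bi by rewrite mulr_ge0 // ltW.
    have q3 : 0 <= D * bi * y by rewrite mulr_ge0.
    rewrite /A; lra.
  lra.
- move=> s s1; rewrite prE weightE; apply: exp_bound => //.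
  have h := lnS s s1; rewrite -/D; have y1 := powR_nat_ge1 hbeta s1.
  set y := s%:R `^ beta in y1 h *.
  have k2 : A * y <= l * (delta / 2) * y by rewrite ler_wpM2r //; lra.
  have k3 : `|ln tau| + D * ln s.+1%:R <= A * y.
    have : `|ln tau| <= `|ln tau| * y by rewrite ler_peMr.
    rewrite /A; nra.
  have k4 : 0 <= l * ((1 - delta) * s%:R) by rewrite !mulr_ge0 //; lra.
  lra.
Qed.

End Profile.

(** * The lattice and its periodic approximations *)

Section Lattice.
Variable d : nat.
Implicit Types n k : 'rV[int]_d.

Lemma l1normD n k : (l1norm (n + k)%R <= l1norm n + l1norm k)%N.
Proof.
rewrite /l1norm -big_split /=; apply: leq_sum => i _; rewrite mxE.
move: (n ord0 i) (k ord0 i) => x y; lia.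
Qed.

Lemma l1normN n : l1norm (- n) = l1norm n.
Proof. by apply: eq_bigr => i _; rewrite mxE abszN. Qed.

Lemma l1norm0 : l1norm (0 : 'rV[int]_d) = 0%N.
Proof. by rewrite /l1norm big1 // => i _; rewrite mxE. Qed.

Lemma l1norm_eq0 n : (l1norm n == 0%N) = (n == 0).
Proof.
apply/idP/eqP => [|->]; last by rewrite l1norm0.
rewrite /l1norm sum_nat_eq0 => /forallP h; apply/rowP => i; rewrite mxE.
by have := h i; rewrite implyTb absz_eq0 => /eqP.
Qed.

Lemma l1norm_delta (i : 'I_d) : l1norm (delta_mx 0 i : 'rV[int]_d) = 1%N.
Proof.
rewrite /l1norm (bigD1 i) //= mxE !eqxx big1 // => j ji.
by rewrite mxE (negPf ji) andbF.
Qed.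

(** Boxes of sites become finite types, which serve to list balls and to expand products over
    coordinates. [Negz k] is [-(k + 1)], so 0 has a single code. *)
Definition decode_int M (z : bool * 'I_M) : int := if z.1 then Posz z.2 else Negz z.2.

Definition decode_site M (h : {ffun 'I_d -> bool * 'I_M}) : 'rV[int]_d :=
  \row_i decode_int (h i).

Lemma decode_int_ex M (z : int) : (`|z| < M)%N -> exists y : bool * 'I_M, decode_int y = z.
Proof.
case: z => k kM.
  by exists (true, Ordinal kM).
have kM' : (k < M)%N by move: kM; rewrite NegzE abszN; lia.
by exists (false, Ordinal kM').
Qed.

Lemma decode_site_ex M n : (l1norm n < M)%N -> exists h : {ffun 'I_d -> bool * 'I_M},
  decode_site h = n.
Proof.
move=> nM; have /fin_all_exists[h hE] : forall i, exists y : bool * 'I_M, decode_int y = n ord0 i.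
  move=> i; apply: decode_int_ex; apply: leq_ltn_trans nM.
  by rewrite /l1norm (bigD1 i) //= leq_addr.
by exists [ffun i => h i]; apply/rowP => i; rewrite mxE ffunE hE.
Qed.

Definition ball L : seq 'rV[int]_d :=
  [seq n <- undup (map (@decode_site L.+1) (enum {: {ffun 'I_d -> bool * 'I_L.+1}}))
     | (l1norm n <= L)%N].

Lemma mem_ball L n : (n \in ball L) = (l1norm n <= L)%N.
Proof.
rewrite mem_filter; apply: andb_idr => nL; rewrite mem_undup.
have [h <-] := @decode_site_ex L.+1 n nL.
by rewrite map_f // mem_enum.
Qed.

Lemma ball_uniq L : uniq (ball L).
Proof. by rewrite filter_uniq // undup_uniq. Qed.

End Lattice.

Section LatticeSum.
Variable (R : realType).

Lemma sum_inv_sqr M : \sum_(j < M) (((j.+1)%:R : R) ^+ 2)^-1 <= 2.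
Proof.
case: M => [|M]; first by rewrite big_ord0.
suff h : \sum_(j < M.+1) (((j.+1)%:R : R) ^+ 2)^-1 <= 2 - (M.+1)%:R^-1.
  by apply: le_trans h _; rewrite lerBlDr lerDl invr_ge0.
elim: M => [|M IH]; first by rewrite big_ord1 expr1n invr1; lra.
rewrite big_ord_recr /=; apply: le_trans (lerD IH (lexx _)) _.
have p0 : 0 < (M.+1)%:R :> R by rewrite ltr0n.
rewrite -[M.+2%:R]natr1; set x := M.+1%:R in p0 *.
have -> : 2 - x^-1 + ((x + 1) ^+ 2)^-1 = 2 - (x + 1)^-1 - (x * (x + 1) ^+ 2)^-1.
  by field; rewrite !gt_eqF // ltr_pwDr.
by rewrite lerBlDr lerDl invr_ge0 mulr_ge0 ?sqr_ge0 // ltW.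
Qed.

(** The exponent [2 d] of the weight allots an inverse square to every coordinate. *)
Lemma weight_le_prod d (n : 'rV[int]_d) :
  weight R d (l1norm n) <= \prod_i ((`|n ord0 i|.+1%:R : R) ^+ 2)^-1.
Proof.
rewrite /weight prodfV lef_pV2; first last.
- by rewrite posrE; apply: prodr_gt0 => i _; apply: exprn_gt0; exact: ltr0Sn.
- by rewrite posrE exprn_gt0 // ltr0n.
have -> : (l1norm n).+1%:R ^+ d.*2 = \prod_(i < d) (((l1norm n).+1%:R : R) ^+ 2).
  by rewrite prodr_const card_ord -exprM mul2n.
apply: ler_prod => i _; rewrite exprn_ge0 //= ler_pXn2r ?nnegrE // ler_nat ltnS.
by rewrite /l1norm (bigD1 i) //= leq_addr.
Qed.

(** The product bound factorizes over coordinates, and each contributes at most 2 from the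
    nonnegative and 2 from the negative integers. *)
Lemma sum_weight_le d (F : seq 'rV[int]_d) : uniq F ->
  \sum_(n <- F) weight R d (l1norm n) <= 4 ^+ d.
Proof.
move=> uF; pose M := (\max_(n <- F) l1norm n).+1.
have FM n : n \in F -> (l1norm n < M)%N by move=> nF; rewrite ltnS (leq_bigmax_seq _ nF).
pose g (y : bool * 'I_M) : R := ((`|decode_int y|.+1%:R : R) ^+ 2)^-1.
have g0 y : 0 <= g y by rewrite invr_ge0 sqr_ge0.
pose G (h : {ffun 'I_d -> bool * 'I_M}) : R := \prod_i g (h i).
have [enc encE] : exists enc : 'rV[int]_d -> {ffun 'I_d -> bool * 'I_M},
    forall n, n \in F -> decode_site (enc n) = n.
  have /boolp.choice[enc h] : forall n : 'rV[int]_d, exists h : {ffun 'I_d -> bool * 'I_M},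
     n \in F -> decode_site h = n.
    move=> n; have [nF|nF] := boolP (n \in F); last by exists [ffun=> (true, ord0)].
    by have [h <-] := decode_site_ex (FM n nF); exists h.
  by exists enc.
apply: (@le_trans _ _ (\sum_(h <- map enc F) G h)).
  rewrite big_map big_seq [leRHS]big_seq; apply: ler_sum => n nF.
  apply: le_trans (weight_le_prod n) _; rewrite le_eqVlt; apply/orP; left; apply/eqP.
  by apply: eq_bigr => i _; rewrite -{1}(encE n nF) mxE.
have uF' : uniq (map enc F).
  rewrite map_inj_in_uniq // => n k nF kF e.
  by rewrite -(encE n nF) -(encE k kF) e.
rewrite big_uniq //=; apply: (@le_trans _ _ (\sum_h G h)).
  rewrite [leRHS](bigID (mem (map enc F))) /= lerDl; apply: sumr_ge0 => h _.
  by apply: prodr_ge0 => i _.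
rewrite /G -(bigA_distr_bigA (fun (i : 'I_d) y => g y)) /=.
have -> : 4 ^+ d = \prod_(i < d) (4 : R) by rewrite prodr_const card_ord.
apply: ler_prod => i _; rewrite sumr_ge0 //=.
have -> : \sum_y g y = \sum_(b : bool) \sum_(j < M) g (b, j).
  by rewrite pair_big /=; apply: eq_bigr => -[].
rewrite big_bool /=.
have -> : 4 = 2 + 2 :> R by lra.
apply: lerD; apply: le_trans (sum_inv_sqr M); apply: ler_sum => j _.
  by [].
by rewrite /g /decode_int /= lef_pV2 ?posrE ?exprn_gt0 ?ltr0n // ler_pXn2r ?nnegrE // ler_nat ltnW.
Qed.

End LatticeSum.

(* The potential of the finite model must take prescribed values at finitely
   many sites and keep the gaps everywhere. *)
Lemma mcshane_extension (R : realType) (I : eqType) (S : seq I) (r : I -> nat) (v : I -> R)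
    (gam : nat -> R) :
  gam 0%N = 0 -> (forall k, 0 <= gam k) -> (forall j k, gam j + gam k <= gam (j + k)%N) ->
  (forall s s', s \in S -> s' \in S -> (r s < r s')%N -> v s + gam (r s' - r s)%N <= v s') ->
  (forall s s', s \in S -> s' \in S -> r s = r s' -> s = s') ->
  exists V : nat -> R, (forall s, s \in S -> V (r s) = v s) /\
    forall j k, V j + gam k <= V (j + k)%N.
Proof.
move=> g0 gge gD sep inj.
(* Low enough that the baseline [m0 + gam j] exceeds no prescribed value. *)
pose m0 := - \sum_(s <- S) (`|v s| + gam (r s)).
have m0le s : s \in S -> m0 + gam (r s) <= v s.
  move=> sS; have : `|v s| + gam (r s) <= \sum_(s <- S) (`|v s| + gam (r s)).
    rewrite (big_rem s) //= lerDl; apply: sumr_ge0 => i _; exact: addr_ge0.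
  have := ler_norm (- v s); rewrite normrN /m0; lra.
(* The largest of the lower bounds forced at [j] by the prescribed values at or below it;
   superadditivity of [gam] hands the gaps on to [V]. *)
pose V j := \big[Num.max/(m0 + gam j)]_(s <- S | (r s <= j)%N) (v s + gam (j - r s)%N).
have Vge j s : s \in S -> (r s <= j)%N -> v s + gam (j - r s)%N <= V j.
  by move=> sS sj; exact: (le_bigmax_seq (m0 + gam j) _ _ (fun s => v s + gam (j - r s)%N) sS).
exists V; split=> [s sS|j k].
  apply/eqP; rewrite eq_le; apply/andP; split; last first.
    by have := Vge (r s) s sS (leqnn _); rewrite subnn g0 addr0.
  rewrite /V big_seq_cond; apply: bigmax_le; first exact: m0le.
  move=> s' /andP[s'S]; rewrite leq_eqVlt => /predU1P[/inj <-//|lt].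
    by rewrite subnn g0 addr0.
  exact: sep.
rewrite -lerBrDr /V big_seq_cond; apply: bigmax_le.
  rewrite lerBrDr -addrA; apply: le_trans (bigmax_ge_id _ _ _ _).
  by rewrite lerD2l.
move=> s /andP[sS sj]; rewrite lerBrDr -addrA.
apply: le_trans (Vge (j + k)%N s sS (leq_trans sj (leq_addr _ _))).
by rewrite lerD2l -addnBAC.
Qed.

Section Residues.
Variable m : nat.
Notation T := 'I_m.+1.

Definition resid (z : int) : T := (inZp 1 : T) *~ z.

Lemma residD x y : resid (x + y) = resid x + resid y.
Proof. exact: mulrzDr. Qed.

Lemma residN x : resid (- x) = - resid x.
Proof. exact: mulrNz. Qed.

Lemma resid_nat (n : nat) : resid (Posz n) = inZp n.
Proof.
apply: val_inj; rewrite /resid -pmulrn Zp_mulrn /=.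
by rewrite modnMml mul1n.
Qed.

Lemma resid_ord (j : T) : resid (Posz j) = j.
Proof. by rewrite resid_nat valZpK. Qed.

Lemma resid_eq0 z : resid z = 0 -> exists k : int, z = k * (Posz m.+1).
Proof.
have h (n : nat) : resid (Posz n) = 0 -> exists k : int, Posz n = k * (Posz m.+1).
  rewrite resid_nat => /(congr1 val) /= /eqP n0.
  by exists (Posz (n %/ m.+1)); rewrite -PoszM divnK.
case: z => n; first exact: h.
rewrite NegzE residN => /eqP; rewrite oppr_eq0 => /eqP/h[k e].
by exists (- k); rewrite e mulNr.
Qed.

Lemma resid_mul_eq0 (k : int) : resid (k * Posz m.+1) = 0.
Proof.
have e : resid (Posz m.+1) = 0 by rewrite resid_nat; apply: val_inj; rewrite /= modnn.
by rewrite /resid mulrC mulrzA -/(resid _) e mul0rz.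
Qed.

End Residues.

(** * Rational frequencies and the distance on residues *)

Section Frequency.
Variables (R : realType) (d m : nat) (omega : 'rV[R]_d) (rho beta : R).
Notation T := 'I_m.+1.
Notation N := (m.+1%:R : R).
Hypothesis omega01 : forall i, 0 <= omega 0 i < 1.
Hypothesis omega_dioph : forall n : 'rV[int]_d, n != 0 -> forall k : int,
  expR (- (rho * (l1norm n)%:R `^ beta)) <= `|zdot n omega - k%:~R|.

Definition freq_num (i : 'I_d) : nat := Num.truncn (N * omega 0 i).

Definition freq_dot (n : 'rV[int]_d) : int := \sum_i Posz (freq_num i) * n 0 i.

Lemma freq_dotD n k : freq_dot (n + k) = freq_dot n + freq_dot k.
Proof. by rewrite /freq_dot -big_split; apply: eq_bigr => i _; rewrite mxE mulrDr. Qed.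

Lemma freq_dotN n : freq_dot (- n) = - freq_dot n.
Proof. by rewrite /freq_dot -sumrN; apply: eq_bigr => i _; rewrite mxE mulrN. Qed.

Lemma freq_dot_delta (z : int) i : freq_dot (z *: delta_mx 0 i) = Posz (freq_num i) * z.
Proof.
rewrite /freq_dot (bigD1 i) //= !mxE !eqxx mulr1 big1 ?addr0 // => j ji.
by rewrite !mxE (negPf ji) andbF !mulr0.
Qed.

Lemma freq_dot_zdot n : `|(freq_dot n)%:~R - N * zdot n omega| <= (l1norm n)%:R.
Proof.
rewrite /freq_dot /zdot /l1norm mulr_sumr natr_sum rmorph_sum -sumrB.
apply: le_trans (ler_norm_sum _ _ _) _; apply: ler_sum => i _.
have [w0 _] := andP (omega01 i).
have /andP[t1 t2] := truncn_itv (mulr_ge0 (ler0n R m.+1) w0).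
rewrite rmorphM /= mulrCA -[(n 0 i)%:~R * _]mulrC -mulrBl normrM.
rewrite -[leRHS]mul1r natr_absz intr_norm.
apply: ler_pM => //.
rewrite ler_norml; move: t1 t2; rewrite -/(freq_num i) -natr1 -pmulrn; lra.
Qed.

(** If [N * e >= 2 s], the rounding error [s] takes at most half of [N * e]; otherwise the left side
    is below 1 and the right side is the modulus of a nonzero integer. The bound thus holds however
    large [n] is compared with [N]. *)
Lemma freq_dot_dioph n (k : int) : n != 0 -> freq_dot n - k * Posz m.+1 != 0 ->
  N * expR (- (rho * (l1norm n)%:R `^ beta)) / (2 * (l1norm n)%:R) <=
  `|(freq_dot n - k * Posz m.+1)%:~R|.
Proof.
move=> n0 z0; set e := expR _; set s := (l1norm n)%:R.
have s1 : 1 <= s by rewrite ler1n lt0n l1norm_eq0.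
have X1 : 1 <= `|(freq_dot n - k * Posz m.+1)%:~R : R|.
  rewrite -intr_norm -[1]/(1%:~R) ler_int -gtz0_ge1 normr_gt0 //.
have h1 := omega_dioph n0 k; rewrite -/e in h1.
have h2 := freq_dot_zdot n; rewrite -/s in h2.
have X2 : N * e - s <= `|(freq_dot n - k * Posz m.+1)%:~R : R|.
  have -> : (freq_dot n - k * Posz m.+1)%:~R =
     N * (zdot n omega - k%:~R) + ((freq_dot n)%:~R - N * zdot n omega) :> R.
    by rewrite rmorphB rmorphM /= -pmulrn; ring.
  apply: le_trans (lerB_normD _ _).
  rewrite normrM ger0_norm ?ler0n //; apply: lerB => //.
  by rewrite ler_pM2l // ltr0n.
rewrite ler_pdivrMr; last by lra.
have [h|h] := leP (2 * s) (N * e); nra.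
Qed.

Hypothesis freq_surj : forall x : T, exists n, resid m (freq_dot n) = x.

Fact nrm_ex (x : T) : exists s, `[< exists n, l1norm n = s /\ resid m (freq_dot n) = x >].
Proof. by have [n nx] := freq_surj x; exists (l1norm n); apply/asboolP; exists n. Qed.

(** The quotient norm that the residues inherit from the l1 norm of Z^d through [freq_dot]; it is
    the distance in which the finite eigenfunctions decay. *)
Definition nrm (x : T) : nat := ex_minn (nrm_ex x).

Lemma nrm_rep x : exists2 n, l1norm n = nrm x & resid m (freq_dot n) = x.
Proof. by rewrite /nrm; case: ex_minnP => s /asboolP[n [e1 e2]] _; exists n. Qed.

Lemma nrm_le n : (nrm (resid m (freq_dot n)) <= l1norm n)%N.
Proof.
by rewrite /nrm; case: ex_minnP => s _; apply; apply/asboolP; exists n.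
Qed.

Lemma nrmD x y : (nrm (x + y)%R <= nrm x + nrm y)%N.
Proof.
have [n <- e] := nrm_rep x; have [k <- e'] := nrm_rep y.
rewrite -e -e' -residD -freq_dotD; apply: leq_trans (nrm_le _) _; exact: l1normD.
Qed.

Lemma nrmN x : nrm (- x) = nrm x.
Proof.
have h y : (nrm (- y)%R <= nrm y)%N.
  have [n <- e] := nrm_rep y; rewrite -e -residN -freq_dotN.
  by apply: leq_trans (nrm_le _) _; rewrite l1normN.
by apply/eqP; rewrite eqn_leq h -{1}(opprK x) h.
Qed.

Lemma freq_dot0 : freq_dot 0 = 0.
Proof. by rewrite /freq_dot big1 // => i _; rewrite mxE mulr0. Qed.

Lemma nrm0 x : (nrm x == 0%N) = (x == 0).
Proof.
apply/idP/eqP => [|->].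
  have [n <- e] := nrm_rep x; rewrite l1norm_eq0 => /eqP n0.
  by rewrite -e n0 freq_dot0.
have := nrm_le 0; rewrite freq_dot0 l1norm0 leqn0.
by [].
Qed.

Lemma nrm_step i : (nrm (resid m (Posz (freq_num i))) <= 1)%N.
Proof.
have := nrm_le (delta_mx 0 i); rewrite l1norm_delta.
by have := freq_dot_delta 1 i; rewrite scale1r mulr1 => ->.
Qed.

(** Shortest representatives of distinct residues are distinct sites, so the bound on Z^d applies
    for every modulus. *)
Lemma sum_weight_nrm : \sum_x weight R d (nrm x) <= 4 ^+ d.
Proof.
have /boolp.choice[rep repE] : forall x, exists n, l1norm n = nrm x /\ resid m (freq_dot n) = x.
  by move=> x; have [n] := nrm_rep x; exists n.
have u : uniq (map rep (enum T)).
  rewrite map_inj_uniq ?enum_uniq // => x y e.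
  by rewrite -(repE x).2 -(repE y).2 e.
apply: le_trans (sum_weight_le R u).
rewrite big_map big_enum /= le_eqVlt; apply/orP; left; apply/eqP.
by apply: eq_bigr => x _; rewrite (repE x).1.
Qed.

(** A shorter representative would differ from [l] by a nonzero site of norm at most [2 K] and
    residue 0. *)
Lemma nrm_eq K l : (forall q, q != 0 -> (l1norm q <= K + K)%N -> resid m (freq_dot q) != 0) ->
  (l1norm l <= K)%N -> nrm (resid m (freq_dot l)) = l1norm l.
Proof.
move=> hK lK; apply/eqP; rewrite eqn_leq nrm_le /=.
have [n en e] := nrm_rep (resid m (freq_dot l)); rewrite -en.
have [->//|nl] := eqVneq n l.
have [//|lt] := leqP (l1norm l) (l1norm n).
have := hK (n - l); rewrite subr_eq0 => /(_ nl).
have le : (l1norm (n - l)%R <= K + K)%N.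
  apply: leq_trans (l1normD _ _) _; rewrite l1normN leq_add //.
  exact: leq_trans (ltnW lt) lK.
by move=> /(_ le); rewrite freq_dotD freq_dotN residD residN e subrr eqxx.
Qed.

(** [c >= 1/2] turns the 2 of [freq_dot_dioph] into the 4 of [divisor]. The base is at most 1, so
    its power [alpha] lies below its power [alpha'], and one divisor serves all exponents from 1 to
    [alpha]. *)
Lemma freq_gap_divisor (alpha alpha' c : R) (i j : T) : 1 <= alpha' -> alpha' <= alpha ->
  0 < rho -> 2^-1 <= c -> c <= 1 -> (i < j)%N ->
  divisor alpha rho beta (nrm (j - i)%R) <= (c * (j - i)%N%:R / N) `^ alpha'.
Proof.
move=> a1 aa rho0 c2 c1 ij; have [n en e] := nrm_rep (j - i)%R; rewrite -en.
have rE : resid m (freq_dot n) = resid m (Posz (j - i)%N).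
  by rewrite e -subzn ?(ltnW ij) // residD residN !resid_ord.
have [k kE] : exists k : int, Posz (j - i)%N = freq_dot n - k * Posz m.+1.
  have /resid_eq0[k h] : resid m (freq_dot n - Posz (j - i)%N) = 0.
    by rewrite residD residN rE subrr.
  by exists k; rewrite -h opprB addrC subrK.
have z0 : freq_dot n - k * Posz m.+1 != 0 by rewrite -kE eqz_nat subn_eq0 -ltnNge.
have n0 : n != 0.
  apply: contraTneq ij => n0; rewrite -leqNgt.
  move: e; rewrite n0 freq_dot0 => /esym/eqP; rewrite subr_eq0 => /eqP ->.
  by [].
have := freq_dot_dioph n0 z0; rewrite -kE -pmulrn normr_nat.
set s := l1norm n; have s1 : 1 <= s%:R :> R by rewrite ler1n lt0n l1norm_eq0.
set E := expR _ => hd.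
have N0 : 0 < N by rewrite ltr0n.
have s0 : 0 < s%:R :> R by lra.
have E0 : 0 < E := expR_gt0 _.
have jiN : (j - i)%N%:R <= N by rewrite ler_nat (leq_trans (leq_subr _ _)) // ltnW.
set X := c * (j - i)%N%:R / N.
have X1 : X <= 1 by rewrite ler_pdivrMr // mul1r; have := ler0n R (j - i)%N; nra.
have EX : E / (4 * s%:R) <= X.
  rewrite /X ler_pdivlMr //.
  have -> : E / (4 * s%:R) * N = 2^-1 * (N * E / (2 * s%:R)) by field; rewrite gt_eqF.
  apply: ler_pM => //; by rewrite !mulr_ge0 ?invr_ge0 ?mulr_ge0 // ltW.
have F0 : 0 < E / (4 * s%:R) by rewrite divr_gt0 ?mulr_gt0.
have X0 : 0 < X by exact: lt_le_trans EX.
rewrite /divisor.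
apply: (@le_trans _ _ ((E / (4 * s%:R)) `^ alpha)); last first.
  apply: (@le_trans _ _ (X `^ alpha)).
    apply: ge0_ler_powR; rewrite ?nnegrE ?(ltW F0) ?(ltW X0) //; lra.
  rewrite /powR gt_eqF // ler_expR ler_wnM2r //.
  by apply: ln_le0.
rewrite [leRHS]/powR (gt_eqF F0) ler_expR.
rewrite ln_div ?posrE ?mulr_gt0 // lnM ?posrE // expRK.
rewrite -mulrN ler_pM2l; last by lra.
have : ln (s%:R : R) <= ln s.+1%:R by rewrite ler_ln ?posrE ?ler_nat.
lra.
Qed.

End Frequency.

(** For a prime modulus [N], the multiples of a single numerator strictly between 0 and [N] cover
    all residues. A short [q] of residue 0 would give [N * |q . omega - k| <= K], against the
    Diophantine bound for large [N]. *)
Lemma frequency_approx (R : realType) d (omega : 'rV[R]_d) (rho beta : R) (K M : nat) :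
  (1 <= d)%N -> 0 < beta -> 0 < rho ->
  (forall i, 0 <= omega 0 i < 1) ->
  (forall n : 'rV[int]_d, n != 0 -> forall k : int,
    expR (- (rho * (l1norm n)%:R `^ beta)) <= `|zdot n omega - k%:~R|) ->
  exists2 m, (M <= m)%N & (forall x : 'I_m.+1, exists n, resid m (freq_dot m omega n) = x) /\
    forall q : 'rV[int]_d, q != 0 -> (l1norm q <= K)%N -> resid m (freq_dot m omega q) != 0.
Proof.
move=> hd b0 r0 w01 wd; pose i0 : 'I_d := Ordinal hd.
have w0 : 0 < omega 0 i0.
  rewrite lt_neqAle (andP (w01 i0)).1 andbT eq_sym; apply/eqP => w0.
  have n0 : (delta_mx 0 i0 : 'rV[int]_d) != 0 by rewrite -l1norm_eq0 l1norm_delta.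
  have := wd _ n0 0; rewrite /zdot (bigD1 i0) //= mxE !eqxx mul1r w0 big1 => [|j ji].
    by rewrite add0r subr0 normr0 leNgt expR_gt0.
  by rewrite mxE (negPf ji) andbF mul0r.
(* The first summand makes the numerator at least 1; the second rules out short sites of residue
   0. *)
pose X := (omega 0 i0)^-1 + K%:R * expR (rho * K%:R `^ beta).
have [N MN pN] := prime_above (M + Num.truncn X).+1.
case: N pN MN => [//|m] pN MN.
have XN : X < m.+1%:R.
  apply: lt_le_trans (truncnS_gt X) _; rewrite ler_nat.
  by apply: leq_trans (ltnW MN); rewrite ltnS leq_addl.
have N0 : 0 < m.+1%:R :> R by rewrite ltr0n.
exists m; first by rewrite -ltnS (leq_trans _ MN) // ltnS (leq_trans (leq_addr (Num.truncn X)
  _)) // leqnSn.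
split.
  move=> x; set A := freq_num m omega i0.
  have Nw : 1 <= m.+1%:R * omega 0 i0.
    rewrite -ler_pdivrMr // mul1r ltW //; apply: le_lt_trans XN.
    by rewrite /X lerDl mulr_ge0 // expR_ge0.
  have A0 : (0 < A)%N by rewrite /A truncn_gt0.
  have AN : (A < m.+1)%N.
    rewrite /A /freq_num truncn_lt_nat; last by rewrite ltW // mulr_gt0.
    by rewrite gtr_pMr // (andP (w01 i0)).2.
  have cop : coprime A m.+1.
    by rewrite coprime_sym prime_coprime // gtnNdvd.
  have /(coprimeP _ A0)[[u1 u2] /= ue] := cop.
  have {}ue : (u1 * A = 1 + u2 * m.+1)%N by move: ue; move: (u1 * A)%N (u2 * m.+1)%N => y z; lia.
  exists (Posz (u1 * x) *: delta_mx 0 i0).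
  rewrite freq_dot_delta -/A -PoszM mulnA [(A * u1)%N]mulnC ue mulnDl mul1n PoszD residD resid_ord.
  have -> : Posz (u2 * m.+1 * x) = Posz (u2 * x) * Posz m.+1 by rewrite -PoszM mulnAC.
  by rewrite resid_mul_eq0 addr0.
move=> q q0 qK; apply/eqP => /resid_eq0[k kE].
have h1 := freq_dot_zdot m w01 q; have h2 := wd q q0 k.
have h3 : m.+1%:R * `|zdot q omega - k%:~R| <= K%:R.
  have qK' : (l1norm q)%:R <= K%:R :> R by rewrite ler_nat.
  apply: le_trans (le_trans h1 qK'); rewrite kE rmorphM /= -pmulrn distrC.
  rewrite -(ger0_norm (ltW N0)) -normrM mulrBr [k%:~R * _]mulrC.
  by rewrite (ger0_norm (ltW N0)).
have qKp : (l1norm q)%:R `^ beta <= K%:R `^ beta :> R.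
  by apply: ge0_ler_powR; rewrite ?nnegrE ?ler_nat // ltW.
have h4 : expR (- (rho * K%:R `^ beta)) <= `|zdot q omega - k%:~R|.
  apply: le_trans h2; rewrite ler_expR lerN2; rewrite ler_pM2l //.
have : K%:R * expR (rho * K%:R `^ beta) < m.+1%:R.
  apply: le_lt_trans XN; rewrite /X lerDr ltW // invr_gt0 //.
apply/negP; rewrite -leNgt -ler_pdivrMr ?expR_gt0 // -expRN.
by apply: le_trans h3; rewrite ler_pM2l.
Qed.

Lemma powR_superadd (R : realType) (a x y : R) : 1 <= a -> 0 <= x -> 0 <= y ->
  x `^ a + y `^ a <= (x + y) `^ a.
Proof.
move=> a1 x0 y0; have [->|xn] := eqVneq x 0.
  by rewrite powR0 ?add0r // gt_eqF // (lt_le_trans ltr01).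
have [->|yn] := eqVneq y 0.
  by rewrite powR0 ?addr0 // gt_eqF // (lt_le_trans ltr01).
have xp : 0 < x by rewrite lt_neqAle eq_sym xn.
have yp : 0 < y by rewrite lt_neqAle eq_sym yn.
have h (z : R) : 0 < z -> z `^ a = z * z `^ (a - 1).
  by move=> z0; rewrite -{2}(powRr1 (ltW z0)) -powRD ?(gt_eqF z0) ?implybT // addrC subrK.
rewrite !h ?addr_gt0 // mulrDl; apply: lerD; rewrite ler_wpM2l //.
  by apply: ge0_ler_powR; rewrite ?nnegrE ?subr_ge0 ?addr_ge0 ?lerDl //.
by apply: ge0_ler_powR; rewrite ?nnegrE ?subr_ge0 ?addr_ge0 ?lerDr //.
Qed.

Lemma finite_min_gt0 (R : realType) (I : eqType) (S : seq I) (F : I -> R) :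
  (forall s, s \in S -> 0 < F s) -> exists2 g, 0 < g & forall s, s \in S -> g <= F s.
Proof.
elim: S => [|s S IH] h; first by exists 1.
have [|g g0 hg] := IH; first by move=> s' s'S; apply: h; rewrite inE s'S orbT.
exists (Num.min g (F s)); first by rewrite lt_min g0 h ?mem_head.
move=> s'; rewrite inE => /predU1P[->|/hg gs]; first by rewrite ge_min lexx orbT.
by apply: le_trans gs; rewrite ge_min lexx.
Qed.

Definition frac_part (R : realType) (t : R) : R := t - (Num.floor t)%:~R.

Lemma frac_part_itv (R : realType) (t : R) : 0 <= frac_part t < 1.
Proof.
have /andP[h1 h2] := floor_itv t; rewrite /frac_part.
by rewrite rmorphD /= in h2; apply/andP; split; lra.
Qed.

Lemma periodic1_int (R : realType) (T : Type) (g : R -> T) : periodic1 g ->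
  forall (x : R) (k : int), g (x + k%:~R) = g x.
Proof.
move=> pg; have h (n : nat) x : g (x + n%:R) = g x.
  by elim: n x => [|n IH] x; rewrite ?addr0 // -natr1 addrA pg IH.
move=> x [n|n]; first exact: h.
rewrite NegzE -(h n.+1 (x + _)); congr g.
by rewrite rmorphN /= -pmulrn subrK.
Qed.

Lemma periodic1_frac (R : realType) (T : Type) (g : R -> T) : periodic1 g ->
  forall x : R, g (frac_part x) = g x.
Proof. by move=> pg x; rewrite /frac_part -rmorphN periodic1_int. Qed.

Definition basis_vec d (i : 'I_d) : 'rV[int]_d := delta_mx 0 i.

(** * Several orbits in one finite model *)

Section Model.
Variables (R : realType) (d : nat) (alpha alpha' delta rho beta eps tau : R).
Variables (omega : 'rV[R]_d) (f : R -> \bar R) (B : finType) (x : B -> R) (K : nat).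
Local Notation pr := (profile delta beta eps).
Hypothesis hd : (1 <= d)%N.
Hypothesis hbeta : 0 < beta.
Hypothesis hrho : 0 < rho.
Hypothesis ha1 : 1 <= alpha'.
Hypothesis haa : alpha' <= alpha.
Hypothesis omega01 : forall i, 0 <= omega 0 i < 1.
Hypothesis omega_dioph : forall n : 'rV[int]_d, n != 0 -> forall k : int,
  expR (- (rho * (l1norm n)%:R `^ beta)) <= `|zdot n omega - k%:~R|.
Hypothesis dp : decay_profile d eps tau (4 ^+ d) (divisor alpha rho beta) (weight R d) pr.
Hypothesis hf : holder_monotone alpha' f.
Hypothesis distinct : forall b n b' n' (k : int),
  x b + zdot n omega - (x b' + zdot n' omega) = k%:~R -> b = b' /\ n = n'.

Let site := (B * 'rV[int]_d)%type.
Definition phase (s : site) : R := frac_part (x s.1 + zdot s.2 omega).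
Let sites : seq site := [seq (b, n) | b <- enum B, n <- ball d K].

Let mem_sites b n : ((b, n) \in sites) = (l1norm n <= K)%N.
Proof.
apply/allpairsP/idP => [[[b' n'] [/= _ + [_ ->]]]|nK]; first by rewrite mem_ball.
by exists (b, n); rewrite mem_enum mem_ball.
Qed.

Let phase_inj s s' : phase s = phase s' -> s = s'.
Proof.
case: s s' => [b n] [b' n'] /eqP; rewrite /phase /frac_part /= => /eqP e.
have := @distinct b n b' n' (Num.floor (x b + zdot n omega) - Num.floor (x b' + zdot n' omega)).
by case=> [|-> -> //]; rewrite rmorphB /=; lra.
Qed.

(* The factor lost in the gaps when [omega] is replaced by a rational
   frequency; it tends to 1 as [K] grows. *)
Definition model_ratio : R := 1 - (K.+2)%:R^-1.

Lemma model_ratio_itv : 2^-1 <= model_ratio < 1.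
Proof.
have h : (K.+2%:R : R)^-1 <= 2^-1 by rewrite lef_pV2 ?posrE // ler_nat.
have h' : 0 < (K.+2%:R : R)^-1 by rewrite invr_gt0.
rewrite /model_ratio; move: h h'; set k := _^-1 => h h'.
by apply/andP; split; lra.
Qed.

(** Once [N] is large against the finitely many phase differences, rounding respects their order.
    The upper estimate makes the values of [f] compatible with the gaps of the model; the lower one
    recovers the true gap as [K] grows. *)
Lemma residue_layout : exists m (J : B -> int),
  [/\ forall y : 'I_m.+1, exists n, resid m (freq_dot m omega n) = y,
      forall q : 'rV[int]_d, q != 0 -> (l1norm q <= K + K)%N -> resid m (freq_dot m omega q) != 0 &
      forall s s' : site, s \in sites -> s' \in sites -> phase s < phase s' ->
        let r s := val (resid m (J s.1 + freq_dot m omega s.2)) in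
        (r s < r s')%N /\
        model_ratio ^+ 2 * (phase s' - phase s)
          <= model_ratio * (r s' - r s)%N%:R / m.+1%:R <= phase s' - phase s].
Proof.
have /andP[c2 c1] := model_ratio_itv.
have p01 s : 0 <= phase s < 1 by exact: frac_part_itv.
(* The diagonal entries [1 - phase] keep the rounded position of the top site below [N], so that
   nothing wraps around. *)
have [g g0 hg] : exists2 g, 0 < g & forall z : site * site, z \in allpairs pair sites sites ->
   g <= (if z.1 == z.2 then 1 - phase z.1 else `|phase z.1 - phase z.2|).
  apply: finite_min_gt0 => -[s s'] _ /=; case: eqVneq => [_|ne].
    by have /andP[] := p01 s; lra.
  by rewrite normr_gt0 subr_eq0; apply: contra ne => /eqP/phase_inj ->.
have g1 s : s \in sites -> g <= 1 - phase s.
  move=> sS; have := hg (s, s); rewrite eqxx; apply.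
  by apply/allpairsP; exists (s, s).
have g2 s s' : s \in sites -> s' \in sites -> phase s < phase s' -> g <= phase s' - phase s.
  move=> sS sS' lt; have := hg (s', s); rewrite /=.
  have /negPf -> : s' != s by apply: contraTneq lt => ->; rewrite ltxx.
  rewrite gtr0_norm ?subr_gt0 //; apply.
  by apply/allpairsP; exists (s', s).
pose W : R := (K + K).+1%:R.
have W0 : 0 < W by rewrite ltr0n.
have [m mM [surj small]] := frequency_approx (K + K)
  (Num.truncn (W * K.+2%:R / g)).+1 hd hbeta hrho omega01 omega_dioph.
have N0 : 0 < (m.+1%:R : R) by rewrite ltr0n.
have Wg : W * K.+2%:R / g < m.+1%:R.
  apply: lt_le_trans (truncnS_gt _) _; rewrite ler_nat; exact: leqW.
have Wg' : W < g * m.+1%:R * (K.+2%:R)^-1.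
  by rewrite ltr_pdivlMr ?ltr0n // mulrC -ltr_pdivrMl //; lra.
have WgN : W < g * m.+1%:R.
  apply: lt_le_trans Wg' _; rewrite ler_piMr ?mulr_ge0 ?(ltW g0) //.
  by rewrite invf_le1 ?ltr0n // ler1n.
(* The shift [K + 1] compensates the rounding errors, at most 1 from [floor] and [K] from
   [freq_dot]; residues then lie between [N * phase] and [N * phase + 2 K + 1]. *)
exists m, (fun b => Num.floor (m.+1%:R * x b) + (Posz K.+1)); split => //.
pose r (s : site) := val (resid m (Num.floor (m.+1%:R * x s.1) + Posz K.+1 + freq_dot m omega s.2)).
have rE s : s \in sites -> m.+1%:R * phase s <= (r s)%:R <= m.+1%:R * phase s + W.
  move=> sS; case: s sS => b n sS; have := sS; rewrite mem_sites => nK.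
  set z := Num.floor (m.+1%:R * x b) + Posz K.+1 + freq_dot m omega n.
  pose F := Num.floor (x b + zdot n omega).
  have h1 := freq_dot_zdot m omega01 n.
  have nK' : (l1norm n)%:R <= K%:R :> R by rewrite ler_nat.
  have /andP[f1 f2] := floor_itv (m.+1%:R * x b).
  have zE : (z - F * Posz m.+1)%:~R = (Num.floor (m.+1%:R * x b))%:~R + K%:R + 1 +
      (freq_dot m omega n)%:~R - F%:~R * m.+1%:R :> R.
    by rewrite rmorphB rmorphM !rmorphD /= -!pmulrn -[K.+1%:R]natr1; ring.
  have pE : m.+1%:R * phase (b, n) = m.+1%:R * x b + m.+1%:R * zdot n omega - F%:~R * m.+1%:R.
    by rewrite /phase /frac_part /= -/F; ring.
  rewrite rmorphD /= in f2.
  have h2 := le_trans h1 nK'; rewrite ler_norml in h2; case/andP: h2 => h2 h3.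
  have WE : W = K%:R + K%:R + 1 by rewrite /W -natr1 natrD.
  have b1 : m.+1%:R * phase (b, n) <= (z - F * Posz m.+1)%:~R by rewrite pE zE; lra.
  have b2 : (z - F * Posz m.+1)%:~R <= m.+1%:R * phase (b, n) + W by rewrite pE zE WE; lra.
  have z0 : 0 <= z - F * Posz m.+1.
    rewrite -(ler_int R); apply: le_trans b1; rewrite mulr_ge0 // ?ler0n //.
    by have /andP[] := p01 (b, n).
  have zN : z - F * Posz m.+1 < Posz m.+1.
    rewrite -(ltr_int R); apply: le_lt_trans b2 _; rewrite -pmulrn.
    have := g1 _ sS; have := WgN; nra.
  have -> : r (b, n) = absz (z - F * Posz m.+1)%R.
    rewrite /r /= -/z.
    have -> : resid m z = resid m (Posz (absz (z - F * Posz m.+1)%R)).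
      by rewrite gez0_abs // residD residN resid_mul_eq0 subr0.
    by rewrite resid_nat /= modn_small // -ltz_nat gez0_abs.
  by rewrite natr_absz ger0_norm // b1.
move=> s s' sS sS' lt; rewrite -/(r s) -/(r s').
have /andP[r1 r2] := rE s sS; have /andP[r3 r4] := rE s' sS'.
have gs := g2 s s' sS sS' lt.
set p := phase s in r1 r2 gs lt *; set p' := phase s' in r3 r4 gs lt *.
have Wp : W < (p' - p) * m.+1%:R * (K.+2%:R)^-1.
  by apply: lt_le_trans Wg' _; rewrite ler_pM2r ?invr_gt0 // ler_pM2r.
have k0 : 0 < (K.+2%:R : R)^-1 by rewrite invr_gt0.
have rlt : (r s < r s')%N.
  rewrite -(ltr_nat R); apply: le_lt_trans r2 _; apply: lt_le_trans r3.
  have : W < g * m.+1%:R by []. nra.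
split=> //; rewrite natrB ?(ltW rlt) //; last exact: ltnW.
rewrite ler_pdivlMr // ler_pdivrMr //.
rewrite /model_ratio in c2 c1 *; set k := (K.+2%:R)^-1 in Wp k0 c2 c1 *.
have pp : 0 < (p' - p) * m.+1%:R by rewrite mulr_gt0 // subr_gt0.
have e1 : (1 - k) * ((p' - p) * m.+1%:R) <= (r s')%:R - (r s)%:R by lra.
have e2 : (r s')%:R - (r s)%:R <= (1 + k) * ((p' - p) * m.+1%:R) by lra.
apply/andP; split.
  have : (1 - k) * ((1 - k) * ((p' - p) * m.+1%:R)) <= (1 - k) * ((r s')%:R - (r s)%:R).
    by apply: ler_wpM2l => //; lra.
  by lra.
have : (1 - k) * ((r s')%:R - (r s)%:R) <= (1 - k) * ((1 + k) * ((p' - p) * m.+1%:R)).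
  by apply: ler_wpM2l => //; lra.
nra.
Qed.

Lemma model_potential m (r : site -> nat) :
  (forall s s', s \in sites -> s' \in sites -> phase s < phase s' ->
     (r s < r s')%N /\ model_ratio * (r s' - r s)%N%:R / m.+1%:R <= phase s' - phase s) ->
  exists V : nat -> R,
    (forall s, s \in sites ->
       match f (x s.1 + zdot s.2 omega) with v%:E => V (r s) = v | _ => V (r s) <= - K%:R end) /\
    forall j k, V j + (model_ratio * k%:R / m.+1%:R) `^ alpha' <= V (j + k)%N.
Proof.
move=> hr; have [fy fp fint fmono] := hf.
have /andP[c2 c1] := model_ratio_itv.
have c0 : 0 < model_ratio by lra.
have N0 : 0 < (m.+1%:R : R) by rewrite ltr0n.
have al0 : 0 < alpha' by apply: lt_le_trans ha1.
have p01 s : 0 <= phase s < 1 by exact: frac_part_itv.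
have fE s : f (x s.1 + zdot s.2 omega) = f (phase s) by rewrite /phase periodic1_frac.
have fp0 s : f (phase s) = -oo%E -> phase s = 0.
  move=> /fint[k pk]; have := p01 s; rewrite pk -[0]/(0%:~R) -[1]/(1%:~R) ler_int ltr_int.
  by move=> /andP[k0 k1]; congr (_%:~R); apply/eqP; rewrite eq_le k0 andbT -ltzD1.
(* [low] stands for the value -oo of [f]. *)
pose low : R := - K%:R - \sum_(s <- sites) `|fine (f (phase s))| - 1.
pose v s : R := if f (phase s) is r0%:E then r0 else low.
pose gam k : R := (model_ratio * k%:R / m.+1%:R) `^ alpha'.
have arg0 k : 0 <= model_ratio * k%:R / m.+1%:R.
  by rewrite divr_ge0 ?mulr_ge0 // ltW.
have [||||s s' sS sS' e|V [VE Vgap]] := @mcshane_extension R _ sites r v gam.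
- by rewrite /gam mulr0 mul0r powR0 // gt_eqF.
- by move=> k; exact: powR_ge0.
- move=> j k; rewrite /gam natrD mulrDr mulrDl; exact: powR_superadd.
- move=> s s' sS sS' lt.
  have pp : phase s < phase s'.
    rewrite ltNge le_eqVlt; apply/negP => /orP[/eqP/phase_inj e|h].
      by move: lt; rewrite e ltnn.
    by have [+ _] := hr s' s sS' sS h; rewrite ltnNge ltnW.
  have [_ le] := hr s s' sS sS' pp.
  have /andP[ps0 _] := p01 s; have /andP[_ ps1] := p01 s'.
  have gle : gam (r s' - r s)%N <= (phase s' - phase s) `^ alpha'.
    by apply: ge0_ler_powR; rewrite ?nnegrE ?(ltW al0) // subr_ge0 ltW.
  have := fmono _ _ ps0 (ltW pp) ps1; rewrite /v.
  case fs : (f (phase s)) => [u| |]; first last.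
  + move=> _; case fs' : (f (phase s')) => [u'| |].
    (* The summand -1 in [low] is used here: within one period a required gap is at most 1. *)
    * have le1 : (phase s' - phase s) `^ alpha' <= 1.
        rewrite -(powR_1l alpha'); apply: ge0_ler_powR; rewrite ?nnegrE ?(ltW al0) //.
          by rewrite subr_ge0 ltW.
        by lra.
      have : `|u'| <= \sum_(s <- sites) `|fine (f (phase s))|.
        rewrite (big_rem s') //= fs' /= lerDl; exact: sumr_ge0.
      have := ler_norm (- u'); rewrite normrN.
      have K0 : 0 <= K%:R :> R := ler0n _ _.
      by rewrite /low; lra.
    * by have := fy (phase s'); rewrite fs'.
    * by move: pp; rewrite (fp0 _ fs) (fp0 _ fs') ltxx.
  + by have := fy (phase s); rewrite fs.
  + case fs' : (f (phase s')) => [u'| |] //=; last by have := fy (phase s'); rewrite fs'.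
    by rewrite -EFinD lee_fin; lra.
- have [->//|ne] := eqVneq s s'.
  have [h|h|/phase_inj//] := ltgtP (phase s) (phase s').
    by have [+ _] := hr s s' sS sS' h; rewrite e ltnn.
  by have [+ _] := hr s' s sS' sS h; rewrite e ltnn.
exists V; split; last exact: Vgap.
move=> s sS; rewrite fE VE // /v.
have S0 : 0 <= \sum_(s <- sites) `|fine (f (phase s))| by exact: sumr_ge0.
by case: (f (phase s)) => //; rewrite /low; lra.
Qed.

(** Pulled back along [n -> J b + a . n], the finite eigenfunctions solve an equation on Z^d whose
    potential is that of [f] within distance [K], up to the values -oo. The mass clause will keep
    the norm from escaping to infinity in the limit. *)
Lemma finite_model : exists (psi : B -> 'rV[int]_d -> 'rV[int]_d -> R)
    (e : B -> 'rV[int]_d -> R) (v : B -> 'rV[int]_d -> R),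
  [/\ forall b n, eigenfun (@basis_vec d) eps (v b) (e b n) (psi b n),
      forall b n k, (l1norm (k - n) <= K)%N -> `|psi b n k| <= pr (l1norm (k - n)),
      forall b n, 2^-1 <= psi b n n /\ 1 - psi b n n ^+ 2 <= tau * 4 ^+ d * pr 1%N,
      forall b n L, (L <= K)%N ->
        1 - tau * 4 ^+ d * pr L <= \sum_(l <- ball d L) psi b n (n + l) ^+ 2 <= 1 &
      (forall b n, (l1norm n <= K)%N ->
         match f (x b + zdot n omega) with r%:E => v b n = r | _ => v b n <= - K%:R end) /\
      forall b n b' n', (l1norm n <= K)%N -> (l1norm n' <= K)%N ->
        phase (b, n) < phase (b', n') ->
        e b n + (model_ratio ^+ 2 * (phase (b', n') - phase (b, n))) `^ alpha' <= e b' n'].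
Proof.
have [m [J [surj small lay]]] := residue_layout.
pose R0 (s : site) := resid m (J s.1 + freq_dot m omega s.2).
have [|V [VE Vgap]] := @model_potential m (fun s => val (R0 s)).
  by move=> s s' sS sS' /(lay s s' sS sS')[h1 /andP[_ h2]].
have /andP[c2 c1] := model_ratio_itv.
have c0 : 0 < model_ratio by lra.
have N0 : 0 < (m.+1%:R : R) by rewrite ltr0n.
have al0 : 0 < alpha' by apply: lt_le_trans ha1.
pose gam k : R := (model_ratio * k%:R / m.+1%:R) `^ alpha'.
pose a i := resid m (Posz (freq_num m omega i)).
pose nr := nrm surj.
have [||||lam [phi [h1 h2 h3 h4 h5]]] := @finite_localization R m d a (fun j => V j) gam nr
   eps tau (4 ^+ d) (divisor alpha rho beta) (weight R d) pr
   (nrmD surj) (nrmN surj) (nrm0 surj) (nrm_step surj) (sum_weight_nrm surj) dp.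
- by move=> i j ij; have := Vgap i (j - i)%N; rewrite subnKC // ltnW.
- by rewrite powR_gt0 // mulr1 divr_gt0.
- move=> k k1; apply: ge0_ler_powR; rewrite ?nnegrE ?(ltW al0) ?divr_ge0 ?mulr_ge0 ?(ltW c0) //.
  by rewrite ler_pM2r ?invr_gt0 // ler_pM2l // ler_nat.
- move=> i j ij; apply: (freq_gap_divisor omega01 omega_dioph) => //; exact: ltW.
pose P b n := R0 (b, n).
have Pshift b n l : P b (n + l) = P b n + resid m (freq_dot m omega l).
  by rewrite /P /R0 /= freq_dotD addrA [LHS]residD.
have Pdiff b n k : P b k - P b n = resid m (freq_dot m omega (k - n)).
  by rewrite -{1}(subrK n k) [k - n + n]addrC Pshift addrAC subrr add0r.
have Pnrm b n k : (l1norm (k - n)%R <= K)%N -> nr (P b k - P b n) = l1norm (k - n).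
  by move=> kn; rewrite Pdiff; exact: (nrm_eq surj small).
exists (fun b n k => phi (P b n) (P b k)), (fun b n => lam (P b n)), (fun b k => V (P b k)).
split.
- move=> b n k; rewrite -(h1 (P b n) (P b k)) /lap; congr (_ * _ + _).
  apply: eq_bigr => i _; rewrite -[in RHS]residN.
  have -> : resid m (- Posz (freq_num m omega i)) = resid m (freq_dot m omega (- basis_vec i)).
    by rewrite freq_dotN; congr (resid m (- _)); rewrite -[basis_vec i]scale1r freq_dot_delta mulr1.
  have -> : a i = resid m (freq_dot m omega (basis_vec i)).
    by congr (resid m _); rewrite -[basis_vec i]scale1r freq_dot_delta mulr1.
  by rewrite !Pshift.
- by move=> b n k kn; have := h3 (P b n) (P b k); rewrite Pnrm.
- by move=> b n; exact: h4.
- move=> b n L LK.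
  have inj : {in ball d L &, injective (fun l => P b (n + l))}.
    move=> l l'; rewrite !mem_ball => lL lL'; rewrite !Pshift => /addrI e.
    apply/eqP; rewrite -subr_eq0; apply: contraT => /small.
    rewrite freq_dotD freq_dotN residD residN e subrr eqxx; apply.
    apply: leq_trans (l1normD _ _) _; rewrite l1normN.
    by apply: leq_add; [exact: leq_trans lL LK|exact: leq_trans lL' LK].
  have sumE : \sum_(l <- ball d L) phi (P b n) (P b (n + l)) ^+ 2 =
      \sum_(y in map (fun l => P b (n + l)) (ball d L)) phi (P b n) y ^+ 2.
    by rewrite -big_uniq ?map_inj_in_uniq ?ball_uniq // big_map.
  have tot : 1 = \sum_(l <- ball d L) phi (P b n) (P b (n + l)) ^+ 2 +
      \sum_(y | y \notin map (fun l => P b (n + l)) (ball d L)) phi (P b n) y ^+ 2.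
    by rewrite sumE -[LHS](h2 (P b n)) [LHS](bigID (mem (map (fun l => P b (n + l)) (ball d L)))).
  set tail := \sum_(y | _) _ in tot.
  have t0 : 0 <= tail by apply: sumr_ge0 => y _; exact: sqr_ge0.
  suff : tail <= tau * 4 ^+ d * pr L by move=> h; apply/andP; split; lra.
  apply: (@le_trans _ _ (\sum_y tau * pr L * weight R d (nr (y - P b n)))); last first.
    rewrite -mulr_sumr -[leRHS]mulrA [4 ^+ d * _]mulrC [leRHS]mulrA.
    apply: ler_wpM2l; first by rewrite mulr_ge0 ?ltW ?(dp_tau dp) ?(dp_b dp).
    exact: (sumw_shift (sum_weight_nrm surj)).
  rewrite /tail big_mkcond /=; apply: ler_sum => y _.
  have w0 : 0 <= tau * pr L * weight R d (nr (y - P b n)).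
    by rewrite !mulr_ge0 ?ltW ?(dp_tau dp) ?(dp_b dp) ?(dp_w dp).
  case: ifPn => // yL.
  (* A residue missed by the ball has no representative of norm at most [L]; there one factor of the
     square is at most [pr L] and the other is summable. *)
  have ny : (L < nr (y - P b n)%R)%N.
    rewrite ltnNge; apply: contra yL => yL.
    have [l ln le] := nrm_rep surj (y - P b n).
    apply/mapP; exists l; first by rewrite mem_ball ln.
    by rewrite Pshift le addrC subrK.
  have n1 : (1 <= nr (y - P b n)%R)%N by apply: leq_trans ny.
  have k1 := h3 (P b n) y; have k2 := dp_small dp n1; have k3 := dp_mono dp (ltnW ny).
  rewrite -real_normK ?num_real //.
  have -> : tau * pr L * weight R d (nr (y - P b n)) = pr L * (tau * weight R d (nr (y - P b
    n))) by ring.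
  rewrite expr2; apply: ler_pM;
    [exact: normr_ge0|exact: normr_ge0|exact: le_trans k1 k3|exact: le_trans k1 k2].
split.
  by move=> b n nK; have := VE (b, n); rewrite mem_sites => /(_ nK).
move=> b n b' n' nK nK' lt.
have nS : (b, n) \in sites by rewrite mem_sites.
have nS' : (b', n') \in sites by rewrite mem_sites.
have [/= lt' /andP[le _]] := lay _ _ nS nS' lt.
have := h5 (P b n) (P b' n') lt'; apply: le_trans; rewrite lerD2l.
apply: ge0_ler_powR; rewrite ?nnegrE ?(ltW al0) ?divr_ge0 ?mulr_ge0 ?(ltW c0) ?exprn_ge0 ?(ltW
  c0) //.
by rewrite subr_ge0 ltW.
Qed.

End Model.

Import numFieldNormedType.Exports.
Local Open Scope classical_set_scope.
Local Open Scope complex_scope.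
Local Open Scope ring_scope.

(** * Localized eigenfunctions on the lattice *)

Section Limits.
Variable R : realType.

(** Along an ultrafilter all coordinates converge at once, with no diagonal extraction. *)
Lemma ultra_bounded_cvg (T : Type) (U : set_system T) (g : T -> R) : UltraFilter U ->
  (\forall t \near U, `|g t| <= 1) -> exists l : R, g t @[t --> U] --> l.
Proof.
move=> UU gb; have [|l [_ cl]] := @segment_compact R (-1) 1 (g @ U) _.
  rewrite nbhs_simpl /=; near=> t => /=; rewrite in_itv /= -ler_norml.
  by near: t.
exists l => W Wl; rewrite nbhs_simpl /=.
have [//|UW] := in_ultra_setVsetC (g @^-1` W) UU.
have [y [/= ny Wy]] := cl (~` W) W UW Wl.
by [].
Unshelve. all: by end_near. Qed.

Lemma cvg_bigsum (T : Type) (F : set_system T) (FF : Filter F) (I : Type) (r : seq I)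
    (g : I -> T -> R) (l : I -> R) :
  (forall i, g i t @[t --> F] --> l i) ->
  \sum_(i <- r) g i t @[t --> F] --> \sum_(i <- r) l i.
Proof.
move=> gl; elim: r => [|i r IH].
  by under eq_fun do rewrite big_nil; rewrite big_nil; exact: cvg_cst.
under eq_fun do rewrite big_cons; rewrite big_cons.
exact: cvgD.
Qed.

End Limits.

Section BoundStates.
Variables (R : realType) (d : nat) (delta beta eps tau : R).
Local Notation pr := (profile delta beta eps).
Local Notation site := 'rV[int]_d.

(** Each condition concerns finitely many coordinates and no inequality is strict, which suits
    pointwise limits; [bs_mass] is norm 1 expressed in this way. *)
Record bound_state (V : site -> \bar R) (n : site) (E : R) (u : site -> R) : Prop := {
  bs_center : V n != -oo%E;
  bs_vanish : forall k, V k = -oo%E -> u k = 0;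
  bs_eq : forall k, V k != -oo%E ->
    eps * lap (@basis_vec d) u k + fine (V k) * u k = E * u k;
  bs_decay : forall k, `|u k| <= pr (l1norm (k - n));
  bs_half : 2^-1 <= u n;
  bs_near1 : 1 - u n ^+ 2 <= tau * 4 ^+ d * pr 1%N;
  bs_mass : forall L,
    1 - tau * 4 ^+ d * pr L <= \sum_(l <- ball d L) u (n + l) ^+ 2 <= 1
}.

(** Applied twice: to models as [K] grows, and to solutions as the base point moves. The eigenvalues
    converge because the equation at [n] can be solved for them, the value there being at least
    1/2. *)
Lemma bound_state_limit (T : Type) (F : set_system T) (FF : ProperFilter F)
    (V : site -> \bar R) (n : site) (u : site -> R)
    (vt : T -> site -> R) (et : T -> R) (ut : T -> site -> R) :
  (forall k, (V k < +oo)%E) -> V n != -oo%E ->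
  (forall k, \forall t \near F,
    eps * lap (@basis_vec d) (ut t) k + vt t k * ut t k = et t * ut t k) ->
  (forall k, \forall t \near F, `|ut t k| <= pr (l1norm (k - n))) ->
  (\forall t \near F, 2^-1 <= ut t n) ->
  (\forall t \near F, 1 - ut t n ^+ 2 <= tau * 4 ^+ d * pr 1%N) ->
  (forall L, \forall t \near F,
    1 - tau * 4 ^+ d * pr L <= \sum_(l <- ball d L) ut t (n + l) ^+ 2 <= 1) ->
  (forall k, if V k is r%:E then vt t k @[t --> F] --> r
     else forall A : R, \forall t \near F, vt t k <= A) ->
  (forall k, ut t k @[t --> F] --> u k) ->
  exists E, bound_state V n E u /\ et t @[t --> F] --> E.
Proof.
move=> Voo Vn heq hdec hhalf hnear hmass hV hu.
have un : 2^-1 <= u n by apply: (cvgr_to_ge (hu n)).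
have un0 : u n != 0 by rewrite gt_eqF // (lt_le_trans _ un).
have hlap k : lap (@basis_vec d) (ut t) k @[t --> F] --> lap (@basis_vec d) u k.
  by apply: cvg_bigsum => i; apply: cvgD; exact: hu.
have hvn : vt t n @[t --> F] --> fine (V n).
  by have := hV n; move: (Voo n) Vn; case: (V n).
pose E := (eps * lap (@basis_vec d) u n + fine (V n) * u n) / u n.
have hE : et t @[t --> F] --> E.
  apply: (@cvg_trans _ ((eps * lap (@basis_vec d) (ut t) n + vt t n * ut t n) / ut t n @[t --> F])).
    apply: near_eq_cvg; near=> t.
    have -> : eps * lap (@basis_vec d) (ut t) n + vt t n * ut t n = et t * ut t n by near: t.
    rewrite mulfK // gt_eqF // (@lt_le_trans _ _ 2^-1) //; by near: t.
  apply: cvgM; last by apply: cvgV.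
  apply: cvgD; last by apply: cvgM.
  by apply: cvgMr; exact: hlap.
exists E; split => //; split => //.
- move=> k Vk; have := hV k; rewrite Vk => hk.
  (* the equation at [k] bounds [vt t k * ut t k], while [vt t k] tends to -oo *)
  have hb : eps * lap (@basis_vec d) (ut t) k - et t * ut t k @[t --> F] -->
       eps * lap (@basis_vec d) u k - E * u k.
    apply: cvgB; last by apply: cvgM.
    by apply: cvgMr; exact: hlap.
  have hbd : \forall t \near F, `|eps * lap (@basis_vec d) (ut t) k - et t * ut t k| <=
       `|eps * lap (@basis_vec d) u k - E * u k| + 1.
    by apply: (cvgr_norm_le _ hb); rewrite ltrDl.
  set M := `|_| + 1 in hbd; have M0 : 0 < M by rewrite ltr_wpDl.
  apply/eqP; rewrite -normr_le0; apply/ler_addgt0Pr => e e0; rewrite add0r.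
  apply: (cvgr_to_le (cvg_norm (hu k))); near=> t.
  have h1 : eps * lap (@basis_vec d) (ut t) k + vt t k * ut t k = et t * ut t k by near: t.
  have h2 : `|eps * lap (@basis_vec d) (ut t) k - et t * ut t k| <= M by near: t.
  have h3 : vt t k <= - (M / e) by near: t; exact: hk.
  have h4 : `|vt t k| * `|ut t k| <= M.
    rewrite -normrM; apply: le_trans h2; rewrite -h1 opprD addrA subrr add0r normrN.
    by [].
  have Me : 0 < M / e by rewrite divr_gt0.
  have h5 : M / e <= `|vt t k| by rewrite ler0_norm; lra.
  have : M / e * `|ut t k| <= M by apply: le_trans h4; exact: ler_wpM2r.
  rewrite mulrAC ler_pdivrMr // ler_pM2l //.
- move=> k Vk.
  have hvk : vt t k @[t --> F] --> fine (V k).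
    by have := hV k; move: (Voo k) Vk; case: (V k).
  have c1 : eps * lap (@basis_vec d) (ut t) k + vt t k * ut t k @[t --> F] -->
     eps * lap (@basis_vec d) u k + fine (V k) * u k.
    apply: cvgD; last by apply: cvgM.
    by apply: cvgMr; exact: hlap.
  have c2 : eps * lap (@basis_vec d) (ut t) k + vt t k * ut t k @[t --> F] --> E * u k.
    apply: (@cvg_trans _ (et t * ut t k @[t --> F])); last by apply: cvgM.
    by apply: near_eq_cvg; near=> t; apply/esym; near: t.
  exact: (cvg_unique (@norm_hausdorff _ R^o) c1 c2).
- by move=> k; apply: (cvgr_to_le (cvg_norm (hu k))).
- have c : 1 - ut t n ^+ 2 @[t --> F] --> 1 - u n ^+ 2.
    by apply: cvgB; [exact: cvg_cst|rewrite expr2; under eq_fun do rewrite expr2; exact: cvgM].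
  exact: (cvgr_to_le c).
- move=> L.
  have c : \sum_(l <- ball d L) ut t (n + l) ^+ 2 @[t --> F] --> \sum_(l <- ball d L) u (n + l)
    ^+ 2.
    by apply: cvg_bigsum => l; rewrite expr2; under eq_fun do rewrite expr2; exact: cvgM.
  apply/andP; split.
    by apply: (cvgr_to_ge c); apply: filterS (hmass L) => t /andP[].
  by apply: (cvgr_to_le c); apply: filterS (hmass L) => t /andP[].
Unshelve. all: by end_near. Qed.

End BoundStates.

Lemma model_ratio_cvg (R : realType) (a y : R) : 0 < y ->
  (model_ratio R K ^+ 2 * y) `^ a @[K --> \oo] --> y `^ a.
Proof.
move=> y0.
have c1 : model_ratio R K @[K --> \oo] --> (1 : R).
  rewrite -[X in _ --> X]subr0 /model_ratio; apply: cvgB; first exact: cvg_cst.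
  have := @cvg_harmonic R; rewrite -(cvg_shiftS (harmonic : nat -> R)); exact.
have c2 : model_ratio R K ^+ 2 * y @[K --> \oo] --> y.
  have {2}-> : y = 1 ^+ 2 * y by rewrite expr1n mul1r.
  apply: cvgMl; rewrite expr2; under eq_fun do rewrite expr2; exact: cvgM.
have -> : (fun K => (model_ratio R K ^+ 2 * y) `^ a) =
    (fun K => expR (a * ln (model_ratio R K ^+ 2 * y))).
  apply/funext => K; rewrite /powR gt_eqF // mulr_gt0 // exprn_gt0 //.
  by have /andP[c _] := model_ratio_itv R K; lra.
have -> : y `^ a = expR (a * ln y) by rewrite /powR gt_eqF.
apply: continuous_cvg; first exact: continuous_expR.
apply: cvgMr; apply: continuous_cvg => //; exact: continuous_ln.
Qed.

Lemma profile_le1 (R : realType) d (eps tau Cw : R) q w b s :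
  decay_profile d eps tau Cw q w b -> b s <= 1.
Proof. by move=> dp; rewrite -(dp_b0 dp) (dp_mono dp). Qed.

Section Family.
Variables (R : realType) (d : nat) (alpha alpha' delta rho beta eps tau : R).
Variables (omega : 'rV[R]_d) (f : R -> \bar R) (B : finType) (x : B -> R).
Local Notation pr := (profile delta beta eps).
Hypothesis hd : (1 <= d)%N.
Hypothesis hbeta : 0 < beta.
Hypothesis hrho : 0 < rho.
Hypothesis ha1 : 1 <= alpha'.
Hypothesis haa : alpha' <= alpha.
Hypothesis omega01 : forall i, 0 <= omega 0 i < 1.
Hypothesis omega_dioph : forall n : 'rV[int]_d, n != 0 -> forall k : int,
  expR (- (rho * (l1norm n)%:R `^ beta)) <= `|zdot n omega - k%:~R|.
Hypothesis dp : decay_profile d eps tau (4 ^+ d) (divisor alpha rho beta) (weight R d) pr.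
Hypothesis hf : holder_monotone alpha' f.
Hypothesis distinct : forall b n b' n' (k : int),
  x b + zdot n omega - (x b' + zdot n' omega) = k%:~R -> b = b' /\ n = n'.

(** All base points and centres share one ultrafilter, so the gaps between different orbits pass to
    the limit as well. *)
Lemma bound_family : exists (E : B -> 'rV[int]_d -> R) (u : B -> 'rV[int]_d -> 'rV[int]_d -> R),
  (forall b n, potential f omega (x b) n != -oo%E ->
     bound_state delta beta eps tau (potential f omega (x b)) n (E b n) (u b n)) /\
  (forall b n b' n', potential f omega (x b) n != -oo%E -> potential f omega (x b') n' != -oo%E ->
     phase omega x (b, n) < phase omega x (b', n') ->
     E b n + (phase omega x (b', n') - phase omega x (b, n)) `^ alpha' <= E b' n').
Proof.
pose site := 'rV[int]_d.
have /boolp.choice[M hM] : forall K : nat,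
  exists M : (B -> site -> site -> R) * (B -> site -> R) * (B -> site -> R),
  let psi := M.1.1 in let e := M.1.2 in let v := M.2 in
  [/\ forall b n, eigenfun (@basis_vec d) eps (v b) (e b n) (psi b n),
      forall b n k, (l1norm (k - n) <= K)%N -> `|psi b n k| <= pr (l1norm (k - n)),
      forall b n, 2^-1 <= psi b n n /\ 1 - psi b n n ^+ 2 <= tau * 4 ^+ d * pr 1%N,
      forall b n L, (L <= K)%N ->
        1 - tau * 4 ^+ d * pr L <= \sum_(l <- ball d L) psi b n (n + l) ^+ 2 <= 1 &
      (forall b n, (l1norm n <= K)%N ->
         match f (x b + zdot n omega) with r%:E => v b n = r | _ => v b n <= - K%:R end) /\
      forall b n b' n', (l1norm n <= K)%N -> (l1norm n' <= K)%N ->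
        phase omega x (b, n) < phase omega x (b', n') ->
        e b n + (model_ratio R K ^+ 2 * (phase omega x (b', n') - phase omega x (b,
          n))) `^ alpha' <= e b' n'].
  move=> K; have [psi [e [v h]]] := finite_model K hd hbeta hrho ha1 haa omega01 omega_dioph dp
    hf distinct.
  by exists (psi, e, v).
have [U [UU sU]] := ultraFilterLemma (@eventually_filter).
have big (L : nat) : \forall K \near U, (L <= K)%N.
  by apply: sU; exact: nbhs_infty_ge.
have FF : ProperFilter U by exact: ultra_proper.
have decK b n k : \forall K \near U, `|(M K).1.1 b n k| <= pr (l1norm (k - n)).
  by apply: filterS (big (l1norm (k - n))) => K hK; have [_ h _ _ _] := hM K; exact: h.
have /boolp.choice[u hu] : forall p : B * site * site, exists l : R,
    (M K).1.1 p.1.1 p.1.2 p.2 @[K --> U] --> l.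
  move=> [[b n] k]; apply: ultra_bounded_cvg => /=.
  by apply: filterS (decK b n k) => K h; apply: le_trans h _; exact: profile_le1 dp.
have [fy _ _ _] := hf.
have hE (p : B * site) : exists E : R, potential f omega (x p.1) p.2 != -oo%E ->
    bound_state delta beta eps tau (potential f omega (x p.1)) p.2 E (fun k => u (p, k)) /\
    (M K).1.2 p.1 p.2 @[K --> U] --> E.
  case: p => b n /=.
  have [X|X] := boolP (potential f omega (x b) n != -oo%E); last by exists 0.
  have hv : forall k, if potential f omega (x b) k is r%:E then (M K).2 b k @[K --> U] --> r
     else forall A : R, \forall K \near U, (M K).2 b k <= A.
    move=> k; have hk : \forall K \near U,
        match potential f omega (x b) k with r%:E => (M K).2 b k = r | _ => (M K).2 b k <= -
          K%:R end.
      by apply: filterS (big (l1norm k)) => K hK; have [_ _ _ _ [h _]] := hM K; exact: h.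
    have low : (\forall K \near U, (M K).2 b k <= - K%:R) ->
        forall A : R, \forall K \near U, (M K).2 b k <= A.
      move=> h A; near=> K; apply: (@le_trans _ _ (- K%:R)); first by near: K.
      rewrite lerNl; apply: (@le_trans _ _ (Num.truncn `|A|).+1%:R).
        by apply: le_trans (ltW (truncnS_gt _)); rewrite -normrN ler_norm.
      by rewrite ler_nat; near: K; exact: big.
    move: hk; case: (potential f omega (x b) k) => [r| |]; [|exact: low|exact: low].
    move=> h; apply: (@cvg_trans _ ((fun=> r) @ U)); last exact: cvg_cst.
    by apply: near_eq_cvg; apply: filterS h => K ->.
  suff [E [h1 h2]] : exists E, bound_state delta beta eps tau (potential f omega (x b)) n E
      (fun k => u (b, n, k)) /\ (M K).1.2 b n @[K --> U] --> E by exists E.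
  apply: (@bound_state_limit R d delta beta eps tau _ U FF (potential f omega (x b)) n
    (fun k => u (b, n, k)) (fun K => (M K).2 b)
    (fun K => (M K).1.2 b n) (fun K => (M K).1.1 b n)).
  - by move=> k; exact: fy.
  - exact: X.
  - by move=> k; apply: nearW => K; have [h _ _ _ _] := hM K; exact: h.
  - exact: decK.
  - by apply: nearW => K; have [_ _ h _ _] := hM K; exact: (h b n).1.
  - by apply: nearW => K; have [_ _ h _ _] := hM K; exact: (h b n).2.
  - by move=> L; apply: filterS (big L) => K hK; have [_ _ _ h _] := hM K; exact: h.
  - by move=> k; have := hv k; case: (potential f omega (x b) k).
  - by move=> k; exact: (hu (b, n, k)).
have /boolp.choice[E {}hE] := hE.
exists (fun b n => E (b, n)), (fun b n k => u (b, n, k)); split=> [b n ne|b n b' n' ne ne' lt].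
  by have [] := hE (b, n) ne.
have [_ c1] := hE (b, n) ne; have [_ c2] := hE (b', n') ne'.
have y0 : 0 < phase omega x (b', n') - phase omega x (b, n) by rewrite subr_gt0.
have c3 := model_ratio_cvg (a := alpha') y0.
have {}c3 := cvg_trans (cvg_app _ sU) c3.
apply: (ler_cvg_to (cvgD c1 c3) c2); near=> K.
have [_ _ _ _ [_ h]] := hM K; apply: h => //; near: K; exact: big.
Unshelve. all: by end_near. Qed.

End Family.

Lemma leq_subr_of_ltn (L0 M L : nat) : (L0 + M < L)%N -> (L0 <= L - M)%N.
Proof. lia. Qed.

(** * Uniqueness of bound states *)

Section Uniqueness.
Variables (R : realType) (d : nat) (delta beta eps tau : R) (q : nat -> R).
Local Notation pr := (profile delta beta eps).
Local Notation site := 'rV[int]_d.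
Hypothesis hd : (1 <= d)%N.
Hypothesis dp : decay_profile d eps tau (4 ^+ d) q (weight R d) pr.

Lemma pr_gt0 s : 0 < pr s. Proof. exact: expR_gt0. Qed.

Lemma weight_le_harmonic s : weight R d s <= (s.+1%:R)^-1.
Proof.
rewrite /weight lef_pV2 ?posrE ?exprn_gt0 ?ltr0n // -[leLHS]expr1.
by rewrite ler_weXn2l ?ler1n // double_gt0.
Qed.

Lemma tau4_itv : 0 < tau * 4 ^+ d <= 40^-1.
Proof.
have := dp_tauC dp; have t0 := dp_tau dp.
have p0 : 0 < (4 : R) ^+ d by rewrite exprn_gt0.
have tp : 0 < tau * 4 ^+ d by rewrite mulr_gt0.
have d1 : 1 <= d.+1%:R :> R by rewrite ler1n.
rewrite -!mulrA => h; rewrite tp /=; nra.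
Qed.

Lemma pr_small (e : R) : 0 < e -> exists L0, forall L, (L0 <= L)%N -> pr L <= e.
Proof.
move=> e0; have t0 := dp_tau dp.
exists (Num.truncn (tau / e)).+1 => L hL.
apply: le_trans (dp_small dp (leq_trans _ hL)) _ => //.
apply: (@le_trans _ _ (tau * (L.+1%:R)^-1)).
  by rewrite ler_pM2l // weight_le_harmonic.
rewrite ler_pdivrMr ?ltr0n // mulrC -ler_pdivrMr //.
apply: le_trans (ltW (truncnS_gt _)) _; rewrite ler_nat; exact: leqW.
Qed.

Lemma sum_weight_shift (F : seq site) n : uniq F ->
  \sum_(k <- F) weight R d (l1norm (k - n)) <= 4 ^+ d.
Proof.
move=> uF; have u : uniq (map (fun k => k - n) F).
  by rewrite map_inj_uniq //; exact: addIr.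
by apply: le_trans (sum_weight_le R u); rewrite big_map.
Qed.

Lemma sum_offdiag (F : seq site) n : uniq F ->
  \sum_(k <- F | k != n) pr (l1norm (k - n)) <= tau * 4 ^+ d.
Proof.
move=> uF; have t0 := dp_tau dp.
apply: (@le_trans _ _ (\sum_(k <- F) tau * weight R d (l1norm (k - n)))); last first.
  by rewrite -mulr_sumr ler_pM2l // sum_weight_shift.
rewrite big_mkcond /=; apply: ler_sum => k _.
case: ifPn => [kn|_]; last by rewrite mulr_ge0 ?ltW // (dp_w dp).
by apply: (dp_small dp); rewrite lt0n l1norm_eq0 subr_eq0.
Qed.

(** Free of normalization and of a lower bound at the centre, so that combinations of bound states
    with equal centre and energy qualify. *)
Definition local_solution (V : site -> \bar R) (n : site) (E C : R) (u : site -> R) :=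
  [/\ forall k, V k = -oo%E -> u k = 0,
      forall k, V k != -oo%E ->
        eps * lap (@basis_vec d) u k + fine (V k) * u k = E * u k &
      forall k, `|u k| <= C * pr (l1norm (k - n))].

Lemma bound_state_local V n E u : bound_state delta beta eps tau V n E u ->
  local_solution V n E 1 u.
Proof. by case=> _ h1 h2 h3 _ _ _; split => // k; rewrite mul1r. Qed.

(** Orthogonality stated on balls, which avoids infinite sums. In Green's identity each boundary
    product has one factor of size [pr (L - M)], tending to 0, and one that is summable. *)
Lemma local_solution_orth V n n' E E' C C' u w : 0 <= C -> 0 <= C' ->
  local_solution V n E C u -> local_solution V n' E' C' w -> E != E' ->
  forall e : R, 0 < e -> exists L0, forall L, (L0 <= L)%N ->
    `|\sum_(k <- ball d L) u k * w k| <= e.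
Proof.
move=> C0 C0' [u1 u2 u3] [w1 w2 w3] EE e e0.
have t0 := dp_tau dp; have ep0 := dp_eps dp.
have E0 : 0 < `|E' - E| by rewrite normr_gt0 subr_eq0 eq_sym.
have p0 : 0 < (4 : R) ^+ d by rewrite exprn_gt0.
pose D := eps * ((d.*2)%:R * (2 * (C * C' * tau) * 4 ^+ d)) / `|E' - E|.
have D0 : 0 <= D by rewrite !mulr_ge0 ?invr_ge0 ?mulr_ge0 // ltW.
have [L1 hL1] := @pr_small (e / (D + 1)) ltac:(by rewrite divr_gt0 // ltr_wpDl).
pose M := (l1norm n + l1norm n')%N.
exists (L1 + M).+1 => L hL.
have green : (E' - E) * \sum_(k <- ball d L) u k * w k =
    eps * \sum_(k <- ball d L) (u k * lap (@basis_vec d) w k - w k * lap (@basis_vec d) u k).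
  rewrite !mulr_sumr; apply: eq_bigr => k _.
  (* No equation is available at a site of infinite coupling, but both functions vanish there. *)
  have [Vk|Vk] := eqVneq (V k) -oo%E; first by rewrite u1 // w1 // !mul0r subrr !mulr0.
  have -> : (E' - E) * (u k * w k) = u k * (E' * w k) - w k * (E * u k) by ring.
  by rewrite -u2 // -w2 //; ring.
have prle (s : site) x : (l1norm s <= M)%N -> (L <= l1norm x)%N ->
    pr (l1norm (x - s)) <= pr (L - M)%N.
  move=> sM Lx; apply: (dp_mono dp); rewrite leq_subLR.
  apply: leq_trans Lx _; rewrite -{1}(subrK s x) addrC.
  by apply: leq_trans (l1normD _ _) _; rewrite leq_add2r.
have nM : (l1norm n <= M)%N by rewrite leq_addr.
have nM' : (l1norm n' <= M)%N by rewrite leq_addl.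
have ge1 (s x : site) : (l1norm s <= M)%N -> (L <= l1norm x)%N -> (1 <= l1norm (x - s)%R)%N.
  move=> sM Lx; rewrite lt0n l1norm_eq0 subr_eq0; apply: contraTneq Lx => ->.
  by rewrite -ltnNge (leq_ltn_trans sM) // (leq_trans _ hL) // ltnS leq_addl.
pose K x := C * C' * tau * pr (L - M)%N *
  (weight R d (l1norm (x - n)) + weight R d (l1norm (x - n'))).
have K0 x : 0 <= K x.
  rewrite /K !mulr_ge0 // ?addr_ge0 // ltW ?(dp_w dp) //; exact: pr_gt0.
have := @green_bound R _ d (@basis_vec d) (ball d L) u w K (ball_uniq _ _).
have hK : forall x (i : 'I_d) y, x \in ball d L -> y \notin ball d L ->
    y = x + basis_vec i \/ y = x - basis_vec i -> `|u x * w y - u y * w x| <= K x.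
  move=> x i y xB yB xy.
  rewrite mem_ball -ltnNge in yB.
  have yx : (l1norm y <= (l1norm x).+1)%N.
    by case: xy => ->; apply: leq_trans (l1normD _ _) _; rewrite ?l1normN l1norm_delta addn1.
  have xL : (L <= l1norm x)%N by rewrite -ltnS (leq_trans yB).
  have yL : (L <= l1norm y)%N by exact: ltnW.
  have a1 : `|u x| <= C * (tau * weight R d (l1norm (x - n))).
    by apply: le_trans (u3 x) _; apply: ler_wpM2l; [exact: C0|apply: (dp_small dp); exact: ge1].
  have a2 : `|w y| <= C' * pr (L - M)%N.
    by apply: le_trans (w3 y) _; apply: ler_wpM2l; [exact: C0'|exact: prle].
  have a3 : `|w x| <= C' * (tau * weight R d (l1norm (x - n'))).
    by apply: le_trans (w3 x) _; apply: ler_wpM2l; [exact: C0'|apply: (dp_small dp); exact: ge1].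
  have a4 : `|u y| <= C * pr (L - M)%N.
    by apply: le_trans (u3 y) _; apply: ler_wpM2l; [exact: C0|exact: prle].
  apply: le_trans (ler_normB _ _) _; rewrite !normrM.
  have b1 := ler_pM (normr_ge0 _) (normr_ge0 _) a1 a2.
  have b2 := ler_pM (normr_ge0 _) (normr_ge0 _) a4 a3.
  apply: le_trans (lerD b1 b2) _.
  by rewrite le_eqVlt /K; apply/orP; left; apply/eqP; ring.
move=> /(_ hK (fun x _ => K0 x)) hg.
have sumK : \sum_(x <- ball d L) K x <= C * C' * tau * pr (L - M)%N * (4 ^+ d + 4 ^+ d).
  rewrite /K -mulr_sumr big_split /=; apply: ler_wpM2l.
    by rewrite !mulr_ge0 // ltW //; exact: pr_gt0.
  by apply: lerD; apply: sum_weight_shift; exact: ball_uniq.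
have h1 : `|E' - E| * `|\sum_(k <- ball d L) u k * w k| <=
   eps * ((d.*2)%:R * (C * C' * tau * pr (L - M)%N * (4 ^+ d + 4 ^+ d))).
  rewrite -normrM green normrM (gtr0_norm ep0) ler_pM2l //.
  by apply: le_trans hg _; rewrite ler_wpM2l.
have h2 : `|\sum_(k <- ball d L) u k * w k| <= D * pr (L - M)%N.
  rewrite /D mulrAC ler_pdivlMr // mulrC; apply: le_trans h1 _.
  by rewrite le_eqVlt; apply/orP; left; apply/eqP; ring.
apply: le_trans h2 _.
have h3 : pr (L - M)%N <= e / (D + 1) by apply: hL1; exact: leq_subr_of_ltn.
apply: (@le_trans _ _ (D * (e / (D + 1)))); first exact: ler_wpM2l.
by rewrite mulrA ler_pdivrMr ?ltr_wpDl // mulrC; lra.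
Qed.

(** Distinct energies would make the sum of [u k * w k] at most 1/8 on large balls, whereas the
    centre contributes at least 1/4 and all other sites at most 1/40. *)
Lemma bound_state_energy_unique (V : site -> \bar R) n E E' u w :
  bound_state delta beta eps tau V n E u -> bound_state delta beta eps tau V n E' w -> E = E'.
Proof.
move=> hu hw; apply/eqP; apply: contraT => EE.
have [L0 hL] := local_solution_orth ler01 ler01 (bound_state_local hu) (bound_state_local hw) EE
  (e := 8^-1) ltac:(by rewrite invr_gt0).
pose L := maxn L0 (l1norm n).
have := hL L (leq_maxl _ _).
have nB : n \in ball d L by rewrite mem_ball leq_maxr.
rewrite (bigD1_seq n) //=; last exact: ball_uniq.
set S := \sum_(_ <- _ | _) _ => h.
have hS : `|S| <= tau * 4 ^+ d.
  apply: le_trans (ler_norm_sum _ _ _) _; apply: le_trans (sum_offdiag n (ball_uniq d L)).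
  apply: ler_sum => k _; rewrite normrM -[leRHS]mulr1; apply: ler_pM => //.
    exact: (bs_decay hu).
  by apply: le_trans (bs_decay hw k) _; exact: profile_le1 dp.
have /andP[_ t4] := tau4_itv.
have un := bs_half hu; have wn := bs_half hw.
rewrite ler_norml in h; rewrite ler_norml in hS.
have /andP[_ h2] := h; have /andP[h3 _] := hS.
have : 4^-1 <= u n * w n by nra.
lra.
Qed.

(** Subtract the multiple of [uf n] that agrees with [u] at [n]. The difference [chi] is orthogonal
    to every other [uf m], which is concentrated at [m]; hence each value of [chi] is at most half
    of any bound on all of them, and iteration gives [chi = 0]. *)
Lemma bound_state_unique (V : site -> \bar R) (Ef : site -> R) (uf : site -> site -> R) n E u :
  (forall m, V m != -oo%E -> bound_state delta beta eps tau V m (Ef m) (uf m)) ->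
  (forall m m', V m != -oo%E -> V m' != -oo%E -> m != m' -> Ef m != Ef m') ->
  bound_state delta beta eps tau V n E u -> E = Ef n /\ forall k, u k = uf n k.
Proof.
move=> fam dist hu; have Vn := bs_center hu.
have hw := fam n Vn; have EE := bound_state_energy_unique hu hw.
split=> //; pose w := uf n; pose c := u n / w n.
have un := bs_half hu; have wn := bs_half hw.
have wn0 : 0 < uf n n by apply: lt_le_trans wn; rewrite invr_gt0.
have un0 : 0 < u n by apply: lt_le_trans un; rewrite invr_gt0.
have c0 : 0 < c by rewrite divr_gt0.
pose chi k := u k - c * w k.
have chi_n : chi n = 0 by rewrite /chi /c divfK ?subrr // gt_eqF.
have hchi : local_solution V n (Ef n) (1 + c) chi.
  split.
  - by move=> k Vk; rewrite /chi (bs_vanish hu) // /w (bs_vanish hw) // mulr0 subr0.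
  - move=> k Vk; have h1 := bs_eq hu Vk; have h2 := bs_eq hw Vk.
    have -> : lap (@basis_vec d) chi k = lap (@basis_vec d) u k - c * lap (@basis_vec d) w k.
      by rewrite /lap mulr_sumr -sumrB; apply: eq_bigr => i _; rewrite /chi; ring.
    have -> : eps * (lap (@basis_vec d) u k - c * lap (@basis_vec d) w k) + fine (V k) * chi k =
       (eps * lap (@basis_vec d) u k + fine (V k) * u k) -
       c * (eps * lap (@basis_vec d) w k + fine (V k) * w k) by rewrite /chi; ring.
    by rewrite h1 h2 EE /chi /w; ring.
  - move=> k; apply: le_trans (ler_normB _ _) _; rewrite mulrDl mul1r.
    apply: lerD; first exact: (bs_decay hu).
    by rewrite normrM gtr0_norm // ler_wpM2l ?(bs_decay hw) // ltW.
have /andP[t40 t4] := tau4_itv.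
have contract M : (forall k, `|chi k| <= M) -> forall k, `|chi k| <= M / 2.
  move=> hM m; have M0 : 0 <= M by apply: le_trans (hM m).
  have [Vm|Vm] := eqVneq (V m) -oo%E.
    by have [h _ _] := hchi; rewrite h // normr0 divr_ge0.
  have [->|mn] := eqVneq m n; first by rewrite chi_n normr0 divr_ge0.
  have hm := fam m Vm.
  apply/ler_addgt0Pr => e e0.
  have ne : Ef n != Ef m by apply: dist => //; rewrite eq_sym.
  have [L0 hL] := local_solution_orth (addr_ge0 ler01 (ltW c0)) ler01 hchi (bound_state_local hm) ne
    (e := e / 2) ltac:(by rewrite divr_gt0).
  pose L := maxn L0 (l1norm m).
  have := hL L (leq_maxl _ _).
  have mB : m \in ball d L by rewrite mem_ball leq_maxr.
  rewrite (bigD1_seq m) //=; last exact: ball_uniq.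
  set S := \sum_(_ <- _ | _) _ => h.
  have hS : `|S| <= M * (tau * 4 ^+ d).
    apply: le_trans (ler_norm_sum _ _ _) _.
    apply: (@le_trans _ _ (M * \sum_(k <- ball d L | k != m) pr (l1norm (k - m)))).
      rewrite mulr_sumr; apply: ler_sum => k _; rewrite normrM.
      by apply: ler_pM => //; exact: (bs_decay hm).
    by rewrite ler_wpM2l // sum_offdiag // ball_uniq.
  have hM4 : M * (tau * 4 ^+ d) <= M / 4.
    by apply: ler_wpM2l => //; apply: le_trans t4 _; rewrite lef_pV2 ?posrE // ler_nat.
  have h1 : `|chi m * uf m m| <= e / 2 + M / 4.
    rewrite -(addrK S (chi m * uf m m)); apply: le_trans (ler_normB _ _) _.
    by apply: lerD => //; apply: le_trans hS _.
  have um := bs_half hm.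
  have h2 : `|chi m| * 2^-1 <= `|chi m * uf m m|.
    rewrite normrM ler_wpM2l //; apply: le_trans um _; exact: ler_norm.
  lra.
have chi0 k : chi k = 0.
  have bd j : forall k, `|chi k| <= (1 + c) / 2 ^+ j.
    elim: j => [|j IH] k'.
      rewrite expr0 divr1; have [_ _ h] := hchi; apply: le_trans (h k') _.
      rewrite -[leRHS]mulr1 ler_wpM2l ?addr_ge0 ?(ltW c0) //; exact: profile_le1 dp.
    by rewrite exprSr invfM mulrA; exact: contract.
  apply/eqP; rewrite -normr_le0; apply/ler_addgt0Pr => e e0; rewrite add0r.
  pose j := (Num.truncn ((1 + c) / e)).+1.
  apply: le_trans (bd j k) _; rewrite ler_pdivrMr ?exprn_gt0 // mulrC -ler_pdivrMr //.
  apply: le_trans (ltW (truncnS_gt _)) _.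
  by rewrite -natrX ler_nat ltnW // ltn_expl.
have uc k : u k = c * uf n k by have /eqP := chi0 k; rewrite subr_eq0 => /eqP.
(* Both functions have norm 1, read off from [bs_mass] as [L] grows; positivity at the centre then
   excludes -1. *)
have c2 : c ^+ 2 = 1.
  have hmass L : c ^+ 2 * (1 - tau * 4 ^+ d * pr L) <= 1 /\ 1 - tau * 4 ^+ d * pr L <= c ^+ 2.
    have /andP[m1 m2] := bs_mass hu L; have /andP[m3 m4] := bs_mass hw L.
    have e : \sum_(l <- ball d L) u (n + l) ^+ 2 = c ^+ 2 * \sum_(l <- ball d L) uf n (n + l) ^+ 2.
      by rewrite mulr_sumr; apply: eq_bigr => l _; rewrite uc exprMn.
    rewrite e in m1 m2; have cc : 0 <= c ^+ 2 := sqr_ge0 c.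
    split; first by apply: le_trans m2; exact: ler_wpM2l.
    by apply: le_trans m1 _; rewrite -[leRHS]mulr1; exact: ler_wpM2l.
  apply/eqP; rewrite eq_le; apply/andP; split; apply/ler_addgt0Pr => e e0.
    have cc : 0 < c ^+ 2 by rewrite exprn_gt0.
    have [L0 hL] := @pr_small (e / c ^+ 2) ltac:(by rewrite divr_gt0).
    have [h _] := hmass L0; have := hL L0 (leqnn _).
    rewrite ler_pdivlMr // mulrC => h'; have p0 := pr_gt0 L0.
    have : tau * 4 ^+ d * (c ^+ 2 * pr L0) <= 1 * (c ^+ 2 * pr L0).
      by apply: ler_wpM2r; [apply: mulr_ge0; exact: ltW|lra].
    lra.
  have [L0 hL] := @pr_small e e0.
  have [_ h] := hmass L0; have h' := hL L0 (leqnn _); have p0 := pr_gt0 L0.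
  have : tau * 4 ^+ d * pr L0 <= 1 * pr L0 by apply: ler_wpM2r; [exact: ltW|lra].
  lra.
have c1 : c = 1.
  by move: c2 => /eqP; rewrite sqrf_eq1 => /orP[/eqP//|/eqP cN]; move: c0; rewrite cN; lra.
by move=> k; rewrite uc c1 mul1r.
Qed.

End Uniqueness.

(** * Square summability and the eigenvalue equation *)

Section SquareSummable.
Variables (R : realType) (d : nat).
Local Notation site := 'rV[int]_d.
Implicit Types (v : site -> R[i]) (u : site -> R).

Lemma modulus_real (x : R) : modulus x%:C = `|x|.
Proof. by rewrite /modulus /= expr0n addr0 sqrtr_sqr. Qed.

Lemma subset_ball (F : seq site) : exists L, {subset F <= ball d L}.
Proof.
exists (\max_(n <- F) l1norm n)%N => n nF.
by rewrite mem_ball (leq_bigmax_seq _ nF).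
Qed.

Lemma sum_subseq_le (I : choiceType) (s r : seq I) (g : I -> R) : (forall i, 0 <= g i) ->
  uniq s -> uniq r -> {subset s <= r} -> \sum_(i <- s) g i <= \sum_(i <- r) g i.
Proof.
move=> g0 us ur sr.
have p : perm_eq s [seq i <- r | i \in s].
  apply: uniq_perm => // [|i]; first exact: filter_uniq.
  by rewrite mem_filter; case: (boolP (i \in s)) => // /sr.
rewrite (perm_big _ p) /= big_filter big_mkcond /=; apply: ler_sum => i _.
by case: ifP.
Qed.

Lemma l2normsq_le v (M : R) :
  (forall L, \sum_(k <- ball d L) modulus (v k) ^+ 2 <= M) -> (l2normsq v <= M%:E)%E.
Proof.
move=> h; apply: ge_ereal_sup => _ [A [fA _] <-].
have [s0 As0] : exists s : seq site, A = [set` s] by apply/finite_seqP.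
have AE : A = [set` undup s0].
  by rewrite As0; apply/seteqP; split=> k /=; rewrite mem_undup.
rewrite AE -fsbig_seq ?undup_uniq // sumEFin lee_fin.
have [L sL] := subset_ball (undup s0); apply: le_trans (h L).
apply: sum_subseq_le => //; [|exact: undup_uniq|exact: ball_uniq].
by move=> k; exact: sqr_ge0.
Qed.

Lemma l2normsq_ge v L : ((\sum_(k <- ball d L) modulus (v k) ^+ 2)%:E <= l2normsq v)%E.
Proof.
apply: esum_ge; exists [set` ball d L].
  by split => //; apply/finite_seqP; exists (ball d L).
by rewrite -fsbig_seq ?ball_uniq // sumEFin.
Qed.

Lemma l2norm_le v (M : R) : 0 <= M ->
  (forall L, \sum_(k <- ball d L) modulus (v k) ^+ 2 <= M) -> l2norm v <= Num.sqrt M.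
Proof.
move=> M0 h; rewrite /l2norm ler_wsqrtr //.
have h1 := l2normsq_le h.
have h0 : (0 <= l2normsq v)%E.
  by apply: esum_ge0 => k _; rewrite lee_fin sqr_ge0.
by move: h0 h1; case: (l2normsq v) => [r| |] //=; rewrite lee_fin.
Qed.

Definition nbr_seq (n : site) : seq site :=
  [seq n + basis_vec i | i <- enum 'I_d] ++ [seq n - basis_vec i | i <- enum 'I_d].

Lemma basis_vec_inj : injective (@basis_vec d).
Proof.
move=> i j /matrixP/(_ 0 i); rewrite !mxE !eqxx /=.
by case: eqVneq.
Qed.

Lemma basis_vecN (i j : 'I_d) : basis_vec i != - basis_vec j.
Proof.
apply/eqP => /matrixP/(_ 0 i); rewrite !mxE !eqxx /=.
by case: (i == j).
Qed.

Lemma nbr_uniq n : uniq (nbr_seq n).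
Proof.
have i1 : injective (fun i => n + basis_vec i) by move=> i j /addrI/basis_vec_inj.
have i2 : injective (fun i => n - basis_vec i) by move=> i j /addrI/oppr_inj/basis_vec_inj.
rewrite cat_uniq (map_inj_uniq i1) (map_inj_uniq i2) enum_uniq.
rewrite andbT /=; apply/hasPn => k /mapP[i _ ->]; apply/mapP => -[j _ /addrI e].
by have := basis_vecN j i; rewrite e eqxx.
Qed.

Lemma l1norm1_basis (k : site) : l1norm k = 1%N -> exists i, k = basis_vec i \/ k = - basis_vec i.
Proof.
move=> k1; have [i ki] : exists i, k 0 i != 0.
  apply/existsP; rewrite -negb_forall; apply/negP => /forallP h.
  have k0 : k = 0 by apply/rowP => i; rewrite mxE; exact/eqP/h.
  by move: k1; rewrite k0 l1norm0.
exists i; move: k1; rewrite /l1norm (bigD1 i) //= => k1.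
have ki1 : (1 <= `|k ord0 i|)%N by rewrite absz_gt0.
have rest : (\sum_(j < d | j != i) `|k ord0 j|)%N = 0%N.
  by move: k1 ki1; move: (\sum_(j < d | j != i) _)%N `|k ord0 i|%N => a b; lia.
have ki' : `|k ord0 i|%N = 1%N by move: k1; rewrite rest addn0.
have kj j : j != i -> k 0 j = 0.
  move=> ji; apply/eqP; rewrite -absz_eq0; move/eqP: rest.
  by rewrite sum_nat_eq0 => /forallP/(_ j); rewrite ji.
have [e|e] : k 0 i = 1 \/ k 0 i = - 1.
  by move: ki'; move: (k ord0 i) => z; lia.
- left; apply/rowP => j; rewrite !mxE eqxx /=.
  by have [->|ji] := eqVneq j i; [rewrite e|rewrite kj].
- right; apply/rowP => j; rewrite !mxE eqxx /=.
  by have [->|ji] := eqVneq j i; [rewrite e|rewrite kj // oppr0].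
Qed.

Lemma laplacian_lap u n : laplacian (fun k => (u k)%:C) n = (lap (@basis_vec d) u n)%:C.
Proof.
rewrite /laplacian.
have -> : [set m : site | l1norm (m - n) = 1%N] = [set` nbr_seq n].
  apply/seteqP; split=> k /=.
    move=> /l1norm1_basis[i [e|e]]; rewrite mem_cat; apply/orP; [left|right].
      by apply/mapP; exists i; rewrite ?mem_enum // -e addrC subrK.
    by apply/mapP; exists i; rewrite ?mem_enum // -e addrC subrK.
  rewrite mem_cat => /orP[] /mapP[i _ ->]; rewrite addrAC subrr add0r ?l1normN;
    exact: l1norm_delta.
have e (g : 'I_d -> site) (F : site -> R[i]) :
    \sum_(k <- [seq g i | i <- enum 'I_d]) F k = \sum_i F (g i).
  by rewrite big_map big_enum.
rewrite -fsbig_seq ?nbr_uniq // big_cat /= !e -big_split /=.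
by rewrite /lap rmorph_sum; apply: eq_bigr => i _; rewrite rmorphD.
Qed.

End SquareSummable.

Section BoundStateProperties.
Variables (R : realType) (d : nat) (delta beta eps tau : R) (q : nat -> R).
Local Notation pr := (profile delta beta eps).
Local Notation site := 'rV[int]_d.
Hypothesis hd : (1 <= d)%N.
Hypothesis dp : decay_profile d eps tau (4 ^+ d) q (weight R d) pr.
Variables (V : site -> \bar R).

(** Translation covariance: along an orbit, moving the centre from [m] to 0 replaces [x] by
    [x + m . omega]. *)
Lemma bound_state_translate m E u : bound_state delta beta eps tau V m E u ->
  bound_state delta beta eps tau (fun k => V (m + k)) 0 E (fun k => u (m + k)).
Proof.
case=> h1 h2 h3 h4 h5 h6 h7; split.
- by rewrite addr0.
- by move=> k; exact: h2.
- move=> k Vk; rewrite -(h3 _ Vk); congr (_ * _ + _).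
  by apply: eq_bigr => i _; rewrite !addrA.
- by move=> k; have := h4 (m + k); rewrite subr0 addrAC subrr add0r.
- by rewrite addr0.
- by rewrite addr0.
- by move=> L; have := h7 L; under eq_bigr => l _ do rewrite -[l in m + l]add0r.
Qed.

Variables (E : R) (u : site -> R).
Hypothesis hu : bound_state delta beta eps tau V 0 E u.
Local Notation uC := (fun k => (u k)%:C).

Lemma bound_state_ball L :
  1 - tau * 4 ^+ d * pr L <= \sum_(k <- ball d L) modulus (uC k) ^+ 2 <= 1.
Proof.
have := bs_mass hu L.
suff -> : \sum_(l <- ball d L) u (0 + l) ^+ 2 = \sum_(k <- ball d L) modulus (uC k) ^+ 2 by [].
by apply: eq_bigr => k _; rewrite modulus_real add0r real_normK ?num_real.
Qed.

Lemma bound_state_l2normsq : l2normsq uC = 1%:E.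
Proof.
apply/eqP; rewrite eq_le; apply/andP; split.
  by apply: l2normsq_le => L; have /andP[] := bound_state_ball L.
apply/lee_addgt0Pr => e e0.
have /andP[t0 t4] := tau4_itv dp.
have [L hL] := pr_small hd dp e0.
have := l2normsq_ge uC L; have /andP[h _] := bound_state_ball L; have h' := hL L (leqnn _).
have pp : tau * 4 ^+ d * pr L <= 1 * pr L.
  by apply: ler_wpM2r; [exact: expR_ge0|lra].
move=> h2; apply: (@le_trans _ _ ((\sum_(k <- ball d L) modulus (uC k) ^+ 2)%:E + e%:E)%E).
  by rewrite -EFinD lee_fin; lra.
by rewrite leeD2r.
Qed.

Lemma bound_state_abs_le1 k : `|u k| <= 1.
Proof. by apply: le_trans (bs_decay hu k) _; exact: profile_le1 dp. Qed.

Lemma bound_state_sum_abs (F : seq site) : uniq F -> \sum_(k <- F) `|u k| <= 2.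
Proof.
move=> uF; rewrite (bigID (fun k => k == 0)) /=.
have h1 : \sum_(k <- F | k == 0) `|u k| <= 1.
  rewrite -big_filter; have uf := filter_uniq (fun k => k == 0) uF.
  have sub : {subset [seq k <- F | k == 0] <= [:: (0 : site)]}.
    by move=> k; rewrite mem_filter inE => /andP[].
  have u1 : uniq [:: (0 : site)] by [].
  apply: le_trans (sum_subseq_le (g := fun k => `|u k|) (fun k => normr_ge0 _) uf u1 sub) _.
  by rewrite big_seq1; exact: bound_state_abs_le1.
have h2 : \sum_(k <- F | k != 0) `|u k| <= tau * 4 ^+ d.
  apply: le_trans (sum_offdiag dp 0 uF); apply: ler_sum => k _; exact: (bs_decay hu).
have /andP[t0 t4] := tau4_itv dp.
lra.
Qed.

(** The potential may be unbounded, but where it is finite the equation expresses [V u] through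
    [E u] and [lap u], which are bounded and summable; its square is at most the bound [Bd] times a
    summable majorant. *)
Lemma bound_state_domain : in_domain V uC.
Proof.
split.
- by rewrite bound_state_l2normsq ltry.
- by move=> k Vk; rewrite (bs_vanish hu Vk).
have e0 := dp_eps dp.
pose lp := lap (@basis_vec d) u.
pose Bd : R := `|E| + eps * (2 * d%:R).
have Bd0 : 0 <= Bd by rewrite addr_ge0 // !mulr_ge0 // ltW.
have lp_le k : `|lp k| <= \sum_i (`|u (k + basis_vec i)| + `|u (k - basis_vec i)|).
  apply: le_trans (ler_norm_sum _ _ _) _; apply: ler_sum => i _; exact: ler_normD.
have lp2 k : `|lp k| <= 2 * d%:R.
  apply: le_trans (lp_le k) _; apply: (@le_trans _ _ (\sum_(i < d) 2)).
    apply: ler_sum => i _.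
    have h1 := bound_state_abs_le1 (k + basis_vec i).
    have h2 := bound_state_abs_le1 (k - basis_vec i); lra.
  by rewrite sumr_const card_ord mulr_natr.
pose M := Bd * (`|E| * 2 + eps * (\sum_(i < d) (2 + 2))).
have term k : modulus ((fine (V k))%:C * uC k) ^+ 2 <=
    Bd * (`|E| * `|u k| + eps * \sum_i (`|u (k + basis_vec i)| + `|u (k - basis_vec i)|)).
  have nn : 0 <= `|E| * `|u k| + eps * \sum_i (`|u (k + basis_vec i)| + `|u (k - basis_vec i)|).
    rewrite addr_ge0 ?mulr_ge0 ?(ltW e0) // sumr_ge0 // => i _; exact: addr_ge0.
  rewrite -rmorphM modulus_real.
  have [Vk|Vk] := eqVneq (V k) -oo%E.
    by rewrite Vk /= mul0r normr0 expr0n mulr_ge0.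
  have -> : fine (V k) * u k = E * u k - eps * lp k by rewrite -(bs_eq hu Vk) /lp; ring.
  have z1 : `|E * u k - eps * lp k| <= `|E| * `|u k| + eps * `|lp k|.
    by apply: le_trans (ler_normB _ _) _; rewrite !normrM (gtr0_norm e0).
  rewrite expr2; apply: ler_pM => //.
    apply: le_trans z1 _; apply: lerD; last by rewrite ler_pM2l.
    by rewrite -[leRHS]mulr1 ler_wpM2l // bound_state_abs_le1.
  by apply: le_trans z1 _; rewrite lerD2l ler_pM2l.
apply: (@le_lt_trans _ _ M%:E); last exact: ltry.
apply: l2normsq_le => L.
apply: (@le_trans _ _ (\sum_(k <- ball d L) Bd * (`|E| * `|u k| +
    eps * \sum_i (`|u (k + basis_vec i)| + `|u (k - basis_vec i)|)))).
  by apply: ler_sum => k _; exact: term.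
rewrite -mulr_sumr /M; apply: ler_wpM2l => //.
rewrite big_split /= -!mulr_sumr; apply: lerD.
  by apply: ler_wpM2l => //; apply: bound_state_sum_abs; exact: ball_uniq.
rewrite ler_pM2l // exchange_big /=; apply: ler_sum => i _; rewrite big_split /=.
have sh (c : site) : \sum_(k <- ball d L) `|u (k + c)| <= 2.
  rewrite -(big_map (fun k => k + c) xpredT (fun k => `|u k|)).
  apply: bound_state_sum_abs; rewrite map_inj_uniq ?ball_uniq //; exact: addIr.
by apply: lerD; exact: sh.
Qed.

Lemma bound_state_eigen : eigen_equation eps V E%:E uC.
Proof.
split; first exact: bound_state_domain.
move=> k; rewrite /schrodinger; case: eqVneq => [Vk|Vk].
  by rewrite (bs_vanish hu Vk) mulr0.
by rewrite laplacian_lap -!rmorphM -rmorphD (bs_eq hu Vk).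
Qed.

(** [1 - u 0 <= 1 - u 0 ^ 2] because [u 0] lies between 0 and 1; the factor 1/40 provided by [tau]
    makes the inequality strict. *)
Lemma bound_state_near1 : 0 < delta < 1 -> 0 < eps < 1 ->
  modulus (uC 0 - 1) < eps `^ (1 - delta).
Proof.
move=> /andP[d0 d1] /andP[e0 e1].
rewrite -[X in _ - X]/((1 : R)%:C) -rmorphB modulus_real.
have h := bs_half hu; have h1 := bound_state_abs_le1 0; have h2 := bs_near1 hu.
have /andP[t0 t4] := tau4_itv dp.
have u0 : 0 <= u 0 by apply: le_trans h; rewrite invr_ge0.
rewrite ger0_norm // in h1.
have ln0 : ln eps < 0 by apply: ln_lt0; rewrite e0.
have pE : pr 1%N <= eps `^ (1 - delta).
  rewrite /profile powR_1l !mulr1 [leRHS]/powR gt_eqF // ler_expR.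
  have dl : 0 < delta * - ln eps by rewrite mulr_gt0 // oppr_gt0.
  lra.
have p0 : 0 < pr 1%N by exact: expR_gt0.
rewrite distrC ger0_norm ?subr_ge0 //; apply: lt_le_trans pE.
have h3 : 1 - u 0 <= 1 - u 0 ^+ 2 by nra.
have h4 : tau * 4 ^+ d * pr 1%N <= 40^-1 * pr 1%N by apply: ler_wpM2r => //; exact: ltW.
apply: le_lt_trans (le_trans h3 h2) _; apply: le_lt_trans h4 _; lra.
Qed.

Lemma bound_state_far n : 0 < delta < 1 -> 0 < eps < 1 ->
  modulus (uC n) <= eps `^ ((1 - delta) * (l1norm n)%:R).
Proof.
move=> /andP[d0 d1] /andP[e0 e1]; rewrite modulus_real.
apply: le_trans (bs_decay hu n) _; rewrite subr0 /profile [leRHS]/powR gt_eqF // ler_expR.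
have ln0 : ln eps < 0 by apply: ln_lt0; rewrite e0.
have y0 := powR_ge0 (l1norm n)%:R beta.
rewrite [leRHS]mulrC mulrDr gerDl mulr_le0_ge0 ?(ltW ln0) // mulr_ge0 //.
by rewrite divr_ge0 // ltW.
Qed.

End BoundStateProperties.

(** * Eigenvalue and eigenfunction as functions of the potential *)

Section Solution.
Variables (R : realType) (d : nat) (alpha delta rho beta eps tau : R).
Variables (omega : 'rV[R]_d) (f : R -> \bar R).
Local Notation pr := (profile delta beta eps).
Local Notation site := 'rV[int]_d.
Local Notation V := (potential f omega).
Local Notation bound := (bound_state delta beta eps tau).
Hypothesis hd : (1 <= d)%N.
Hypothesis hbeta : 0 < beta.
Hypothesis hrho : 0 < rho.
Hypothesis ha1 : 1 <= alpha.
Hypothesis omega01 : forall i, 0 <= omega 0 i < 1.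
Hypothesis omega_dioph : forall n : site, n != 0 -> forall k : int,
  expR (- (rho * (l1norm n)%:R `^ beta)) <= `|zdot n omega - k%:~R|.
Hypothesis dp : decay_profile d eps tau (4 ^+ d) (divisor alpha rho beta) (weight R d) pr.
Hypothesis hf : holder_monotone alpha f.

Lemma zdotD (n k : site) : zdot (n + k) omega = zdot n omega + zdot k omega.
Proof.
rewrite /zdot -big_split; apply: eq_bigr => i _.
by rewrite mxE rmorphD mulrDl.
Qed.

Lemma zdot0 : zdot (0 : site) omega = 0.
Proof. by rewrite /zdot big1 // => i _; rewrite mxE mul0r. Qed.

Lemma zdotN (n : site) : zdot (- n) omega = - zdot n omega.
Proof. by apply/eqP; rewrite -addr_eq0 -zdotD addNr zdot0. Qed.

Lemma zdot_int_inj (n n' : site) (k : int) :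
  zdot n omega - zdot n' omega = k%:~R -> n = n'.
Proof.
move=> e; apply/eqP; rewrite -subr_eq0; apply: contraT => n0.
have := omega_dioph n0 k; rewrite zdotD zdotN e subrr normr0.
by rewrite leNgt expR_gt0.
Qed.

Lemma potential0 x : V x 0 = f x.
Proof. by rewrite /potential zdot0 addr0. Qed.

Lemma potential_lty x k : (V x k < +oo)%E.
Proof. by have [fy _ _ _] := hf; exact: fy. Qed.

Lemma potential_period x : V (x + 1) = V x.
Proof.
have [_ fp _ _] := hf; apply/funext => k.
by rewrite /potential addrAC fp.
Qed.

Lemma orbit_family (alpha' x : R) : 1 <= alpha' -> alpha' <= alpha -> holder_monotone alpha' f ->
  exists (E : site -> R) (u : site -> site -> R),
  (forall m, V x m != -oo%E -> bound (V x) m (E m) (u m)) /\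
  forall m m', V x m != -oo%E -> V x m' != -oo%E ->
     frac_part (x + zdot m omega) < frac_part (x + zdot m' omega) ->
     E m + (frac_part (x + zdot m' omega) - frac_part (x + zdot m omega)) `^ alpha' <= E m'.
Proof.
move=> a1 aa hf'; have [|E [u [h1 h2]]] := bound_family (B := unit) (x := fun=> x) hd hbeta hrho
  a1 aa
  omega01 omega_dioph dp hf'.
  move=> [] n [] n' k e; split=> //; apply: (@zdot_int_inj n n' k).
  by rewrite -e opprD addrACA subrr add0r.
exists (E tt), (u tt); split=> [m ne|m m' ne ne' lt]; first exact: h1.
exact: (h2 tt m tt m').
Qed.

Lemma orbit_family_distinct x : exists (E : site -> R) (u : site -> site -> R),
  (forall m, V x m != -oo%E -> bound (V x) m (E m) (u m)) /\
  forall m m', V x m != -oo%E -> V x m' != -oo%E -> m != m' -> E m != E m'.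
Proof.
have [E [u [h1 h2]]] := orbit_family x ha1 (lexx _) hf.
exists E, u; split=> // m m' ne ne' mm.
have lt n n' : V x n != -oo%E -> V x n' != -oo%E ->
    frac_part (x + zdot n omega) < frac_part (x + zdot n' omega) -> E n < E n'.
  move=> hn hn' l; apply: lt_le_trans (h2 n n' hn hn' l).
  by rewrite ltrDl powR_gt0 // subr_gt0.
have [l|l|e] := ltgtP (frac_part (x + zdot m omega)) (frac_part (x + zdot m' omega)).
- by rewrite lt_eqF // lt.
- by rewrite gt_eqF // lt.
case/eqP: mm; move: e; rewrite /frac_part => e.
apply: (@zdot_int_inj m m' (Num.floor (x + zdot m omega) - Num.floor (x + zdot m' omega))).
by rewrite rmorphB /=; lra.
Qed.

Lemma bound_unique x E E' u u' : bound (V x) 0 E u -> bound (V x) 0 E' u' ->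
  E = E' /\ forall k, u k = u' k.
Proof.
move=> h h'; have [Ef [uf [h1 h2]]] := orbit_family_distinct x.
have [-> e1] := bound_state_unique hd dp h1 h2 h.
have [-> e2] := bound_state_unique hd dp h1 h2 h'.
by split=> // k; rewrite e1 e2.
Qed.

(* A property of the potential rather than of [x], which makes [E] and [psi]
   periodic. *)
Definition solution (W : site -> \bar R) (y : \bar R * l2 R d) : Prop :=
  if W 0 == -oo%E then y.1 = -oo%E /\ forall k, y.2 k = (k == 0)%:R
  else exists E u, [/\ bound W 0 E u, y.1 = E%:E & forall k, y.2 k = (u k)%:C].

Lemma l2normsq_delta : l2normsq (fun k : site => (k == 0)%:R : R[i]) = 1%:E.
Proof.
have sumE L : \sum_(k <- ball d L) modulus ((k == 0)%:R : R[i]) ^+ 2 = 1.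
  rewrite (bigD1_seq 0) ?ball_uniq ?mem_ball ?l1norm0 //= eqxx.
  rewrite -[1%:R]/((1 : R)%:C) modulus_real normr1 expr1n big1 ?addr0 // => k /negPf ->.
  by rewrite -[0%:R]/((0 : R)%:C) modulus_real normr0 expr0n.
apply/eqP; rewrite eq_le; apply/andP; split.
  by apply: l2normsq_le => L; rewrite sumE.
by apply: le_trans (l2normsq_ge _ 0%N); rewrite sumE.
Qed.

Lemma solution_exists x : exists y, solution (V x) y.
Proof.
have [e|ne] := eqVneq (V x 0) -oo%E.
  have h : (l2normsq (fun k : site => ((k == 0)%:R)%R : R[i]) < +oo)%E.
    by rewrite l2normsq_delta ltry.
  by exists (-oo%E, L2 h); rewrite /solution e eqxx.
have [E [u [h1 _]]] := orbit_family_distinct x.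
have hu := h1 0 ne.
have h : (l2normsq (fun k => ((u 0 k)%:C)%R) < +oo)%E.
  by rewrite (bound_state_l2normsq hd dp hu) ltry.
by exists ((E 0)%:E, L2 h); rewrite /solution (negPf ne); exists (E 0), (u 0).
Qed.

Lemma solution_map : exists sol : (site -> \bar R) -> \bar R * l2 R d,
  forall x, solution (V x) (sol (V x)).
Proof.
have /boolp.choice[sol h] : forall W : site -> \bar R, exists y : \bar R * l2 R d,
    (exists x, W = V x) -> solution W y.
  move=> W; have [[x ->]|n] := pselect (exists x, W = V x).
    by have [y hy] := solution_exists x; exists y.
  by exists (0%E, point) => /n.
by exists sol => x; apply: h; exists x.
Qed.

Variable sol : (site -> \bar R) -> \bar R * l2 R d.
Hypothesis hsol : forall x, solution (V x) (sol (V x)).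

Lemma sol_infty x : f x = -oo%E ->
  (sol (V x)).1 = -oo%E /\ forall k, (sol (V x)).2 k = (k == 0)%:R.
Proof. by move=> fx; have := hsol x; rewrite /solution potential0 fx eqxx. Qed.

Lemma sol_finite x : f x != -oo%E ->
  exists E u, [/\ bound (V x) 0 E u, (sol (V x)).1 = E%:E & forall k, (sol (V x)).2 k = (u k)%:C].
Proof. by move=> fx; have := hsol x; rewrite /solution potential0 (negPf fx). Qed.

Lemma frac_part_id (t : R) : 0 <= t < 1 -> frac_part t = t.
Proof. by move=> t01; rewrite /frac_part (floor_def (m := 0)) ?subr0. Qed.

Lemma frac_partD_int (t : R) (k : int) : frac_part (t + k%:~R) = frac_part t.
Proof.
rewrite /frac_part (floor_def (m := Num.floor t + k)); first by rewrite rmorphD /=; ring.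
have := floor_itv t; rewrite !rmorphD /= => /andP[h1 h2].
by rewrite lerD2r h1 /= addrAC ltrD2r.
Qed.

(** [bound] does not mention the exponent, so by uniqueness a family built from gaps with exponent
    [alpha'] has the energies of [sol], which therefore inherit these gaps. The cases of interest
    are [alpha] and 1. *)
Lemma sol_holder (alpha' x y : R) : 1 <= alpha' -> alpha' <= alpha -> holder_monotone alpha' f ->
  0 <= x -> x <= y -> y < 1 ->
  ((sol (V x)).1 + ((y - x) `^ alpha')%:E <= (sol (V y)).1)%E.
Proof.
move=> a1 aa hf' x0 xy y1; have al0 : 0 < alpha' by apply: lt_le_trans a1.
have [fy fp fint fmono] := hf'.
move: xy; rewrite le_eqVlt => /predU1P[<-|xy].
  by rewrite subrr powR0 ?gt_eqF // adde0.
have [fx|fx] := eqVneq (f x) -oo%E.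
  by have [-> _] := sol_infty fx; rewrite leNye.
have fyn : f y != -oo%E.
  have := fmono x y x0 (ltW xy) y1; have := fy x; move: fx.
  by case: (f x) => // r _ _; case: (f y).
have [E [u [bx -> _]]] := sol_finite fx.
have [E' [u' [by' -> _]]] := sol_finite fyn.
rewrite -EFinD lee_fin.
have px : frac_part x = x by apply: frac_part_id; rewrite x0 (lt_trans xy).
have py : frac_part y = y by apply: frac_part_id; rewrite y1 (le_trans x0 (ltW xy)).
(* If [y] is on the orbit of [x], the two eigenvalues belong to the same family;
   otherwise both orbits are put in one finite model. *)
have [[m [k yE]]|no] := pselect (exists (m : site) (k : int), y = x + zdot m omega + k%:~R).
  have [Ef [uf [h1 h2]]] := orbit_family x a1 aa hf'.
  have Vm : (fun l => V x (m + l)) = V y.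
    apply/funext => l; rewrite /potential zdotD yE.
    by rewrite [x + zdot m omega + _ + _]addrAC periodic1_int // addrA.
  have vm : V x m != -oo%E by have /(congr1 (fun g => g 0)) := Vm; rewrite addr0 potential0 => ->.
  have v0 : V x 0 != -oo%E by rewrite potential0.
  have hm := bound_state_translate (h1 m vm); rewrite Vm in hm.
  have [-> _] := bound_unique by' hm; have [-> _] := bound_unique bx (h1 0 v0).
  have pm : frac_part (x + zdot m omega) = y by rewrite -py yE frac_partD_int.
  have p0 : frac_part (x + zdot 0 omega) = x by rewrite zdot0 addr0 px.
  have := h2 0 m v0 vm; rewrite pm p0; exact.
have [|Ef [uf [h1 h2]]] := bound_family (B := bool) (x := fun b : bool => if b then x else y)
    hd hbeta hrho a1 aa omega01 omega_dioph dp hf'.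
  (* The two orbits are disjoint modulo 1, so all phases in the common model are distinct. *)
  have cross n n' (k : int) : x + zdot n omega - (y + zdot n' omega) <> k%:~R.
    move=> e; apply: no; exists (n - n'), (- k).
    by rewrite zdotD zdotN rmorphN /= -e; ring.
  case=> n [] n' k e.
  - split=> //; apply: (@zdot_int_inj n n' k).
    by rewrite -e opprD addrACA subrr add0r.
  - by case: (cross _ _ _ e).
  - case: (cross n' n (- k)); rewrite rmorphN /= -e; ring.
  - split=> //; apply: (@zdot_int_inj n n' k).
    by rewrite -e opprD addrACA subrr add0r.
have v0 : V x 0 != -oo%E by rewrite potential0.
have v0' : V y 0 != -oo%E by rewrite potential0.
have [-> _] := bound_unique bx (h1 true 0 v0).
have [-> _] := bound_unique by' (h1 false 0 v0').
have := h2 true 0 false 0 v0 v0'; rewrite /phase /= zdot0 !addr0 px py; exact.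
Qed.

End Solution.

(** * Measurability *)

Section Discontinuities.
Variable R : realType.

(** Monotonicity gives one-sided limits with [g s] between them; without a jump all three agree. *)
Lemma nondecreasing_continuous_or_jump (g : R -> R) (a b s : R) :
  {in `[a, b] &, {homo g : x y / x <= y}} -> a < s -> s < b ->
  ~ discontinuity g s -> g t @[t --> s] --> g s.
Proof.
move=> nd as_ sb nj.
have inab z : a <= z -> z <= b -> z \in `[a, b] by move=> az zb; rewrite in_itv /= az.
have sab := inab s (ltW as_) (ltW sb).
have cl : cvg (g t @[t --> s^'-]).
  apply: nondecreasing_at_left_is_cvgr.
    near=> z => x y; rewrite !in_itv /= => /andP[zx xs] /andP[zy ys] xy.
    have az : a <= z by near: z; exact: nbhs_left_ge.
    apply: nd => //; apply: inab; try exact: ltW (lt_trans _ sb).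
      exact: le_trans az (ltW zx).
    exact: le_trans az (ltW zy).
  near=> z; exists (g s) => _ [x /= + <-]; rewrite in_itv /= => /andP[zx xs].
  have az : a <= z by near: z; exact: nbhs_left_ge.
  apply: nd => //; last exact: ltW.
  by apply: inab; [exact: le_trans az (ltW zx)|exact: ltW (lt_trans xs sb)].
have cr : cvg (g t @[t --> s^'+]).
  apply: nondecreasing_at_right_is_cvgr.
    near=> z => x y; rewrite !in_itv /= => /andP[sx xz] /andP[sy yz] xy.
    have zb : z <= b by near: z; exact: nbhs_right_le.
    apply: nd => //; apply: inab; try exact: ltW (lt_trans as_ _).
      exact: le_trans (ltW xz) zb.
    exact: le_trans (ltW yz) zb.
  near=> z; exists (g s) => _ [x /= + <-]; rewrite in_itv /= => /andP[sx xz].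
  have zb : z <= b by near: z; exact: nbhs_right_le.
  apply: nd => //; last exact: ltW.
  by apply: inab; [exact: ltW (lt_trans as_ sx)|exact: le_trans (ltW xz) zb].
have le_l : lim (g t @[t --> s^'-]) <= g s.
  apply: limr_le => //; near=> z.
  have zs : z < s by near: z; exact: nbhs_left_lt.
  have az : a <= z by near: z; exact: nbhs_left_ge.
  by apply: nd; [apply: inab => //; exact: ltW (lt_trans zs sb)|by []|exact: ltW].
have le_r : g s <= lim (g t @[t --> s^'+]).
  apply: limr_ge => //; near=> z.
  have sz : s < z by near: z; exact: nbhs_right_gt.
  have zb : z <= b by near: z; exact: nbhs_right_le.
  by apply: nd; [by []|apply: inab => //; exact: ltW (lt_trans as_ sz)|exact: ltW].
have e : lim (g t @[t --> s^'-]) = lim (g t @[t --> s^'+]).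
  by apply/eqP; apply: contra_notT nj => ne; split.
have el : lim (g t @[t --> s^'-]) = g s by apply/eqP; rewrite eq_le le_l /= e.
have er : lim (g t @[t --> s^'+]) = g s by rewrite -e el.
by apply/left_right_continuousP; split; [rewrite -el|rewrite -er].
Unshelve. all: by end_near. Qed.

Lemma countable_imageT (T T' : Type) (h : T -> T') (A : set T) :
  countable A -> countable (h @` A).
Proof. by move=> cA; apply: sub_countable cA; exact: card_image_le. Qed.

Lemma countable_setU (T : Type) (A B : set T) :
  countable A -> countable B -> countable (A `|` B).
Proof.
move=> cA cB; have -> : A `|` B = \bigcup_(b in [set: bool]) (if b then A else B).
  apply/seteqP; split=> x; first by case; [exists true|exists false].
  by case=> -[] _; [left|right].
by apply: bigcup_countable => [|[] _ //]; exact: countableP.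
Qed.

Variables (alpha : R) (f : R -> \bar R).
Hypothesis hf : holder_monotone alpha f.

Definition irregular : set R :=
  [set t | ~ (f t != -oo%E /\ fine (f s) @[s --> t] --> fine (f t))].

Lemma irregular_countable : countable irregular.
Proof.
have [fy fp fint fmono] := hf.
pose g t := fine (f t).
(* [fine] maps -oo to 0, so monotonicity may fail at integers; the open unit interval is exhausted
   by intervals that avoid them. *)
pose lo (j : nat) : R := (j.+2%:R)^-1.
pose S (j : nat) : set R := [set s | s \in (`]lo j, (1 - lo j)[) /\ discontinuity g s].
have fin s : 0 < s -> s < 1 -> f s != -oo%E.
  move=> s0 s1; apply/eqP => /fint[k sk]; move: s0 s1; rewrite sk.
  rewrite ltr0z ltrz1 => k0 k1.
  by move: k0 k1; clear; lia.
have lo0 j : 0 < lo j by rewrite invr_gt0.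
have gnd j : {in `[lo j, 1 - lo j] &, {homo g : x y / x <= y}}.
  move=> x y; rewrite !in_itv /= => /andP[x0 x1] /andP[y0 y1] xy.
  have l0 := lo0 j.
  have xp : 0 < x by lra.
  have yp : 0 < y by lra.
  have x1' : x < 1 by lra.
  have y1' : y < 1 by lra.
  have := fmono x y (ltW xp) xy y1'; rewrite /g.
  move: (fin x xp x1') (fy x) (fin y yp y1') (fy y).
  case: (f x) => // u _ _; case: (f y) => // v _ _; rewrite -EFinD lee_fin /=.
  by apply: le_trans; rewrite lerDl powR_ge0.
apply: (@sub_countable _ _ _ ((range (fun k : int => k%:~R : R)) `|`
   \bigcup_(p in [set: int * nat]) ((fun s : R => s + p.1%:~R) @` S p.2))); last first.
  apply: countable_setU; first by apply: countable_imageT; exact: countableP.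
  apply: bigcup_countable => [|p _]; first exact: countableP.
  by apply: countable_imageT; exact: discontinuity_countable.
apply: subset_card_le => t irr.
pose k := Num.floor t; pose s := t - k%:~R.
have /andP[s0 s1] : 0 <= s < 1 := frac_part_itv t.
have [s00|sn] := eqVneq s 0.
  by left; exists k => //; apply/eqP; rewrite eq_sym -subr_eq0; apply/eqP.
right; have sp : 0 < s by rewrite lt_neqAle eq_sym sn.
pose j := Num.truncn (s^-1 + (1 - s)^-1).
have jlt : s^-1 + (1 - s)^-1 < j.+2%:R.
  by apply: lt_trans (truncnS_gt _) _; rewrite ltr_nat.
have s1p : 0 < 1 - s by rewrite subr_gt0.
have i1 : 0 < s^-1 by rewrite invr_gt0.
have i2 : 0 < (1 - s)^-1 by rewrite invr_gt0.
have l1 : lo j < s.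
  by rewrite -[ltRHS]invrK /lo ltf_pV2 ?posrE //; lra.
have l2 : s < 1 - lo j.
  rewrite ltrBrDl -ltrBrDr -[ltRHS]invrK /lo ltf_pV2 ?posrE //; lra.
exists (k, j) => //; exists s; last by rewrite /s /= subrK.
split; first by rewrite in_itv /= l1.
apply: contrapT => nj; apply: irr.
have fts : f t = f s by rewrite /s -rmorphN periodic1_int.
split; first by rewrite fts; exact: fin.
have c := nondecreasing_continuous_or_jump (gnd j) l1 l2 nj.
have gE : (fun t' => fine (f t')) = g \o (fun t' => t' - k%:~R).
  by apply/funext => t' /=; rewrite /g -rmorphN periodic1_int.
rewrite gE fts -/(g s).
apply: (@cvg_comp _ _ _ (fun t' => t' - k%:~R) g _ (nbhs s)) => //.
by rewrite /s; apply: cvgB; [exact: cvg_id|exact: cvg_cst].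
Qed.

End Discontinuities.

Section Measurability.
Variables (R : realType) (d : nat) (alpha delta rho beta eps tau : R).
Variables (omega : 'rV[R]_d) (f : R -> \bar R).
Local Notation pr := (profile delta beta eps).
Local Notation site := 'rV[int]_d.
Local Notation V := (potential f omega).
Local Notation bound := (bound_state delta beta eps tau).
Hypothesis hd : (1 <= d)%N.
Hypothesis hbeta : 0 < beta.
Hypothesis hrho : 0 < rho.
Hypothesis ha1 : 1 <= alpha.
Hypothesis omega01 : forall i, 0 <= omega 0 i < 1.
Hypothesis omega_dioph : forall n : site, n != 0 -> forall k : int,
  expR (- (rho * (l1norm n)%:R `^ beta)) <= `|zdot n omega - k%:~R|.
Hypothesis dp : decay_profile d eps tau (4 ^+ d) (divisor alpha rho beta) (weight R d) pr.
Hypothesis hf : holder_monotone alpha f.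
Variable sol : (site -> \bar R) -> \bar R * l2 R d.
Hypothesis hsol : forall x, solution delta beta eps tau (V x) (sol (V x)).

Definition regular : set R := [set x | forall n : site, ~ irregular f (x + zdot n omega)].

Lemma regularP x n : regular x -> V x n != -oo%E /\
  fine (f s) @[s --> x + zdot n omega] --> fine (f (x + zdot n omega)).
Proof. by move=> /(_ n) h; apply: contrapT. Qed.

Lemma regular_countableC : countable (~` regular).
Proof.
apply: (@sub_countable _ _ _
  (\bigcup_(n in [set: site]) ((fun s : R => s - zdot n omega) @` irregular f))); last first.
  apply: bigcup_countable => [|n _]; first exact: countableP.
  by apply: countable_imageT; exact: irregular_countable hf.
apply: subset_card_le => x /existsNP[n /contrapT h].
by exists n => //; exists (x + zdot n omega) => //; rewrite addrK.
Qed.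

Local Notation ut := (fun (t : R) (k : site) => complex.Re ((sol (V t)).2 k)).
Local Notation et := (fun t : R => fine (sol (V t)).1).

Lemma regular_bound t : regular t -> bound (V t) 0 (et t) (ut t) /\
  forall k, (sol (V t)).2 k = (ut t k)%:C.
Proof.
move=> /(@regularP t 0)[+ _]; rewrite potential0 => ft.
have [E [u [h1 h2 h3]]] := sol_finite hsol ft.
have -> : ut t = u by apply/funext => k; rewrite h3.
by rewrite h2; split=> // k; rewrite h3.
Qed.

(** Turns closeness on a ball into closeness in norm: by the common decay, the part outside is at
    most [4 * (tau * 4 ^ d) * pr L], below [pr L]. *)
Lemma bound_state_dist_le (W W' : site -> \bar R) E E' u u' L (e : R) :
  bound W 0 E u -> bound W' 0 E' u' -> 0 <= e ->
  \sum_(k <- ball d L) (u k - u' k) ^+ 2 <= e ->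
  l2norm (fun k => (u k)%:C - (u' k)%:C) <= Num.sqrt (e + pr L).
Proof.
move=> h h' e0 he; have p0 : 0 < pr L by exact: expR_gt0.
apply: l2norm_le => [|L']; first by rewrite addr_ge0 // ltW.
under eq_bigr => k _ do rewrite -rmorphB modulus_real real_normK ?num_real //.
rewrite (bigID (fun k => k \in ball d L)) /=; apply: lerD.
  apply: le_trans he; rewrite -big_filter.
  apply: (sum_subseq_le (g := fun k => (u k - u' k) ^+ 2)) => //.
  - by move=> k; exact: sqr_ge0.
  - by rewrite filter_uniq // ball_uniq.
  - exact: ball_uniq.
  - by move=> k; rewrite mem_filter => /andP[].
apply: (@le_trans _ _ (\sum_(k <- ball d L') 4 * tau * pr L * weight R d (l1norm (k - 0)))).
  rewrite big_mkcond /=; apply: ler_sum => k _.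
  have w0 : 0 <= 4 * tau * pr L * weight R d (l1norm (k - 0)).
    by rewrite !mulr_ge0 ?(ltW p0) ?(ltW (dp_tau dp)) ?(ltW (dp_w dp _)).
  case: ifPn => //; rewrite mem_ball -ltnNge => Lk.
  have k1 := bs_decay h k; have k2 := bs_decay h' k; rewrite subr0 in k1 k2.
  have k3 := dp_mono dp (ltnW Lk).
  have k4 := dp_small dp (leq_trans (ltn0Sn L) Lk).
  rewrite -real_normK ?num_real // expr2 subr0.
  have dk : `|u k - u' k| <= 2 * pr (l1norm k) by apply: le_trans (ler_normB _ _) _;
    rewrite mulr_natl mulr2n; exact: (lerD k1 k2).
  have -> : 4 * tau * pr L * weight R d (l1norm k) =
    (2 * pr L) * (2 * (tau * weight R d (l1norm k))) by ring.
  by apply: ler_pM; [exact: normr_ge0|exact: normr_ge0|..]; apply: le_trans dk _; rewrite ler_pM2l.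
rewrite -mulr_sumr; have := sum_weight_shift R 0 (ball_uniq d L').
have /andP[t0 t4] := tau4_itv dp; have t00 := dp_tau dp.
set w := \sum_(_ <- _) _ => hw.
have : 4 * tau * pr L * w <= 4 * tau * pr L * 4 ^+ d.
  by apply: ler_wpM2l => //; rewrite !mulr_ge0 // ltW.
move=> /le_trans; apply.
have -> : 4 * tau * pr L * 4 ^+ d = (4 * (tau * 4 ^+ d)) * pr L by ring.
by rewrite ger_pMl //; lra.
Qed.

(** If solutions at regular points approaching [x] stayed at distance [r], their limit along an
    ultrafilter would be a bound state for the potential of [x], since [f] is continuous along the
    orbit of [x]; uniqueness identifies it with the solution at [x], and the decay makes the
    convergence hold in norm. *)
Lemma sol_locally_continuous x (r : R) : regular x -> 0 < r ->
  exists2 W : set R, nbhs x W & forall t, W t -> regular t ->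
    l2norm (fun k => (sol (V t)).2 k - (sol (V x)).2 k) < r.
Proof.
move=> rx r0; have [hx sx] := regular_bound rx.
pose Bad := [set t | regular t /\ r <= l2norm (fun k => (sol (V t)).2 k - (sol (V x)).2 k)].
have [cl|/existsNP[W /not_implyP[nW nB]]] := pselect (closure Bad x); last first.
  exists W => // t Wt rt; rewrite ltNge; apply/negP => le.
  by apply: nB; exists t.
exfalso.
have PF : ProperFilter (within Bad (nbhs x)) by exact: within_nbhs_proper.
have [U [UU sU]] := ultraFilterLemma PF.
have FF : ProperFilter U by exact: ultra_proper.
have UB : \forall t \near U, Bad t by apply: sU; apply: nearW.
have Ux : U --> x.
  move=> A nA; have wA : within Bad (nbhs x) A by apply: filterS nA => t At _.
  exact: (sU A wA).
have UR : \forall t \near U, regular t by apply: filterS UB => t [].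
have dec k : \forall t \near U, `|ut t k| <= pr (l1norm (k - 0)).
  by apply: filterS UR => t rt; exact: (bs_decay (regular_bound rt).1).
have /boolp.choice[ul hul] : forall k : site, exists l : R, ut t k @[t --> U] --> l.
  move=> k; apply: ultra_bounded_cvg; apply: filterS (dec k) => t h.
  by apply: le_trans h _; exact: profile_le1 dp.
have Vx0 : V x 0 != -oo%E by have [] := @regularP x 0 rx.
have hv k : fine (V t k) @[t --> U] --> fine (V x k).
  have [_ c] := @regularP x k rx.
  have c2 : t + zdot k omega @[t --> U] --> x + zdot k omega.
    by apply: cvgD; [exact: Ux|exact: cvg_cst].
  exact: (@cvg_comp _ _ _ (fun t => t + zdot k omega) (fun s => fine (f s)) _ _ _ c2 c).
have [E' [hE' _]] : exists E', bound (V x) 0 E' ul /\ et t @[t --> U] --> E'.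
  apply: (@bound_state_limit R d delta beta eps tau _ U FF (V x) 0 ul
    (fun t k => fine (V t k)) et ut).
  - by move=> k; exact: (potential_lty _ hf).
  - exact: Vx0.
  - move=> k; apply: filterS UR => t rt; have [b _] := regular_bound rt.
    by apply: (bs_eq b); have [] := @regularP t k rt.
  - exact: dec.
  - by apply: filterS UR => t rt; exact: (bs_half (regular_bound rt).1).
  - by apply: filterS UR => t rt; exact: (bs_near1 (regular_bound rt).1).
  - by move=> L; apply: filterS UR => t rt; exact: (bs_mass (regular_bound rt).1).
  - move=> k; have := hv k; have [+ _] := @regularP x k rx.
    have := potential_lty omega hf x k.
    by case: (V x k).
  - exact: hul.
have [_ eu] := bound_unique hd hbeta hrho ha1 omega01 omega_dioph dp hf hx hE'.
have r40 : 0 < r ^+ 2 / 4 by rewrite divr_gt0 ?exprn_gt0.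
have [L hL] := pr_small hd dp r40.
have c0 : \sum_(k <- ball d L) (ut t k - ut x k) ^+ 2 @[t --> U] -->
    \sum_(k <- ball d L) (0 : R).
  apply: cvg_bigsum => k.
  have -> : (0 : R) = (ul k - ut x k) * (ul k - ut x k) by rewrite eu subrr mul0r.
  under eq_fun do rewrite expr2.
  by apply: cvgM; apply: cvgB; [exact: hul|exact: cvg_cst|exact: hul|exact: cvg_cst].
rewrite big1 // in c0.
have small : \forall t \near U, \sum_(k <- ball d L) (ut t k - ut x k) ^+ 2 <= r ^+ 2 / 4.
  have : \forall t \near U, `|\sum_(k <- ball d L) (ut t k - ut x k) ^+ 2| <= r ^+ 2 / 4.
    by apply: (cvgr_norm_le _ c0); rewrite normr0.
  by apply: filterS => t; apply: le_trans; exact: ler_norm.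
have [t [[rt le] ht]] := filter_ex (filterI UB small).
have [bt st] := regular_bound rt.
have := bound_state_dist_le bt hx (ltW r40) ht.
have -> : (fun k => (ut t k)%:C - (ut x k)%:C) = (fun k => (sol (V t)).2 k - (sol (V x)).2 k).
  by apply/funext => k; rewrite -st -sx.
move=> /(le_trans le); apply/negP; rewrite -ltNge.
have pL := hL L (leqnn _).
have r1 : r = Num.sqrt (r ^+ 2) by rewrite sqrtr_sqr gtr0_norm.
rewrite [ltRHS]r1 ltr_sqrt ?exprn_gt0 //.
have : 0 < r ^+ 2 by rewrite exprn_gt0.
lra.
Qed.

(** On the regular points the map is continuous, so preimages of open sets are relatively open
    there; the other points form a countable set. *)
Lemma sol_measurable : measurable_fun [set: measurableTypeR R]
  ((fun x => (sol (V x)).2) : measurableTypeR R -> l2_borel R d).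
Proof.
have mreg : measurable (~` regular : set (measurableTypeR R)).
  apply: countable_measurable; last exact: regular_countableC.
  by move=> t; exact: measurable_set1.
apply: (@measurability _ _ (measurableTypeR R) (l2_borel R d) [set: measurableTypeR R]
  (fun x => (sol (V x)).2) (@l2_open R d)); first by [].
move=> _ [A oA <-]; rewrite setTI.
pose psi x := (sol (V x)).2.
pose O := [set x | exists W : set R, [/\ open W, W x & forall t, W t -> regular t -> A (psi t)]].
have oO : open O.
  rewrite openE => x [W [oW Wx hW]]; rewrite /interior.
  by apply: filterS (open_nbhs_nbhs (conj oW Wx)) => t Wt; exists W.
have -> : (fun x => (sol (V x)).2) @^-1` A =
    (regular `&` O) `|` (~` regular `&` (psi @^-1` A)).
  apply/seteqP; split=> x /=.
    move=> Ax; have [rx|nrx] := pselect (regular x); last by right.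
    left; split=> //; have [r r0 hr] := oA _ Ax.
    have [W nW hW] := sol_locally_continuous rx r0.
    have [W' [oW' W'x] sW] : exists2 W', open_nbhs x W' & W' `<=` W by move: nW; rewrite nbhsE.
    exists W'; split=> // t W't rt; apply: hr; exact: (hW t (sW _ W't) rt).
  by move=> [[rx [W [_ Wx h]]]|[]//]; exact: h.
apply: measurableU.
  apply: measurableI; last exact: measurable_realfun.open_measurable.
  by rewrite -[regular]setCK; exact: measurableC.
apply: countable_measurable; first by move=> t; exact: measurable_set1.
apply: sub_countable regular_countableC; apply: subset_card_le; exact: subIsetl.
Qed.

End Measurability.

Lemma diophantine_int (R : realType) (d : nat) (rho mu : R) (omega : 'rV[R]_d) :
  diophantine rho mu omega -> forall n : 'rV[int]_d, n != 0 -> forall k : int,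
  expR (- (rho * (l1norm n)%:R `^ (1 + mu)^-1)) <= `|zdot n omega - k%:~R|.
Proof.
move=> [_ h] n n0 k; apply: le_trans (h n n0) _; apply: ge_inf; last by exists k.
by exists 0 => _ [j _ <-].
Qed.

Unset Implicit Arguments.

Theorem theorem1p1 (R : realType) (d : nat) (alpha delta rho mu : R)
    (hd : (1 <= d)%N) (halpha : 1 <= alpha) (hdelta : 0 < delta < 1)
    (hrho : 0 < rho) (hmu : 0 < mu) :
  exists2 eps0 : R, 0 < eps0 &
  forall (eps : R) (omega : 'rV[R]_d) (f : R -> \bar R),
    0 < eps < eps0 -> diophantine rho mu omega -> holder_monotone alpha f ->
  exists (E : R -> \bar R) (psi : R -> l2 R d),
    [/\
        [/\ forall x, (E x < +oo)%E,
            periodic1 E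
          & forall x y, 0 <= x -> x < y -> y < 1 -> (E x < E y)%E],
        periodic1 psi /\
        measurable_fun [set: measurableTypeR R]
          (psi : measurableTypeR R -> l2_borel R d),
        forall x, eigen_equation eps (potential f omega x) (E x) (psi x),
        forall x,
          [/\ l2norm (psi x) = 1,
              modulus (psi x 0 - 1) < eps `^ (1 - delta)
            & forall n : 'rV[int]_d, l1norm n <> 0%N ->
                modulus (psi x n) <= eps `^ ((1 - delta) * (l1norm n)%:R)]
      & lipschitz_monotone f -> lipschitz_monotone E].
Proof.
pose beta := (1 + mu)^-1.
have hbeta : 0 < beta < 1.
  by rewrite invr_gt0 invf_lt1 ?addr_gt0 // ltrDl hmu.
have b0 : 0 < beta by case/andP: hbeta.
(* [4 ^ d] bounds the sum of the weights; this [tau] gives equality in the smallness condition of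
   [decay_profile]. *)
pose tau : R := (40 * (d.+1)%:R * 4 ^+ d)^-1.
have C0 : 0 < 40 * (d.+1)%:R * 4 ^+ d :> R by rewrite !mulr_gt0 ?exprn_gt0 // ltr0n.
have tau0 : 0 < tau by rewrite invr_gt0.
have tauC : 40 * (d.+1)%:R * tau * 4 ^+ d <= 1.
  by rewrite mulrAC /tau divff // gt_eqF.
have [eps0 /andP[e00 e01] hprof] := profile_exists halpha hdelta hrho hbeta tau0 tauC.
exists eps0 => // eps omega f eps_lt hdio hf.
have dp := hprof eps eps_lt; have [e0 e1] := andP eps_lt.
have eps01 : 0 < eps < 1 by rewrite e0 (lt_le_trans e1).
have hom : forall i, 0 <= omega 0 i < 1 by case: hdio.
have homd := diophantine_int hdio.
have [sol hsol] := solution_map hd b0 hrho halpha hom homd dp hf.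
pose E x := (sol (potential f omega x)).1; pose psi x := (sol (potential f omega x)).2.
have [fy fp fint fmono] := hf.
have per x : potential f omega (x + 1) = potential f omega x := potential_period omega hf x.
have Eoo x : (E x < +oo)%E.
  have [fx|fx] := eqVneq (f x) -oo%E; first by have [e _] := sol_infty hsol fx; rewrite /E e.
  by have [e [u [_ h _]]] := sol_finite hsol fx; rewrite /E h ltry.
have Eper : periodic1 E by move=> x; rewrite /E per.
have Eint x : E x = -oo%E -> f x = -oo%E.
  have [//|fx] := eqVneq (f x) -oo%E.
  by have [e [u [_ h _]]] := sol_finite hsol fx; rewrite /E h.
have Eh (a x y : R) : 1 <= a -> a <= alpha -> holder_monotone a f -> 0 <= x -> x <= y -> y < 1 ->
    (E x + ((y - x) `^ a)%:E <= E y)%E.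
  exact: (sol_holder hd b0 hrho halpha hom homd dp hf hsol).
exists E, psi; split.
- split => // x y x0 xy y1.
  have h := Eh alpha x y halpha (lexx _) hf x0 (ltW xy) y1.
  have p0 : 0 < (y - x) `^ alpha by rewrite powR_gt0 // subr_gt0.
  move: h; case Ex : (E x) => [r| |].
  + by apply: lt_le_trans; rewrite -EFinD lte_fin ltrDl.
  + by have := Eoo x; rewrite Ex.
  + move=> _; rewrite ltNye; apply/eqP => /Eint/fint[k yk].
    have := lt_le_trans xy (lexx y); move: y1; rewrite yk ltrz1 => k1 xk.
    have : 0 < (k%:~R : R) by exact: le_lt_trans xk.
    by rewrite ltr0z; move: k1; clear; lia.
- split; first by move=> x; rewrite /psi per.
  exact: (sol_measurable hd b0 hrho halpha hom homd dp hf hsol).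
- move=> x; have [fx|fx] := eqVneq (f x) -oo%E.
    have [eE ep] := sol_infty hsol fx; rewrite /E eE.
    exists 0; first by rewrite potential0.
    exists 1 => k; rewrite /psi ep; by case: eqP.
  have [e [u [hb eE ep]]] := sol_finite hsol fx.
  rewrite /E eE /psi.
  have -> : l2_val (sol (potential f omega x)).2 = (fun k => (u k)%:C%C) by apply/funext.
  exact: (bound_state_eigen hd dp hb).
- move=> x; have pe a : 0 < eps `^ a by rewrite powR_gt0.
  have [fx|fx] := eqVneq (f x) -oo%E.
    have [_ ep] := sol_infty hsol fx; rewrite /psi.
    have -> : l2_val (sol (potential f omega x)).2 = (fun k => (k == 0)%:R) by apply/funext.
    split.
    + by rewrite /l2norm l2normsq_delta /= sqrtr1.
    + rewrite eqxx subrr;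
      have -> : modulus (0 : R[i]%C) = 0 by rewrite -[0]/(0%:C%C) modulus_real normr0.
      exact: pe.
    + move=> n n0; have /negPf -> : n != 0 by rewrite -l1norm_eq0; apply/eqP.
      have -> : modulus (0%:R : R[i]%C) = 0 by rewrite -[0%:R]/((0 : R)%:C%C) modulus_real normr0.
      exact: ltW.
  have [e [u [hb eE ep]]] := sol_finite hsol fx; rewrite /psi.
  have -> : l2_val (sol (potential f omega x)).2 = (fun k => (u k)%:C%C) by apply/funext.
  split.
  + by rewrite /l2norm (bound_state_l2normsq hd dp hb) /= sqrtr1.
  + exact: (bound_state_near1 dp hb hdelta eps01).
  + by move=> n _; exact: (bound_state_far hb n hdelta eps01).
(* The gaps are taken with exponent 1, while the decay profile is still the one fixed by [alpha]. *)
- move=> hl; split=> // [x /Eint/fint //|x y x0 xy y1].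
  exact: Eh.
Qed.
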